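(* Let $D\subseteq\mathbb{C}^n$ be a domain and let $\mathcal{F}$ be a family of holomorphic functions $f:D\to\mathbb{C}$. Then $\mathcal{F}$ is normal on $D$ if and only if there exists a set $E\subseteq\mathbb{C}$ containing at least three points such that for each compact subset $K\subset D$ there exists a constant $M(K)>0$ for which $$f^{\sharp}(z)\le M(K)\quad\text{whenever } f\in\mathcal{F},\ z\in K \text{ and } f(z)\in E.$$
   Context: A family $\mathcal{F}$ of holomorphic functions $f:D\to\mathbb{C}$ on a domain $D\subseteq\mathbb{C}^n$ is normal on $D$ if every sequence in $\mathcal{F}$ contains a subsequence that converges locally uniformly on $D$ to a limit function which is either holomorphic on $D$ or identically equal to $\infty$. For a holomorphic function $f$ on $D$ and $z\in D$, the spherical derivative is $$f^{\sharp}(z)=\sup_{|v|=1}\sqrt{L_z(\log(1+|f|^2),v)}=\sup_{|v|=1}\frac{|Df(z)v|}{1+|f(z)|^2},$$ where the supremum is over $v=(v_1,\dots,v_n)\in\mathbb{C}^n$ with Euclidean norm $|v|=1$, $L_z(\psi,v)=\sum_{k,l=1}^n\frac{\partial^2\psi}{\partial z_k\partial\bar z_l}(z)v_k\bar v_l$ is the Levi form of $\psi\in\mathcal{C}^2(D)$ at $z$, and $Df(z)v=\sum_{k=1}^n\frac{\partial f}{\partial z_k}(z)v_k$. *)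

(* Defs.v *)
From HB Require Import structures.
From mathcomp Require Import all_boot all_order all_algebra.
From mathcomp Require Import all_classical all_reals all_analysis.
From mathcomp Require Import complex.

Set Implicit Arguments.
Unset Strict Implicit.
Unset Printing Implicit Defensive.

Import Order.TTheory GRing.Theory Num.Theory.
Import numFieldNormedType.Exports Normc.

Local Open Scope classical_set_scope.
Local Open Scope ring_scope.

(* MathComp-Analysis puts the topology of a numFieldType K on K^o, and on K when
   K is an abstract structure; this makes it available on the concrete R[i]. *)
HB.instance Definition _ (R : realType) := NormedModule.copy R[i] R[i]^o.

Section SeveralComplexVariables.
Context {R : realType} {n : nat}.
Local Notation C := R[i].
Local Notation Cn := 'rV[C]_n.

Implicit Types (D : set Cn) (f g : Cn -> C) (u : nat -> Cn -> C)
  (F : set (Cn -> C)) (z v : Cn).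

Definition is_domain D : Prop := [/\ D !=set0, open D & connected D].

(* Functions on D are represented by total functions of which only the values
   on D matter. Cn is a normed space over C, hence differentiable is complex
   (Frechet) differentiability. *)
Definition holomorphic_on D f : Prop := forall z, D z -> differentiable f z.

Definition locally_uniformly_cvg D u g : Prop :=
  forall z, D z -> exists2 U, nbhs z U &
    {uniform U `&` D, u k @[k --> \oo] --> g}.

Definition locally_uniformly_cvg_infty D u : Prop :=
  forall z, D z -> exists2 U, nbhs z U &
    forall A : R, \forall k \near \oo,
      forall w, (U `&` D) w -> A < normc (u k w).

Definition normal_family D F : Prop :=
  forall u, (forall k, F (u k)) ->
  exists2 phi : nat -> nat, {homo phi : i j / (i < j)%N} &
    (exists2 g, holomorphic_on D g & locally_uniformly_cvg D (u \o phi) g)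
    \/ locally_uniformly_cvg_infty D (u \o phi).

(* The library's norm on 'rV[C]_n is the sup norm, which gives the same topology
   but not the same unit sphere. *)
Definition euclidean_norm v : R := Num.sqrt (\sum_k normc (v 0 k) ^+ 2).

(* D f(z) v; the derivative along delta_mx 0 k is a limit over complex
   increments, i.e. the complex partial derivative in the k-th variable. *)
Definition complex_deriv f z v : C :=
  \sum_k 'D_(delta_mx 0 k) f z * v 0 k.

Definition spherical_derivative f z : R :=
  sup [set normc (complex_deriv f z v) / (1 + normc (f z) ^+ 2)
      | v in [set v | euclidean_norm v = 1]].

End SeveralComplexVariables.

(* Main.v *)
Require Import Defs.
From HB Require Import structures.
From mathcomp Require Import all_boot all_order all_algebra.
From mathcomp Require Import all_classical all_reals all_analysis.
From mathcomp Require Import complex ring lra.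

Import numFieldNormedType.Exports.

Local Open Scope classical_set_scope.
Local Open Scope card_scope.
Local Open Scope ring_scope.

Set Implicit Arguments.
Unset Strict Implicit.
Unset Printing Implicit Defensive.

Import Order.TTheory GRing.Theory Num.Theory.
Import Normc.

(* Suppose the spherical derivatives are bounded at the points with values in E, and let
   a, b, c be three points of E. Then |f'| <= K (1 + |f|^2) on the complex lines near any
   given point of D, with K independent of f in F. Otherwise Zalcman's rescaling and Marty's
   theorem produce an entire g with |g'| <= 2 (1 + |g|^2), g'(0) <> 0 and g' = 0 wherever g
   is a, b or c. Put P(x) = (x - a)(x - b)(x - c). Then h = g'^2 / P(g) is entire, and
   2 h g'' = h' g' + h^2 P'(g); the function 1/g satisfies the analogous relations, where it
   is defined. The derivatives of g, where |g| <= 1, and of 1/g, where |g| >= 1, are bounded,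
   and P and P' have no common zero, so these relations bound h. Hence h is a nonzero
   constant. Where |g| is huge, 1/g is therefore nearly a quadratic polynomial with leading
   coefficient h/4, so it is bounded below on a small square around the point, which bounds g
   at that point: a contradiction.
   The bound |f'| <= K (1 + |f|^2) makes F equicontinuous for the chordal metric, hence
   normal; by Hurwitz's theorem, applied to 1/f on complex lines, the set where a limit is
   infinite is open, and so is its complement.
   Conversely let F be normal and E = {0, 1, 2}. If the spherical derivatives of f_k at
   points z_k of a compact set with f_k(z_k) in E were unbounded, then near a limit point of
   (z_k) a subsequence of f_k would either tend to infinity, which excludes values in E, or
   converge to a finite limit, and then Cauchy's estimate bounds the derivatives. *)

(** * Complex derivatives *)

(** The function h is the pull-back by g of the quadratic differential dw^2 / P(w), whose only poles
    on the sphere are a, b, c and infinity, all simple. A simple pole becomes harmless under a map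
    ramified there, and an entire g omits infinity: hence h is entire. If h is a nonzero constant, g
    solves an equation of Weierstrass type, whose solutions reach infinity within a finite distance;
    this stands in for Nevanlinna's second main theorem. The obstacle is that h' enters the bound
    for h and nothing controls it a priori; it is controlled at a maximum point of |h| times a
    weight vanishing on the boundary of a disc, by the same device as in Zalcman's rescaling. The
    function theory rests on rectangle contours and never needs sharp constants. The integral of the
    Cauchy kernel is only bounded below, by 4 in place of 2 pi. This yields a maximum principle with
    the constant 4 ([le_center]) and Cauchy's estimate with the constant 24 ([le_cder]); these two
    replace power series, the argument principle and the sharp maximum principle. In several
    variables all estimates are made on complex lines, uniformly in the direction. *)

Section Modulus.
Context {R : realType}.
Local Open Scope complex_scope.
Local Open Scope ring_scope.
Local Notation C := R[i].
Local Notation Re := (@complex.Re R).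
Local Notation Im := (@complex.Im R).
Implicit Types (x y z w : C) (r e : R).

Lemma normc_ge0 z : 0 <= normc z.
Proof. by case: z => a b; exact: sqrtr_ge0. Qed.

Lemma normcB z w : normc (z - w) = normc (w - z).
Proof. by rewrite -opprB normcN. Qed.

Lemma normc_eq0 z : (normc z == 0) = (z == 0).
Proof. by apply/eqP/eqP => [/eq0_normc //|->]; exact: normc0. Qed.

Lemma normc_gt0 z : (0 < normc z) = (z != 0).
Proof. by rewrite lt_neqAle normc_ge0 andbT eq_sym normc_eq0. Qed.

Lemma le_normcB z w : normc (z - w) <= normc z + normc w.
Proof. by rewrite -(normcN w) le_normcD. Qed.

Lemma le_normc_sub z w : normc z - normc w <= normc (z - w).
Proof. by rewrite lerBlDr; apply: le_trans (le_normcD _ _); rewrite subrK. Qed.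

Lemma normc_dist_trans w z x : normc (z - x) <= normc (z - w) + normc (w - x).
Proof. by apply: le_trans (le_normcD _ _); rewrite addrA subrK. Qed.

Lemma normcX z n : normc (z ^+ n) = normc z ^+ n.
Proof. by elim: n => [|n IH]; rewrite ?expr0 ?normc1// !exprS normcM IH. Qed.

Lemma normc_real r : normc r%:C = `|r|.
Proof. by rewrite /= expr0n addr0 sqrtr_sqr. Qed.

Lemma normci : normc ('i : C) = 1.
Proof. by rewrite /= expr0n add0r expr1n sqrtr1. Qed.

Lemma normc_nat n : normc (n%:R : C) = n%:R.
Proof. by rewrite -[n%:R](rmorph_nat (real_complex R)) normc_real ger0_norm. Qed.

Lemma normc_sqr z : normc z ^+ 2 = Re z ^+ 2 + Im z ^+ 2.
Proof. by case: z => a b; rewrite /= sqr_sqrtr// addr_ge0 ?sqr_ge0. Qed.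

Lemma normRe_le z : `|Re z| <= normc z.
Proof.
rewrite -(@ler_pXn2r _ 2) ?nnegrE ?normc_ge0// normc_sqr real_normK ?num_real//.
by rewrite lerDl sqr_ge0.
Qed.

Lemma normIm_le z : `|Im z| <= normc z.
Proof.
rewrite -(@ler_pXn2r _ 2) ?nnegrE ?normc_ge0// normc_sqr real_normK ?num_real//.
by rewrite lerDr sqr_ge0.
Qed.

Lemma normc_le_ReIm z : normc z <= `|Re z| + `|Im z|.
Proof.
rewrite {1}[z]complexE; apply: le_trans (le_normcD _ _) _.
by rewrite normcM normci mul1r !normc_real.
Qed.

Lemma normc_lt_eq0 z : (forall e, 0 < e -> normc z <= e) -> z = 0.
Proof.
move=> h; apply: eq0_normc; apply/eqP; rewrite eq_le normc_ge0 andbT.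
by apply/ler_addgt0Pr => e e0; rewrite add0r h.
Qed.

End Modulus.

Section ComplexDerivative.
Context {R : realType}.
Local Open Scope complex_scope.
Local Open Scope ring_scope.
Local Notation C := R[i].
Local Notation Re := (@complex.Re R).
Local Notation Im := (@complex.Im R).
Implicit Types (f g q : C -> C) (z w l m h : C) (r e d : R).

(** The library's norm on [R[i]] is itself complex-valued; real radii through [normc] keep all
    estimates within real arithmetic. *)
Definition ccont f z := forall e, 0 < e ->
  exists2 d, 0 < d & forall w, normc (w - z) < d -> normc (f w - f z) < e.

Lemma ccont_cst l z : ccont (fun=> l) z.
Proof. by move=> e e0; exists 1 => // w _; rewrite subrr normc0. Qed.

Lemma ccont_id z : ccont id z.
Proof. by move=> e e0; exists e. Qed.

Lemma ccontD f g z : ccont f z -> ccont g z -> ccont (fun w => f w + g w) z.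
Proof.
move=> cf cg e e0; have e2 : 0 < e / 2 by lra.
have [d d0 hd] := cf _ e2; have [c c0 hc] := cg _ e2.
exists (Num.min d c) => [|w]; rewrite ?lt_min ?d0// => /andP[/hd h1 /hc h2].
rewrite opprD addrACA; apply: le_lt_trans (le_normcD _ _) _; lra.
Qed.

Lemma ccontM f g z : ccont f z -> ccont g z -> ccont (fun w => f w * g w) z.
Proof.
move=> cf cg e e0; pose A := normc (f z) + normc (g z) + 1.
have A0 : 0 < A by have := normc_ge0 (f z); have := normc_ge0 (g z); rewrite /A; lra.
have e2 : 0 < Num.min 1 (e / (2 * A)) by rewrite lt_min ltr01 divr_gt0// mulr_gt0.
have [d d0 hd] := cf _ e2; have [c c0 hc] := cg _ e2.
exists (Num.min d c) => [|w]; rewrite ?lt_min ?d0//.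
move=> /andP[/hd + /hc]; rewrite !lt_min => /andP[h1 h2] /andP[h3 h4].
have -> : f w * g w - f z * g z =
  (f w - f z) * (g w - g z) + (f w - f z) * g z + f z * (g w - g z) by ring.
apply: le_lt_trans (le_normcD _ _) _.
apply: le_lt_trans (lerD (le_normcD _ _) (lexx _)) _; rewrite !normcM.
set p := normc (f w - f z) in h1 h2 *; set s := normc (g w - g z) in h3 h4 *.
have p0 : 0 <= p by exact: normc_ge0.
have s0 : 0 <= s by exact: normc_ge0.
have a0 := normc_ge0 (f z); have b0 := normc_ge0 (g z).
have : Num.max p s * A < e.
  have : Num.max p s < e / (2 * A) by rewrite gt_max h2 h4.
  rewrite ltr_pdivlMr ?mulr_gt0//; have : 0 <= Num.max p s * A.
    by rewrite mulr_ge0 ?(ltW A0)// le_max p0.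
  lra.
apply: le_lt_trans; have m1 : p <= Num.max p s by rewrite le_max lexx.
have m2 : s <= Num.max p s by rewrite le_max lexx orbT.
have u1 : p * s <= Num.max p s * 1 by apply: ler_pM => //; exact: ltW.
have u2 : p * normc (g z) <= Num.max p s * normc (g z) by exact: ler_wpM2r.
have u3 : normc (f z) * s <= normc (f z) * Num.max p s by exact: ler_wpM2l.
rewrite /A; lra.
Qed.

Lemma ccontV f z : f z != 0 -> ccont f z -> ccont (fun w => (f w)^-1) z.
Proof.
move=> fzn0; have := fzn0; rewrite -normc_gt0 => fz0 cf e e0; set a := normc (f z) in fz0.
have e2 : 0 < Num.min (a / 2) (e * a * a / 4).
  by rewrite lt_min !divr_gt0// !mulr_gt0.
have [d d0 hd] := cf _ e2; exists d => // w /hd; rewrite lt_min => /andP[h1 h2].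
have fw : a / 2 < normc (f w).
  by have := le_normc_sub (f z) (f w); rewrite normcB -/a; lra.
have fw0 : f w != 0 by rewrite -normc_gt0; lra.
have -> : (f w)^-1 - (f z)^-1 = (f z - f w) / (f w * f z).
  by field; rewrite fw0 fzn0.
rewrite normcM normcV normcM normcB -/a ltr_pdivrMr; last by nra.
apply: lt_le_trans h2 _.
have ea := mulr_gt0 e0 fz0; have eaa := mulr_gt0 ea fz0.
have : 0 < e * a * (normc (f w) - a / 2) by rewrite mulr_gt0// subr_gt0.
lra.
Qed.

Lemma ccont_comp f g z : ccont g z -> ccont f (g z) -> ccont (fun w => f (g w)) z.
Proof.
move=> cg cf e /cf[d /cg[c c0 hc] hd].
by exists c => // w /hc /hd.
Qed.

Lemma ccontN f z : ccont f z -> ccont (fun w => - f w) z.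
Proof. by move=> cf e /cf[d d0 hd]; exists d => // w /hd; rewrite -opprD normcN. Qed.

Lemma ccontB f g z : ccont f z -> ccont g z -> ccont (fun w => f w - g w) z.
Proof. by move=> cf /ccontN; exact: ccontD. Qed.

Lemma ccont_ext f g z r : 0 < r -> (forall w, normc (w - z) < r -> f w = g w) ->
  ccont f z -> ccont g z.
Proof.
move=> r0 fg cf e /cf[d d0 hd]; exists (Num.min d r) => [|w]; rewrite lt_min ?d0//.
by move=> /andP[/hd h1 h2]; rewrite -!fg// subrr normc0.
Qed.

Lemma ccont_neq0 f z : ccont f z -> f z != 0 ->
  exists2 d, 0 < d & forall w, normc (w - z) < d -> normc (f z) / 2 < normc (f w).
Proof.
move=> cf; rewrite -normc_gt0 => fz0.
have [d d0 hd] := cf _ (divr_gt0 fz0 (ltr0Sn _ 1)); exists d => // w /hd.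
by have := le_normc_sub (f z) (f w); rewrite normcB; lra.
Qed.

Lemma ccont_norm f z : ccont f z -> ccont (fun w => (normc (f w))%:C) z.
Proof.
move=> cf e /cf[d d0 hd]; exists d => // w /hd; apply: le_lt_trans.
rewrite -rmorphB normc_real ler_norml le_normc_sub andbT.
by have := le_normc_sub (f z) (f w); rewrite [normc (f z - _)]normcB; lra.
Qed.

(* Caratheodory's form of the complex derivative: the difference quotient extends continuously. *)
Definition cder f z l := exists q : C -> C,
  [/\ forall h, f (z + h) = f z + q h * h, ccont q 0 & q 0 = l].

Lemma cder_eps f z l e : cder f z l -> 0 < e -> exists2 d, 0 < d &
  forall h, normc h < d -> normc (f (z + h) - f z - l * h) <= e * normc h.
Proof.
move=> [q [fq cq <-]] /cq[d d0 hd]; exists d => // h hh.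
have -> : f (z + h) - f z - q 0 * h = (q h - q 0) * h by rewrite fq; ring.
by rewrite normcM ler_wpM2r ?normc_ge0// ltW// hd// subr0.
Qed.

Lemma eps_cder f z l : (forall e, 0 < e -> exists2 d, 0 < d &
  forall h, normc h < d -> normc (f (z + h) - f z - l * h) <= e * normc h) ->
  cder f z l.
Proof.
move=> H; exists (fun h => if h == 0 then l else (f (z + h) - f z) / h).
split; last by rewrite eqxx.
  move=> h; case: eqVneq => [->|h0]; first by rewrite mulr0 !addr0.
  by rewrite mulfVK// [RHS]addrC subrK.
move=> e e0; have [d d0 hd] := H (e / 2) ltac:(lra); exists d => // h.
rewrite subr0 eqxx; case: eqVneq => [->|h0 /hd]; first by rewrite subrr normc0.
have h0' : 0 < normc h by rewrite normc_gt0.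
have -> : (f (z + h) - f z) / h - l = (f (z + h) - f z - l * h) / h by field.
rewrite [normc (_ / _)]normcM normcV -ler_pdivrMr// => H2.
by apply: le_lt_trans H2 _; lra.
Qed.

Lemma cder_uniq f z l m : cder f z l -> cder f z m -> l = m.
Proof.
move=> fl fm; apply: subr0_eq; apply: normc_lt_eq0 => e e0.
have e2 : 0 < e / 2 by lra.
have [d d0 hd] := cder_eps fl e2; have [c c0 hc] := cder_eps fm e2.
pose t := Num.min d c / 2; have t0 : 0 < t by rewrite divr_gt0// lt_min d0.
have md : Num.min d c <= d by rewrite ge_min lexx.
have mc : Num.min d c <= c by rewrite ge_min lexx orbT.
have td : t < d by rewrite /t; rewrite /t in t0; lra.
have tc : t < c by rewrite /t; rewrite /t in t0; lra.
have nt : normc t%:C = t by rewrite normc_real gtr0_norm.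
have := hd t%:C; have := hc t%:C; rewrite nt => /(_ tc) h1 /(_ td) h2.
have : normc ((l - m) * t%:C) <= e * t.
  have -> : (l - m) * t%:C = (f (z + t%:C) - f z - m * t%:C) -
     (f (z + t%:C) - f z - l * t%:C) by ring.
  by apply: le_trans (le_normcB _ _) _; lra.
by rewrite normcM nt ler_pM2r.
Qed.

Lemma cder_ccont f z l : cder f z l -> ccont f z.
Proof.
move=> [q [fq cq _]].
have c1 : ccont (fun w => f z + q (w - z) * (w - z)) z.
  have cz : ccont (fun w => w - z) z by apply: ccontB; [exact: ccont_id|exact: ccont_cst].
  apply: ccontD; first exact: ccont_cst.
  by apply: ccontM => //; apply: (ccont_comp cz); rewrite subrr.
by apply: ccont_ext ltr01 _ c1 => w _; rewrite -fq addrC subrK.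
Qed.

Lemma cder_ext f g z l r : 0 < r -> (forall w, normc (w - z) < r -> f w = g w) ->
  cder f z l -> cder g z l.
Proof.
move=> r0 fg fl; apply: eps_cder => e /(cder_eps fl)[d d0 hd].
exists (Num.min d r) => [|h]; rewrite lt_min ?d0// => /andP[/hd h1 h2].
rewrite -!fg// ?subrr ?normc0//; last by rewrite addrC addKr.
Qed.

Lemma cder_eq f z l m : cder f z l -> l = m -> cder f z m.
Proof. by move=> ? <-. Qed.

Lemma cder_cst m z : cder (fun=> m) z 0.
Proof. by exists (fun=> 0); split => // [h|]; [rewrite mul0r addr0|exact: ccont_cst]. Qed.

Lemma cder_id z : cder id z 1.
Proof. by exists (fun=> 1); split => // [h|]; [rewrite mul1r|exact: ccont_cst]. Qed.

Lemma cderD f g z l m : cder f z l -> cder g z m -> cder (fun w => f w + g w) z (l + m).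
Proof.
move=> [p [fp cp <-]] [q [gq cq <-]]; exists (fun h => p h + q h); split => //.
  by move=> h; rewrite fp gq; ring.
exact: ccontD.
Qed.

Lemma cderM f g z l m : cder f z l -> cder g z m ->
  cder (fun w => f w * g w) z (l * g z + f z * m).
Proof.
move=> fl gm; have cg := cder_ccont gm.
move: fl gm => [p [fp cp <-]] [q [gq cq <-]].
exists (fun h => p h * g (z + h) + f z * q h); split; last by rewrite addr0.
  by move=> h; rewrite fp gq; ring.
apply: ccontD; apply: ccontM => //; last exact: ccont_cst.
apply: (@ccont_comp g (fun h => z + h)); last by rewrite addr0.
by apply: ccontD; [exact: ccont_cst|exact: ccont_id].
Qed.

Lemma cderV f z l : f z != 0 -> cder f z l -> cder (fun w => (f w)^-1) z (- l / f z ^+ 2).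
Proof.
move=> fz0 fl; have cf := cder_ccont fl.
have [d d0 hd] := ccont_neq0 cf fz0.
have fw0 h : normc h < d -> f (z + h) != 0.
  move=> hh; rewrite -normc_gt0; apply: le_lt_trans (hd _ _).
    by rewrite divr_ge0// normc_ge0.
  by rewrite addrC addKr.
move: fl => [p [fp cp <-]].
apply: eps_cder => e e0.
pose q h := - p h / (f (z + h) * f z).
have cq : ccont q 0.
  have cfz : ccont (fun h => f (z + h)) 0.
    apply: (@ccont_comp f (fun h => z + h)); last by rewrite addr0.
    by apply: ccontD; [exact: ccont_cst|exact: ccont_id].
  apply: ccontM; first exact: ccontN.
  apply: ccontV; first by rewrite addr0 mulf_neq0.
  by apply: ccontM => //; exact: ccont_cst.
have [c c0 hc] := cq e e0; exists (Num.min d c) => [|h]; rewrite lt_min ?d0// => /andP[h1 h2].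
have -> : (f (z + h))^-1 - (f z)^-1 - - p 0 / f z ^+ 2 * h = (q h - q 0) * h.
  have fh0 := fw0 _ h1.
  have -> : (q h - q 0) * h = - (p h * h) / (f (z + h) * f z) + p 0 / (f z * f z) * h.
    by rewrite /q addr0; ring.
  have -> : p h * h = f (z + h) - f z by rewrite fp; ring.
  by field; rewrite fh0 fz0.
by rewrite normcM ler_wpM2r ?normc_ge0// ltW// hc// subr0.
Qed.

Lemma cder_comp f g z l m : cder g z m -> cder f (g z) l -> cder (fun w => f (g w)) z (l * m).
Proof.
move=> [q [gq cq <-]] [p [fp cp <-]].
exists (fun h => p (q h * h) * q h); split; last by rewrite mulr0.
  by move=> h; rewrite gq fp mulrA.
apply: ccontM => //; apply: (@ccont_comp p (fun h => q h * h)); last by rewrite mulr0.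
by apply: ccontM => //; exact: ccont_id.
Qed.

Lemma cderN f z l : cder f z l -> cder (fun w => - f w) z (- l).
Proof.
move=> [p [fp cp <-]]; exists (fun h => - p h); split => //; last exact: ccontN.
by move=> h; rewrite fp; ring.
Qed.

Lemma cderB f g z l m : cder f z l -> cder g z m -> cder (fun w => f w - g w) z (l - m).
Proof. by move=> fl /cderN; exact: cderD. Qed.

Lemma cderZ (m : C) f z l : cder f z l -> cder (fun w => m * f w) z (m * l).
Proof. by move=> /(cderM (cder_cst m z)) /cder_eq; apply; rewrite mul0r add0r. Qed.

Lemma cder_affine (a b : C) z : cder (fun w => a + b * w) z b.
Proof.
have := cderD (cder_cst a z) (cderZ b (cder_id z)).
by move=> /cder_eq; apply; rewrite add0r mulr1.
Qed.

Lemma cder_shift f (a b : C) z l : cder f (a + b * z) l -> cder (fun w => f (a + b * w)) z (l * b).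
Proof. exact: (@cder_comp f (fun w => a + b * w) z l b (cder_affine a b z)). Qed.

(* [deriv1 f z] is 0 when f is not differentiable at z. *)
Definition deriv1 f z := xget 0 [set l | cder f z l].

Lemma deriv1E f z l : cder f z l -> deriv1 f z = l.
Proof.
move=> fl; rewrite /deriv1; case: xgetP => [y _ /cder_uniq|/(_ l) //]; exact.
Qed.

Definition hol f z r := forall w, normc (w - z) < r -> exists l, cder f w l.

Lemma hol_deriv1 f z r w : hol f z r -> normc (w - z) < r -> cder f w (deriv1 f w).
Proof. by move=> hf /hf[l fl]; rewrite (deriv1E fl). Qed.

Lemma hol_sub f z r w s : normc (w - z) + s <= r -> hol f z r -> hol f w s.
Proof.
move=> H hf v hv; apply: hf; apply: le_lt_trans (normc_dist_trans w _ _) _; lra.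
Qed.

End ComplexDerivative.

(** * Contour integrals and Cauchy's estimates *)

Section ContourIntegral.
Context {R : realType}.
Local Open Scope complex_scope.
Local Open Scope ring_scope.
Local Notation C := R[i].
Local Notation Re := (@complex.Re R).
Local Notation Im := (@complex.Im R).
Local Notation mu := (@lebesgue_measure R).
Implicit Types (p q : R -> C) (f g : C -> C) (a b r t s M : R) (z w l m k : C).

(** The point [s] is not confined to the segment, so continuity is two-sided at the end points; it
    is obtained from continuity in the plane at each point of the contour. *)
Definition path_continuous p a b := forall t, a <= t <= b -> forall e, 0 < e ->
  exists2 d, 0 < d & forall s, `|s - t| < d -> normc (p s - p t) < e.

Definition cint p a b : C :=
  (\int[mu]_(t in `[a, b]) Re (p t)) +i* (\int[mu]_(t in `[a, b]) Im (p t)).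

Lemma path_continuous_integrable p a b (c : C -> R) :
  (forall z w, `|c z - c w| <= normc (z - w)) -> path_continuous p a b ->
  mu.-integrable `[a, b] (EFin \o (fun t => c (p t))).
Proof.
move=> cl cp; apply: continuous_compact_integrable; first exact: segment_compact.
apply: continuous_in_subspaceT => t; rewrite inE/= in_itv/= => tab.
apply/cvgrPdist_lt => e e0; have [d d0 hd] := cp _ tab _ e0.
apply/nbhs_ballP; exists d => //= s; rewrite /ball/= => ts.
by apply: le_lt_trans (cl _ _) _; rewrite normcB hd// distrC.
Qed.

Lemma Re_lip z w : `|Re z - Re w| <= normc (z - w).
Proof. by rewrite -raddfB normRe_le. Qed.

Lemma Im_lip z w : `|Im z - Im w| <= normc (z - w).
Proof. by rewrite -raddfB normIm_le. Qed.

Let iRe p a b (cp : path_continuous p a b) := path_continuous_integrable Re_lip cp.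
Let iIm p a b (cp : path_continuous p a b) := path_continuous_integrable Im_lip cp.

Lemma path_continuous_cst k a b : path_continuous (fun=> k) a b.
Proof. by move=> t _ e e0; exists 1 => // s _; rewrite subrr normc0. Qed.

Lemma path_continuousB p q a b : path_continuous p a b -> path_continuous q a b ->
  path_continuous (fun t => p t - q t) a b.
Proof.
move=> cp cq t tab e e0; have e2 : 0 < e / 2 by lra.
have [d d0 hd] := cp _ tab _ e2; have [c c0 hc] := cq _ tab _ e2.
exists (Num.min d c) => [|s]; rewrite lt_min ?d0// => /andP[/hd h1 /hc h2].
have -> : p s - q s - (p t - q t) = (p s - p t) - (q s - q t) by ring.
by apply: le_lt_trans (le_normcB _ _) _; lra.
Qed.

Lemma cint_chasles p a x b : a <= x -> x <= b -> path_continuous p a b ->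
  cint p a b = cint p a x + cint p x b.
Proof.
have key (c : C -> R) : (forall z w, `|c z - c w| <= normc (z - w)) ->
  a <= x -> x <= b -> path_continuous p a b ->
  \int[mu]_(t in `[a, b]) c (p t) =
  \int[mu]_(t in `[a, x]) c (p t) + \int[mu]_(t in `[x, b]) c (p t).
  move=> cl ax xb cp; have ip := path_continuous_integrable cl cp.
  have := Rintegral_itvB ip (x := x); rewrite !bnd_simp => /(_ ax xb).
  rewrite Rintegral_itv_obnd_cbnd => [<-|]; first by rewrite addrC subrK.
  by apply: integrableS ip => //; apply: subset_itvr; rewrite bnd_simp.
move=> ax xb cp; rewrite /cint (key _ Re_lip ax xb cp) (key _ Im_lip ax xb cp).
by apply/eqP; rewrite eq_complex /= !eqxx.
Qed.

Lemma cintB p q a b : path_continuous p a b -> path_continuous q a b ->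
  cint (fun t => p t - q t) a b = cint p a b - cint q a b.
Proof.
move=> cp cq; rewrite /cint; under eq_Rintegral do rewrite raddfB/=.
under [X in _ +i* X]eq_Rintegral do rewrite raddfB/=.
by rewrite !RintegralB//; do ?[exact: iRe|exact: iIm].
Qed.

Lemma cintZ k p a b : path_continuous p a b -> cint (fun t => k * p t) a b = k * cint p a b.
Proof.
move=> cp; rewrite /cint.
have mZ (x : R) (c : R -> R) : mu.-integrable `[a, b] (EFin \o c) ->
    mu.-integrable `[a, b] (EFin \o (fun t => x * c t)).
  by move=> ic; apply: eq_integrable (integrableZl _ x ic).
have hr := iRe cp; have hi := iIm cp.
have E1 : \int[mu]_(t in `[a, b]) Re (k * p t) =
    Re k * \int[mu]_(t in `[a, b]) Re (p t) - Im k * \int[mu]_(t in `[a, b]) Im (p t).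
  transitivity (\int[mu]_(t in `[a, b]) (Re k * Re (p t) - Im k * Im (p t))).
    by apply: eq_Rintegral => t _; case: (k) (p t) => ? ? [].
  by rewrite RintegralB//; try exact: mZ; rewrite !RintegralZl.
have E2 : \int[mu]_(t in `[a, b]) Im (k * p t) =
    Re k * \int[mu]_(t in `[a, b]) Im (p t) + Im k * \int[mu]_(t in `[a, b]) Re (p t).
  transitivity (\int[mu]_(t in `[a, b]) (Re k * Im (p t) + Im k * Re (p t))).
    by apply: eq_Rintegral => t _; case: (k) (p t) => ? ? [].
  by rewrite RintegralD//; try exact: mZ; rewrite !RintegralZl.
by rewrite E1 E2; case: (k).
Qed.

Lemma Rintegral_segment_cst a b (x : R) : a <= b -> \int[mu]_(t in `[a, b]) x = x * (b - a).
Proof.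
move=> ab; rewrite Rintegral_cst//=; rewrite lebesgue_measure_itv/= lte_fin; case: ltP => ab'.
  by rewrite -EFinB.
by rewrite (@le_anti _ _ a b) ?ab//= subrr !mulr0.
Qed.

Lemma Rintegral_segment_bounds (c : R -> R) a b x y : a <= b ->
  mu.-integrable `[a, b] (EFin \o c) ->
  (forall t, a <= t <= b -> x <= c t <= y) ->
  x * (b - a) <= \int[mu]_(t in `[a, b]) c t <= y * (b - a).
Proof.
move=> ab ic hc; rewrite -!(Rintegral_segment_cst _ ab).
have icst (k : R) : mu.-integrable `[a, b] (EFin \o (fun=> k)).
  have := path_continuous_integrable Re_lip (@path_continuous_cst k%:C a b).
  by congr (integrable _ _ _).
apply/andP; split; apply: le_Rintegral => // t; rewrite /= in_itv/= => /hc /andP[] //.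
Qed.

(** Real and imaginary parts are bounded separately, whence the factor 2. *)
Lemma le_cint p a b M : a <= b -> path_continuous p a b ->
  (forall t, a <= t <= b -> normc (p t) <= M) -> normc (cint p a b) <= 2 * M * (b - a).
Proof.
move=> ab cp hM.
have key (c : C -> R) : (forall z w, `|c z - c w| <= normc (z - w)) ->
    (forall z, `|c z| <= normc z) -> `|\int[mu]_(t in `[a, b]) c (p t)| <= M * (b - a).
  move=> cl cn; rewrite ler_norml -mulNr.
  apply: Rintegral_segment_bounds => //; first exact: path_continuous_integrable.
  by move=> t tab; rewrite -ler_norml; apply: le_trans (cn _) (hM _ tab).
apply: le_trans (normc_le_ReIm _) _ => /=.
by have := key _ Re_lip (@normRe_le R); have := key _ Im_lip (@normIm_le R); lra.
Qed.

Lemma cint_cst k a b : a <= b -> cint (fun=> k) a b = k * (b - a)%:C.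
Proof.
move=> ab; rewrite /cint !Rintegral_segment_cst//; case: k => x y.
by apply/eqP; rewrite eq_complex /= !mulr0 subr0 add0r !eqxx.
Qed.

Lemma eq_cint p q a b : (forall t, a <= t <= b -> p t = q t) -> cint p a b = cint q a b.
Proof.
move=> pq; congr (_ +i* _); apply: eq_Rintegral => t; rewrite inE/= in_itv/= => tab;
  by rewrite pq.
Qed.

(** The counterclockwise boundary integral of f(z) dz, with dz = i dy on the vertical sides. *)
Definition contour f x0 x1 y0 y1 : C :=
  (cint (fun t => f (t +i* y0)) x0 x1 - cint (fun t => f (t +i* y1)) x0 x1)
  + 'i * (cint (fun t => f (x1 +i* t)) y0 y1 - cint (fun t => f (x0 +i* t)) y0 y1).

Definition hcont f x0 x1 y := forall x, x0 <= x <= x1 -> ccont f (x +i* y).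
Definition vcont f y0 y1 x := forall y, y0 <= y <= y1 -> ccont f (x +i* y).

Lemma hcont_path f x0 x1 y : hcont f x0 x1 y -> path_continuous (fun t => f (t +i* y)) x0 x1.
Proof.
move=> hf t tx e /(hf _ tx)[d d0 hd]; exists d => // s st; apply: hd.
have -> : (s +i* y) - (t +i* y) = (s - t)%:C.
  by apply/eqP; rewrite eq_complex /= subrr !eqxx.
by rewrite normc_real.
Qed.

Lemma vcont_path f y0 y1 x : vcont f y0 y1 x -> path_continuous (fun t => f (x +i* t)) y0 y1.
Proof.
move=> hf t tx e /(hf _ tx)[d d0 hd]; exists d => // s st; apply: hd.
have -> : (x +i* s) - (x +i* t) = 'i * (s - t)%:C.
  by apply/eqP; rewrite eq_complex /= !mul0r !mul1r !subrr add0r !eqxx.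
by rewrite normcM normci mul1r normc_real.
Qed.

Lemma contour_vcut f x0 x x1 y0 y1 : x0 <= x -> x <= x1 ->
  hcont f x0 x1 y0 -> hcont f x0 x1 y1 ->
  contour f x0 x1 y0 y1 = contour f x0 x y0 y1 + contour f x x1 y0 y1.
Proof.
move=> a b /hcont_path c0 /hcont_path c1.
by rewrite /contour (cint_chasles a b c0) (cint_chasles a b c1); ring.
Qed.

Lemma contour_hcut f x0 x1 y0 y y1 : y0 <= y -> y <= y1 ->
  vcont f y0 y1 x0 -> vcont f y0 y1 x1 ->
  contour f x0 x1 y0 y1 = contour f x0 x1 y0 y + contour f x0 x1 y y1.
Proof.
move=> a b /vcont_path c0 /vcont_path c1.
by rewrite /contour (cint_chasles a b c0) (cint_chasles a b c1); ring.
Qed.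

Definition on_rect (x0 x1 y0 y1 : R) z := (x0 <= Re z <= x1) && (y0 <= Im z <= y1).

Definition on_boundary (x0 x1 y0 y1 : R) z := on_rect x0 x1 y0 y1 z &&
  [|| Re z == x0, Re z == x1, Im z == y0 | Im z == y1].

Lemma boundary_conts f x0 x1 y0 y1 : x0 <= x1 -> y0 <= y1 ->
  (forall z, on_boundary x0 x1 y0 y1 z -> ccont f z) ->
  [/\ hcont f x0 x1 y0, hcont f x0 x1 y1, vcont f y0 y1 x0 & vcont f y0 y1 x1].
Proof.
move=> hx hy H; split=> t ht; apply: H;
  by rewrite /on_boundary /on_rect /= ht eqxx ?orbT ?lexx ?hx ?hy.
Qed.

Lemma contourB f g x0 x1 y0 y1 : x0 <= x1 -> y0 <= y1 ->
  (forall z, on_boundary x0 x1 y0 y1 z -> ccont f z) ->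
  (forall z, on_boundary x0 x1 y0 y1 z -> ccont g z) ->
  contour (fun z => f z - g z) x0 x1 y0 y1 = contour f x0 x1 y0 y1 - contour g x0 x1 y0 y1.
Proof.
move=> hx hy /(boundary_conts hx hy)[/hcont_path a1 /hcont_path a2 /vcont_path a3 /vcont_path a4].
move=> /(boundary_conts hx hy)[/hcont_path b1 /hcont_path b2 /vcont_path b3 /vcont_path b4].
by rewrite /contour !cintB//; ring.
Qed.

Lemma contourZ k f x0 x1 y0 y1 : x0 <= x1 -> y0 <= y1 ->
  (forall z, on_boundary x0 x1 y0 y1 z -> ccont f z) ->
  contour (fun z => k * f z) x0 x1 y0 y1 = k * contour f x0 x1 y0 y1.
Proof.
move=> hx hy /(boundary_conts hx hy)[/hcont_path a1 /hcont_path a2 /vcont_path a3 /vcont_path a4].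
by rewrite /contour !cintZ//; ring.
Qed.

Lemma le_contour f x0 x1 y0 y1 M : x0 <= x1 -> y0 <= y1 ->
  (forall z, on_boundary x0 x1 y0 y1 z -> ccont f z) ->
  (forall z, on_boundary x0 x1 y0 y1 z -> normc (f z) <= M) ->
  normc (contour f x0 x1 y0 y1) <= 4 * M * ((x1 - x0) + (y1 - y0)).
Proof.
move=> hx hy /(boundary_conts hx hy)[/hcont_path a1 /hcont_path a2 /vcont_path a3 /vcont_path a4] H.
have h1 : normc (cint (fun t => f (t +i* y0)) x0 x1) <= 2 * M * (x1 - x0).
  by apply: le_cint => // t ht; apply: H; rewrite /on_boundary /on_rect /= ht eqxx ?orbT ?lexx ?hx ?hy.
have h2 : normc (cint (fun t => f (t +i* y1)) x0 x1) <= 2 * M * (x1 - x0).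
  by apply: le_cint => // t ht; apply: H; rewrite /on_boundary /on_rect /= ht eqxx ?orbT ?lexx ?hx ?hy.
have h3 : normc (cint (fun t => f (x0 +i* t)) y0 y1) <= 2 * M * (y1 - y0).
  by apply: le_cint => // t ht; apply: H; rewrite /on_boundary /on_rect /= ht eqxx ?orbT ?lexx ?hx ?hy.
have h4 : normc (cint (fun t => f (x1 +i* t)) y0 y1) <= 2 * M * (y1 - y0).
  by apply: le_cint => // t ht; apply: H; rewrite /on_boundary /on_rect /= ht eqxx ?orbT ?lexx ?hx ?hy.
rewrite /contour; apply: le_trans (le_normcD _ _) _; rewrite normcM normci mul1r.
apply: le_trans (lerD (le_normcB _ _) (le_normcB _ _)) _; lra.
Qed.

Lemma contour_affine k l x0 x1 y0 y1 : x0 <= x1 -> y0 <= y1 ->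
  contour (fun z => k + l * z) x0 x1 y0 y1 = 0.
Proof.
move=> hx hy; have cf z : ccont (fun z => k + l * z) z.
  exact: cder_ccont (cder_affine _ _ _).
have ch y : path_continuous (fun t => k + l * (t +i* y)) x0 x1.
  by apply: (@hcont_path (fun z => k + l * z)) => ? _; exact: cf.
have cv x : path_continuous (fun t => k + l * (x +i* t)) y0 y1.
  by apply: (@vcont_path (fun z => k + l * z)) => ? _; exact: cf.
rewrite /contour -!cintB//.
rewrite (@eq_cint _ (fun=> l * 'i * (y0 - y1)%:C)) => [|t _]; last first.
  have -> : forall u v : C, k + l * u - (k + l * v) = l * (u - v) by move=> u v; ring.
  rewrite -mulrA; congr (_ * _).
  by apply/eqP; rewrite eq_complex /= !mul0r !mul1r !subrr add0r !eqxx.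
rewrite (@eq_cint (fun t => k + l * (x1 +i* t) - (k + l * (x0 +i* t))) (fun=> l * (x1 - x0)%:C)) => [|t _]; last first.
  have -> : forall u v : C, k + l * u - (k + l * v) = l * (u - v) by move=> u v; ring.
  congr (_ * _).
  by apply/eqP; rewrite eq_complex /= subrr !eqxx.
rewrite !cint_cst//; have -> : (y0 - y1)%:C = - (y1 - y0)%:C by rewrite -rmorphN opprB.
by ring.
Qed.

End ContourIntegral.

(** * Nested rectangles and intervals *)

Section Bisection.
Context {R : realType}.
Local Open Scope ring_scope.
Implicit Types (x y s d u v a b : R).

Lemma ltr_pow2_shrink (s d : R) : 0 < s -> 0 < d -> exists n, s / 2 ^+ n < d.
Proof.
move=> s0 d0; exists (Num.bound (s / d)).
rewrite ltr_pdivrMr ?exprn_gt0//; have := archi_boundP (ltW (divr_gt0 s0 d0)).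
rewrite ltr_pdivrMr// => /lt_le_trans; apply; rewrite mulrC ler_pM2l//.
by rewrite -natrX ler_nat ltnW// ltn_expl.
Qed.

(** [P x y s] speaks of the rectangle with lower left corner (x, y), width s and height k s. The
    lower left corners of the nested quarters increase, and their suprema give the common point (u,
    v). *)
Lemma bisection2 (P : R -> R -> R -> Prop) (k x y s : R) : 0 < s -> 0 < k -> P x y s ->
  (forall x y s, 0 < s -> P x y s -> exists x' y',
     [/\ x' = x \/ x' = x + s / 2, y' = y \/ y' = y + k * (s / 2) & P x' y' (s / 2)]) ->
  exists u v, [/\ x <= u <= x + s, y <= v <= y + k * s & forall d, 0 < d ->
    exists x' y' s', [/\ 0 < s' < d, x' <= u <= x' + s', y' <= v <= y' + k * s' & P x' y' s']].
Proof.
move=> s0 k0 Pxy step.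
(* The successor is made total, with value (0, 0) at rectangles failing [P], so that it can be
   iterated as a function. *)
have /choice[nxt hnxt] : forall p : R * R * R, exists q : R * R, 0 < p.2 -> P p.1.1 p.1.2 p.2 ->
    [/\ q.1 = p.1.1 \/ q.1 = p.1.1 + p.2 / 2,
        q.2 = p.1.2 \/ q.2 = p.1.2 + k * (p.2 / 2) & P q.1 q.2 (p.2 / 2)].
  move=> [[x1 y1] s1] /=; case: (pselect (0 < s1 /\ P x1 y1 s1)) => [[h1 h2]|h].
    by have [x' [y' ?]] := step _ _ _ h1 h2; exists (x', y').
  by exists (0, 0) => h1 h2; exfalso; apply: h.
pose F (p : R * R * R) := (nxt p, p.2 / 2).
pose sq n := iter n F (x, y, s).
have sqs n : (sq n).2 = s / 2 ^+ n.
  elim: n => [|n /= ->]; first by rewrite expr0 divr1.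
  by rewrite exprS; field; rewrite expf_neq0.
have sq0 n : 0 < (sq n).2 by rewrite sqs divr_gt0// exprn_gt0.
have sqP n : P (sq n).1.1 (sq n).1.2 (sq n).2.
  by elim: n => [//|n IH] /=; have [] := hnxt (sq n) (sq0 n) IH.
have stp n := hnxt (sq n) (sq0 n) (sqP n).
have mono n m : (n <= m)%N ->
  [/\ (sq n).1.1 <= (sq m).1.1, (sq m).1.1 + (sq m).2 <= (sq n).1.1 + (sq n).2,
   (sq n).1.2 <= (sq m).1.2 & (sq m).1.2 + k * (sq m).2 <= (sq n).1.2 + k * (sq n).2].
  move=> /subnK <-; elim: (m - n)%N => [|j IH]; first by split.
  rewrite addSn; case: IH => i1 i2 i3 i4.
  have [c1 c2 _] := stp (j + n)%N; have := sq0 (j + n)%N.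
  rewrite /sq /= -/(sq (j + n)%N) => p0.
  have pk : 0 < k * ((sq (j + n)%N).2 / 2) by rewrite mulr_gt0// divr_gt0.
  have pk2 : k * (sq (j + n)%N).2 = k * ((sq (j + n)%N).2 / 2) + k * ((sq (j + n)%N).2 / 2).
    by field.
  split; clear -p0 i1 i2 i3 i4 pk pk2 c1 c2; by [case: c1 => ->; lra | case: c2 => ->; lra].
have xle n m : (sq n).1.1 <= (sq m).1.1 + (sq m).2.
  case: (leqP n m) => nm.
    by have [h _ _ _] := mono _ _ nm; have := sq0 m; lra.
  by have [_ h _ _] := mono _ _ (ltnW nm); have := sq0 n; lra.
have yle n m : (sq n).1.2 <= (sq m).1.2 + k * (sq m).2.
  have hk j : 0 < k * (sq j).2 by rewrite mulr_gt0.
  case: (leqP n m) => nm.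
    by have [_ _ h _] := mono _ _ nm; have := hk m; lra.
  by have [_ _ _ h] := mono _ _ (ltnW nm); have := hk n; lra.
pose u := sup (range (fun n => (sq n).1.1)); pose v := sup (range (fun n => (sq n).1.2)).
have hu n : (sq n).1.1 <= u <= (sq n).1.1 + (sq n).2.
  apply/andP; split; last by apply: ge_sup; [exists x, 0%N|move=> _ [m _ <-]].
  by apply: ub_le_sup; [exists (x + s) => _ [m _ <-]; exact: (xle m 0%N)|exists n].
have hv n : (sq n).1.2 <= v <= (sq n).1.2 + k * (sq n).2.
  apply/andP; split; last by apply: ge_sup; [exists y, 0%N|move=> _ [m _ <-]].
  by apply: ub_le_sup; [exists (y + k * s) => _ [m _ <-]; exact: (yle m 0%N)|exists n].
exists u, v; split; [exact: (hu 0%N)|exact: (hv 0%N)|move=> d d0].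
have [n hn] := ltr_pow2_shrink s0 d0.
exists (sq n).1.1, (sq n).1.2, (sq n).2; split => //.
by rewrite sq0 sqs.
Qed.

Lemma bisection (P : R -> R -> Prop) a b : a < b -> P a b ->
  (forall a b, a < b -> P a b -> P a ((a + b) / 2) \/ P ((a + b) / 2) b) ->
  exists2 t, a <= t <= b & forall d, 0 < d ->
    exists a' b', [/\ a' <= t <= b', 0 < b' - a' < d & P a' b'].
Proof.
move=> ab Pab step.
have s0 : 0 < b - a by lra.
have [||u [v [hu _ H]]] := @bisection2 (fun x _ s => P x (x + s)) 1 a 0 _ s0 ltr01.
- by rewrite addrC subrK.
- move=> x y s s1 /step[|h|h]; first by lra.
    exists x, y; split; [by left|by left|].
    by have -> : x + s / 2 = (x + (x + s)) / 2 by field.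
  exists (x + s / 2), y; split; [by right|by left|].
  have -> : x + s / 2 = (x + (x + s)) / 2 by field.
  by have -> : (x + (x + s)) / 2 + s / 2 = x + s by field.
exists u; first by lra.
move=> d /H[x' [y' [s' [h1 h2 _ h3]]]]; exists x', (x' + s'); split => //.
by rewrite addrAC subrr add0r.
Qed.

End Bisection.

(** * Goursat's theorem on rectangles *)

Section CauchyEstimates.
Context {R : realType}.
Local Open Scope complex_scope.
Local Open Scope ring_scope.
Local Notation C := R[i].
Local Notation Re := (@complex.Re R).
Local Notation Im := (@complex.Im R).
Implicit Types (f g : C -> C) (z w l : C) (r s M : R).

Lemma contour_quarter f x y s s' : 0 < s -> 0 < s' ->
  (forall z, on_rect x (x + s + s) y (y + s' + s') z -> ccont f z) ->
  contour f x (x + s + s) y (y + s' + s') =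
  contour f x (x + s) y (y + s') + contour f x (x + s) (y + s') (y + s' + s') +
  (contour f (x + s) (x + s + s) y (y + s') +
   contour f (x + s) (x + s + s) (y + s') (y + s' + s')).
Proof.
move=> s0 s0' cf.
have ch t : y <= t <= y + s' + s' -> hcont f x (x + s + s) t.
  by move=> ht u hu; apply: cf; rewrite /on_rect /= hu ht.
have cv t : x <= t <= x + s + s -> vcont f y (y + s' + s') t.
  by move=> ht u hu; apply: cf; rewrite /on_rect /= hu ht.
rewrite (@contour_vcut _ f x (x + s)); [|lra|lra|apply: ch; lra|apply: ch; lra].
rewrite (@contour_hcut _ f x _ y (y + s')); [|lra|lra|apply: cv; lra|apply: cv; lra].
by rewrite (@contour_hcut _ f (x + s) _ y (y + s')); [|lra|lra|apply: cv; lra|apply: cv; lra].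
Qed.

(** If the integral exceeded K times the area, so would that of some quarter, and quarters would
    shrink to a point. There f is affine up to o(|z - u|), and affine functions integrate to 0, so
    the integral is o(area). *)
Lemma goursat f x0 x1 y0 y1 : x0 < x1 -> y0 < y1 ->
  (forall z, on_rect x0 x1 y0 y1 z -> exists l, cder f z l) -> contour f x0 x1 y0 y1 = 0.
Proof.
move=> hx hy hf; apply: normc_lt_eq0 => e e0; rewrite leNgt; apply/negP => He.
have cf z : on_rect x0 x1 y0 y1 z -> ccont f z by move=> /hf[l /cder_ccont].
pose k := (y1 - y0) / (x1 - x0); have k0 : 0 < k by rewrite divr_gt0// subr_gt0.
(* The ratio of [e] to the area of the initial rectangle; [k] is the common aspect ratio of all
   quarters. *)
pose K := e / (k * (x1 - x0) ^+ 2).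
have K0 : 0 < K by rewrite divr_gt0// mulr_gt0// exprn_gt0// subr_gt0.
pose P x y s := [/\ x0 <= x, x + s <= x1, y0 <= y, y + k * s <= y1 &
  K * (k * s ^+ 2) < normc (contour f x (x + s) y (y + k * s))].
have kx : k * (x1 - x0) = y1 - y0 by rewrite /k divfK// subr_eq0 gt_eqF.
have P0 : P x0 y0 (x1 - x0).
  rewrite /P kx !(addrC _ (_ - _)) !subrK /K divfK//.
  by rewrite gt_eqF// mulr_gt0// exprn_gt0// subr_gt0.
have s0 : 0 < x1 - x0 by lra.
have [x y s sp [p1 p2 p3 p4 p5]|u [v [hu hv H]]] := bisection2 s0 k0 P0.
  have sp2 : 0 < s / 2 by lra.
  have ksp : 0 < k * (s / 2) by rewrite mulr_gt0.
  have es : x + s = x + s / 2 + s / 2 by field.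
  have eks : y + k * s = y + k * (s / 2) + k * (s / 2) by field.
  apply: contrapT => nex.
  have small x' y' : (x' = x \/ x' = x + s / 2) -> (y' = y \/ y' = y + k * (s / 2)) ->
     normc (contour f x' (x' + s / 2) y' (y' + k * (s / 2))) <= K * (k * s ^+ 2) / 4.
    move=> hx' hy'; rewrite leNgt; apply/negP => L; apply: nex; exists x', y'; split => //.
    rewrite /P; split.
    - by clear -p1 hx' sp2; case: hx' => ->; lra.
    - by clear -p2 es hx' sp2; case: hx' => ->; lra.
    - by clear -p3 hy' ksp; case: hy' => ->; lra.
    - by clear -p4 eks hy' ksp; case: hy' => ->; lra.
    - by apply: le_lt_trans L; rewrite le_eqVlt; apply/orP; left; apply/eqP; field.
  move: p5; rewrite es eks contour_quarter//; last first.
    by move=> z; rewrite /on_rect => hz; apply: cf; rewrite /on_rect; lra.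
  apply/negP; rewrite -leNgt.
  apply: le_trans (le_normcD _ _) _.
  apply: le_trans (lerD (le_normcD _ _) (le_normcD _ _)) _.
  have := small x y (or_introl erefl) (or_introl erefl).
  have := small x _ (or_introl erefl) (or_intror erefl).
  have := small _ y (or_intror erefl) (or_introl erefl).
  have := small _ _ (or_intror erefl) (or_intror erefl).
  by clear; lra.
pose z := u +i* v.
have [l fl] : exists l, cder f z l.
  by apply: hf; rewrite /on_rect /=; rewrite kx in hv; lra.
(* Chosen so that 4 e' (s + k s)^2 = K k s^2: the left side is the bound of [le_contour] for the
   error term, the right side K times the area. *)
pose e' := K * k / (4 * (1 + k) ^+ 2).
have k1 : 0 < (1 + k) ^+ 2 by rewrite exprn_gt0// addr_gt0.
have e0' : 0 < e' by rewrite divr_gt0// mulr_gt0.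
have [d d0 hd] := cder_eps fl e0'.
have [x [y [s [/andP[sp sd] hxu hyv [p1 p2 p3 p4 p5]]]]] := H (d / (1 + k)) (divr_gt0 d0 (addr_gt0 ltr01 k0)).
have ks : 0 < k * s by rewrite mulr_gt0.
have sd' : s + k * s < d.
  by move: sd; rewrite ltr_pdivlMr ?addr_gt0//; clear; lra.
have inr w : on_boundary x (x + s) y (y + k * s) w -> on_rect x0 x1 y0 y1 w.
  by rewrite /on_boundary => /andP[+ _]; rewrite /on_rect; clear -p1 p2 p3 p4; lra.
have hx' : x <= x + s by clear -sp; lra.
have hy' : y <= y + k * s by clear -ks; lra.
(* The tangent at [z]; subtracting it leaves the integral unchanged. *)
pose g w := (f z - l * z) + l * w.
have cg w : ccont g w by exact: cder_ccont (cder_affine _ _ _).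
have E : contour f x (x + s) y (y + k * s) = contour (fun w => f w - g w) x (x + s) y (y + k * s).
  rewrite contourB//; last by move=> w /inr /cf.
  by rewrite contour_affine// subr0.
move: p5; rewrite E; apply/negP; rewrite -leNgt.
apply: (le_trans (@le_contour _ _ _ _ _ _ (e' * (s + k * s)) hx' hy' _ _)).
- by move=> w /inr/cf cfw; exact: ccontB.
- move=> w hw; have wz : normc (w - z) <= s + k * s.
    apply: le_trans (normc_le_ReIm _) _; rewrite !raddfB /=.
    move: hw; rewrite /on_boundary /on_rect => /andP[/andP[/andP[a1 a2] /andP[a3 a4]] _].
    by apply: lerD; rewrite ler_norml; clear -a1 a2 a3 a4 hxu hyv; lra.
  have -> : f w - g w = f (z + (w - z)) - f z - l * (w - z).
    by rewrite [z + _]addrC subrK /g; ring.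
  apply: le_trans (hd _ _) _; first exact: le_lt_trans wz sd'.
  by rewrite ler_pM2l.
- rewrite le_eqVlt; apply/orP; left; apply/eqP; rewrite /e'; field.
  by rewrite gt_eqF// addr_gt0.
Qed.

End CauchyEstimates.

(** * Contours around a point and the Cauchy kernel *)

Section SquareContours.
Context {R : realType}.
Local Open Scope complex_scope.
Local Open Scope ring_scope.
Local Notation C := R[i].
Local Notation Re := (@complex.Re R).
Local Notation Im := (@complex.Im R).
Implicit Types (f g : C -> C) (z w l : C) (r s M : R).

Definition square_contour f w r := contour f (Re w - r) (Re w + r) (Im w - r) (Im w + r).
Definition on_square w r := on_rect (Re w - r) (Re w + r) (Im w - r) (Im w + r).
Definition on_square_boundary w r := on_boundary (Re w - r) (Re w + r) (Im w - r) (Im w + r).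

Lemma on_square_le w r z : on_square w r z -> normc (z - w) <= 2 * r.
Proof.
rewrite /on_square /on_rect => h; apply: le_trans (normc_le_ReIm _) _; rewrite !raddfB /=.
have : `|Re z - Re w| <= r by rewrite ler_norml; lra.
have : `|Im z - Im w| <= r by rewrite ler_norml; lra.
lra.
Qed.

Lemma on_square_boundary_le w r z : on_square_boundary w r z -> r <= normc (z - w) <= 2 * r.
Proof.
move=> /andP[h1 h2]; rewrite (on_square_le h1) andbT.
have := normRe_le (z - w); have := normIm_le (z - w); rewrite !raddfB/= => hi hr.
have rn : r <= `|- r| by rewrite normrN ler_norm.
have : r <= `|Re z - Re w| \/ r <= `|Im z - Im w|.
  case/or4P: h2 => /eqP E.
  - by left; rewrite E addrAC subrr add0r.
  - by left; rewrite E addrAC subrr add0r ler_norm.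
  - by right; rewrite E addrAC subrr add0r.
  - by right; rewrite E addrAC subrr add0r ler_norm.
by move=> [h|h]; [exact: le_trans h hr|exact: le_trans h hi].
Qed.

(* The square minus a smaller one is cut into four rectangles avoiding the centre. *)
Lemma square_contour_shrink f w r d : 0 < d -> d < r ->
  (forall z, on_square w r z -> z != w -> exists l, cder f z l) ->
  square_contour f w r = square_contour f w d.
Proof.
move=> d0 dr hf; rewrite /square_contour; case: w hf => a b /=; rewrite /on_square /= => hf.
have hfn x y : a - r <= x <= a + r -> b - r <= y <= b + r -> (x != a) || (y != b) ->
    exists l, cder f (x +i* y) l.
  move=> hx hy hxy; apply: hf; first by rewrite /on_rect /= hx hy.
  by rewrite eq_complex /= negb_and.
have ch t : b - r <= t <= b + r -> t != b -> forall x0 x1, a - r <= x0 -> x1 <= a + r -> hcont f x0 x1 t.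
  move=> ht tb x0 x1 h0 h1 x hx.
  have [l /cder_ccont//] : exists l, cder f (x +i* t) l.
    by apply: hfn => //; [lra|rewrite tb orbT].
have cv t : a - r <= t <= a + r -> t != a -> forall y0 y1, b - r <= y0 -> y1 <= b + r -> vcont f y0 y1 t.
  move=> ht ta x0 x1 h0 h1 x hx.
  have [l /cder_ccont//] : exists l, cder f (t +i* x) l.
    by apply: hfn => //; [lra|rewrite ta].
have n1 t : 0 < t -> a - t != a by move=> t0; rewrite lt_eqF//; lra.
have n2 t : 0 < t -> a + t != a by move=> t0; rewrite gt_eqF//; lra.
have n3 t : 0 < t -> b - t != b by move=> t0; rewrite lt_eqF//; lra.
have n4 t : 0 < t -> b + t != b by move=> t0; rewrite gt_eqF//; lra.
have r0 : 0 < r by lra.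
rewrite (@contour_vcut _ f (a - r) (a - d)); [|lra|lra
  |apply: ch => //; [lra|exact: n3]|apply: ch => //; [lra|exact: n4]].
rewrite (@contour_vcut _ f (a - d) (a + d)); [|lra|lra
  |apply: ch; [lra|exact: n3|lra|lra]|apply: ch; [lra|exact: n4|lra|lra]].
rewrite (@contour_hcut _ f (a - d) (a + d) (b - r) (b - d)); [|lra|lra
  |apply: cv => //; [lra|exact: n1]|apply: cv => //; [lra|exact: n2]].
rewrite (@contour_hcut _ f (a - d) (a + d) (b - d) (b + d)); [|lra|lra
  |apply: cv => //; [lra|exact: n1|lra]|apply: cv => //; [lra|exact: n2|lra]].
have z1 : contour f (a - r) (a - d) (b - r) (b + r) = 0.
  apply: goursat => [||[x y]]; [lra|lra|rewrite /on_rect /= => hz].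
  apply: hfn; [lra|lra|]; apply/orP; left; rewrite lt_eqF//; lra.
have z2 : contour f (a + d) (a + r) (b - r) (b + r) = 0.
  apply: goursat => [||[x y]]; [lra|lra|rewrite /on_rect /= => hz].
  apply: hfn; [lra|lra|]; apply/orP; left; rewrite gt_eqF//; lra.
have z3 : contour f (a - d) (a + d) (b - r) (b - d) = 0.
  apply: goursat => [||[x y]]; [lra|lra|rewrite /on_rect /= => hz].
  apply: hfn; [lra|lra|]; apply/orP; right; rewrite lt_eqF//; lra.
have z4 : contour f (a - d) (a + d) (b + d) (b + r) = 0.
  apply: goursat => [||[x y]]; [lra|lra|rewrite /on_rect /= => hz].
  apply: hfn; [lra|lra|]; apply/orP; right; rewrite gt_eqF//; lra.
by rewrite z1 z2 z3 z4; ring.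
Qed.

Lemma le_square_contour f w r M : 0 < r ->
  (forall z, on_square_boundary w r z -> ccont f z) ->
  (forall z, on_square_boundary w r z -> normc (f z) <= M) ->
  normc (square_contour f w r) <= 16 * M * r.
Proof.
move=> r0 cf hM; apply: le_trans (le_contour _ _ cf hM) _; lra.
Qed.

(** The integral does not depend on the size of the square, while on a small square it is at most a
    constant times the supremum of |f(z)| |z - w|. This is the removable singularity needed for
    difference quotients. *)
Lemma punctured_goursat f w r : 0 < r ->
  (forall z, on_square w r z -> z != w -> exists l, cder f z l) ->
  (forall e, 0 < e -> exists2 d, 0 < d & forall z, z != w -> normc (z - w) < d ->
     normc (f z) * normc (z - w) <= e) ->
  square_contour f w r = 0.
Proof.
move=> r0 hf lim; apply: normc_lt_eq0 => e e0.
have [d d0 hd] := lim (e / 16) ltac:(lra).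
pose s := Num.min r d / 4.
have m0 : 0 < Num.min r d by rewrite lt_min r0.
have mr : Num.min r d <= r by rewrite ge_min lexx.
have md : Num.min r d <= d by rewrite ge_min lexx orbT.
have s0 : 0 < s by rewrite divr_gt0.
have sr : s < r by rewrite /s; lra.
have sd : 2 * s < d by rewrite /s; lra.
rewrite (square_contour_shrink s0 sr hf).
have bd z : on_square_boundary w s z -> [/\ on_square w r z, z != w & s <= normc (z - w) < d].
  move=> hz; have /andP[h1 h2] := on_square_boundary_le hz; split; last by lra.
    by move: hz => /andP[+ _]; rewrite /on_square /on_rect; lra.
  by rewrite -subr_eq0 -normc_gt0; lra.
apply: le_trans (le_square_contour (M := e / 16 / s) s0 _ _) _.
- by move=> z /bd[h1 h2 _]; have [l /cder_ccont] := hf _ h1 h2.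
- move=> z /bd[h1 h2 /andP[h3 h4]]; rewrite ler_pdivlMr//.
  by apply: le_trans (hd _ h2 h4); rewrite ler_wpM2l ?normc_ge0.
- by rewrite -mulrA divfK ?gt_eqF//; lra.
Qed.

Lemma cder_inv_sub w z : z != w -> cder (fun u => (u - w)^-1) z (- 1 / (z - w) ^+ 2).
Proof.
move=> zw; apply: (@cderV _ (fun u => u - w) z 1); first by rewrite subr_eq0.
by have := cderB (cder_id z) (cder_cst w z); rewrite subr0.
Qed.

(** The two horizontal sides together contribute i times the integral of 2 r / (t^2 + r^2) over
    [-r, r], and so do the vertical ones. This integrand is at least 1 / r, so each pair contributes
    at least 2 to the imaginary part. *)
Lemma cauchy_kernel w r : 0 < r -> 4 <= normc (square_contour (fun z => (z - w)^-1) w r).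
Proof.
move=> r0; set f := fun z : C => _.
have cf z : on_square_boundary w r z -> ccont f z.
  move=> /on_square_boundary_le/andP[h _]; apply: cder_ccont (cder_inv_sub _).
  by rewrite -subr_eq0 -normc_gt0; lra.
have hx : Re w - r <= Re w + r by lra.
have hy : Im w - r <= Im w + r by lra.
have [/hcont_path c1 /hcont_path c2 /vcont_path c3 /vcont_path c4] := boundary_conts hx hy cf.
apply: le_trans (normIm_le _); apply: le_trans (ler_norm _).
pose p t := f (t +i* (Im w - r)) - f (t +i* (Im w + r)).
pose q t := f ((Re w + r) +i* t) - f ((Re w - r) +i* t).
have ImD (u v : C) : Im (u + 'i * v) = Im u + Re v.
  by case: u v => ? ? [? ?] /=; ring.
rewrite /square_contour /contour -!cintB// ImD -/p -/q.
have gb (t a : R) : a - r <= t <= a + r -> 1 / r <= 2 * r / ((t - a) ^+ 2 + r ^+ 2) <= 2 / r.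
  move=> ht; have t2 : 0 <= (t - a) ^+ 2 <= r ^+ 2.
    rewrite sqr_ge0 /= -[X in X <= _]real_normK ?num_real//.
    by rewrite ler_pXn2r ?nnegrE ?normr_ge0 ?(ltW r0)// ler_norml; lra.
  have r2 : 0 < r ^+ 2 by rewrite exprn_gt0.
  have dn : 0 < (t - a) ^+ 2 + r ^+ 2 by lra.
  rewrite !expr2 in t2 dn *; apply/andP; split.
    by rewrite ler_pdivlMr// mulrAC ler_pdivrMr//; lra.
  by rewrite ler_pdivrMr// mulrAC ler_pdivlMr//; lra.
have cE (A : R) : (2 * r / (A ^+ 2 + r ^+ 2))%:C = 2 * r%:C / (A%:C ^+ 2 + r%:C ^+ 2).
  by rewrite fmorph_div rmorphM (rmorphD _ (A ^+ 2)) !rmorphXn rmorph_nat.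
have pE t : p t = 'i * (2 * r / ((t - Re w) ^+ 2 + r ^+ 2))%:C.
  have dn : (t - Re w) ^+ 2 + r ^+ 2 != 0.
    by rewrite gt_eqF// ltr_wpDl ?sqr_ge0// exprn_gt0.
  rewrite /p /f.
  have E1 : t +i* (Im w - r) - w = (t - Re w)%:C - 'i * r%:C.
    by case: (w) => a b; apply/eqP; rewrite eq_complex /=; apply/andP; split; apply/eqP; ring.
  have E2 : t +i* (Im w + r) - w = (t - Re w)%:C + 'i * r%:C.
    by case: (w) => a b; apply/eqP; rewrite eq_complex /=; apply/andP; split; apply/eqP; ring.
  rewrite E1 E2; set A := t - Re w in dn *.
  rewrite cE.
  have F : A%:C ^+ 2 + r%:C ^+ 2 = (A%:C - 'i * r%:C) * (A%:C + 'i * r%:C).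
    have := sqr_i R; set I : C := 'i => I2.
    have -> : r%:C ^+ 2 = - (I ^+ 2 * r%:C ^+ 2) by rewrite I2; ring.
    by ring.
  have nz : (A%:C - 'i * r%:C) * (A%:C + 'i * r%:C) != 0.
    by rewrite -F -(rmorphXn _ 2 A) -(rmorphXn _ 2 r) -rmorphD fmorph_eq0.
  rewrite F; move: nz; rewrite mulf_eq0 negb_or => /andP[nz1 nz2].
  by field; rewrite nz1 nz2.
have qE t : q t = (2 * r / ((t - Im w) ^+ 2 + r ^+ 2))%:C.
  have dn : (t - Im w) ^+ 2 + r ^+ 2 != 0.
    by rewrite gt_eqF// ltr_wpDl ?sqr_ge0// exprn_gt0.
  rewrite /q /f.
  have E1 : (Re w + r) +i* t - w = r%:C + 'i * (t - Im w)%:C.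
    by case: (w) => a b; apply/eqP; rewrite eq_complex /=; apply/andP; split; apply/eqP; ring.
  have E2 : (Re w - r) +i* t - w = - r%:C + 'i * (t - Im w)%:C.
    by case: (w) => a b; apply/eqP; rewrite eq_complex /=; apply/andP; split; apply/eqP; ring.
  rewrite E1 E2; set A := t - Im w in dn *.
  rewrite cE.
  have F : A%:C ^+ 2 + r%:C ^+ 2 = (r%:C + 'i * A%:C) * - (- r%:C + 'i * A%:C).
    have := sqr_i R; set I : C := 'i => I2.
    have -> : A%:C ^+ 2 = - (I ^+ 2 * A%:C ^+ 2) by rewrite I2; ring.
    by ring.
  have nz : (r%:C + 'i * A%:C) * - (- r%:C + 'i * A%:C) != 0.
    by rewrite -F -(rmorphXn _ 2 A) -(rmorphXn _ 2 r) -rmorphD fmorph_eq0.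
  rewrite F; move: nz; rewrite mulf_eq0 oppr_eq0 negb_or => /andP[nz1 nz2].
  by field; rewrite nz1 nz2.
have /andP[i1 _] : 1 / r * (Re w + r - (Re w - r)) <= Im (cint p (Re w - r) (Re w + r))
    <= 2 / r * (Re w + r - (Re w - r)).
  apply: (@Rintegral_segment_bounds R (fun t => Im (p t))) => //.
    exact: (path_continuous_integrable (@Im_lip R) (path_continuousB c1 c2)).
  by move=> t /gb; rewrite pE /= !(mul0r, mul1r, add0r).
have /andP[i2 _] : 1 / r * (Im w + r - (Im w - r)) <= Re (cint q (Im w - r) (Im w + r))
    <= 2 / r * (Im w + r - (Im w - r)).
  apply: (@Rintegral_segment_bounds R (fun t => Re (q t))) => //.
    exact: (path_continuous_integrable (@Re_lip R) (path_continuousB c4 c3)).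
  by move=> t /gb; rewrite qE.
have e1 : 1 / r * (Re w + r - (Re w - r)) = 2 by field; rewrite gt_eqF.
have e2 : 1 / r * (Im w + r - (Im w - r)) = 2 by field; rewrite gt_eqF.
by move: i1 i2; rewrite e1 e2 /=; lra.
Qed.

End SquareContours.

(** * Cauchy's estimates and the mean value inequality *)

Section CauchyConsequences.
Context {R : realType}.
Local Open Scope complex_scope.
Local Open Scope ring_scope.
Local Notation C := R[i].
Local Notation Re := (@complex.Re R).
Local Notation Im := (@complex.Im R).
Implicit Types (f g : C -> C) (z w l h v : C) (r s d e M : R).

(** By Cauchy's formula on the square of half-side s, which lies in the annulus s <= |z - w| <= 2 s:
    f(w) times the kernel integral is bounded by 16 M, and the kernel integral is at least 4. A
    bound on an annulus thus passes to its centre. *)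
Lemma le_center f w s M : 0 < s ->
  (forall z, normc (z - w) <= 2 * s -> exists l, cder f z l) ->
  (forall z, s <= normc (z - w) <= 2 * s -> normc (f z) <= M) -> normc (f w) <= 4 * M.
Proof.
move=> s0 hf hM.
have hx : Re w - s <= Re w + s by lra.
have hy : Im w - s <= Im w + s by lra.
have bnd z : on_square_boundary w s z -> [/\ z != w, s <= normc (z - w), normc (z - w) <= 2 * s,
    ccont (fun u => (u - w)^-1) z & ccont f z].
  move=> /on_square_boundary_le/andP[h1 h2]; have zw : z != w by rewrite -subr_eq0 -normc_gt0; lra.
  split=> //; first exact: cder_ccont (cder_inv_sub zw).
  by have [l /cder_ccont] := hf _ h2.
pose q z := f z * (z - w)^-1; pose k z := f w * (z - w)^-1.
have qk0 : square_contour (fun z => q z - k z) w s = 0.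
  apply: punctured_goursat => // [z /on_square_le hz zw|e e0].
    have [l fl] := hf _ hz; eexists; apply: cderB.
      exact: cderM fl (cder_inv_sub zw).
    exact: cderZ (cder_inv_sub zw).
  have [l /cder_ccont/(_ _ e0)[d d0 hd]] : exists l, cder f w l.
    by apply: hf; rewrite subrr normc0; lra.
  exists d => // z zw /hd; rewrite -normcM /q /k -mulrBl divfK ?subr_eq0//.
  exact: ltW.
have bq z : on_square_boundary w s z -> ccont q z by move=> /bnd[_ _ _ h1 h2]; exact: ccontM.
have bk z : on_square_boundary w s z -> ccont k z.
  by move=> /bnd[_ _ _ h1 h2]; apply: ccontM => //; exact: ccont_cst.
have E : f w * square_contour (fun z => (z - w)^-1) w s = square_contour q w s.
  apply/esym/eqP; rewrite -subr_eq0; apply/eqP; rewrite -[RHS]qk0.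
  by rewrite /square_contour contourB// /k contourZ// => z /bnd[].
have : normc (square_contour q w s) <= 16 * (M / s) * s.
  apply: le_square_contour => // z /bnd[zw h1 h2 _ _]; rewrite normcM normcV.
  by apply: ler_pM; rewrite ?invr_ge0 ?normc_ge0 ?hM ?h1 ?lef_pV2// posrE; lra.
rewrite -E normcM -mulrA divfK ?gt_eqF// => H.
have := cauchy_kernel w s0; have := normc_ge0 (f w); nra.
Qed.

(** The function (f(z) - f(w)) / (z - w)^2 - l / (z - w) has a removable singularity in the sense of
    [punctured_goursat]. With half-side s = r / 3 this gives 4 |l| <= 16 (2 M / s^2) s = 96 M /
    r. *)
Lemma le_cder f w r M l : 0 < r -> hol f w r ->
  (forall z, normc (z - w) < r -> normc (f z) <= M) -> cder f w l -> normc l <= 24 * M / r.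
Proof.
move=> r0 hf hM fl; pose s := r / 3; have s0 : 0 < s by rewrite /s; lra.
have sr z : normc (z - w) <= 2 * s -> normc (z - w) < r by rewrite /s; lra.
have hx : Re w - s <= Re w + s by lra.
have hy : Im w - s <= Im w + s by lra.
have c1 z : z != w -> ccont (fun u => (u - w)^-1) z by move=> /cder_inv_sub/cder_ccont.
have bnd z : on_square_boundary w s z -> [/\ z != w, s <= normc (z - w), normc (z - w) < r & ccont f z].
  move=> /on_square_boundary_le/andP[h1 h2]; split=> //; last 1 first.
  - by have [l' /cder_ccont] := hf _ (sr _ h2).
  - by rewrite -subr_eq0 -normc_gt0; lra.
  - exact: sr.
pose q z := (f z - f w) * ((z - w)^-1 * (z - w)^-1); pose k z := l * (z - w)^-1.
have qk0 : square_contour (fun z => q z - k z) w s = 0.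
  apply: punctured_goursat => // [z /on_square_le/sr hz zw|e e0].
    have [l' fl'] := hf _ hz; eexists; apply: cderB.
      apply: cderM; first exact: cderB fl' (cder_cst _ _).
      exact: cderM (cder_inv_sub zw) (cder_inv_sub zw).
    exact: cderZ (cder_inv_sub zw).
  have [d d0 hd] := cder_eps fl e0; exists d => // z zw /hd.
  rewrite [w + _]addrC subrK -normcM => H.
  have zw0 : 0 < normc (z - w) by rewrite normc_gt0 subr_eq0.
  rewrite -(ler_pM2r zw0) -normcM; apply: le_trans H; rewrite /q /k.
  by rewrite le_eqVlt; apply/orP; left; apply/eqP; congr normc; field; rewrite subr_eq0.
have bq z : on_square_boundary w s z -> ccont q z.
  move=> /bnd[zw _ _ cf]; apply: ccontM; first by apply: ccontB => //; exact: ccont_cst.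
  by apply: ccontM; exact: c1.
have bk z : on_square_boundary w s z -> ccont k z.
  by move=> /bnd[zw _ _ _]; apply: ccontM; [exact: ccont_cst|exact: c1].
have E : l * square_contour (fun z => (z - w)^-1) w s = square_contour q w s.
  apply/esym/eqP; rewrite -subr_eq0; apply/eqP; rewrite -[RHS]qk0.
  by rewrite /square_contour contourB// /k contourZ// => z /bnd[zw _ _ _]; exact: c1.
have : normc (square_contour q w s) <= 16 * (2 * M / s / s) * s.
  apply: le_square_contour => // z /bnd[zw h1 h2 _]; rewrite normcM normcM normcV -[2 * M / s / s]mulrA.
  have wr : normc (w - w) < r by rewrite subrr normc0.
  apply: ler_pM; rewrite ?normc_ge0// ?mulr_ge0 ?invr_ge0 ?normc_ge0//.
    by have := le_normcB (f z) (f w); have := hM _ h2; have := hM _ wr; lra.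
  by apply: ler_pM; rewrite ?invr_ge0 ?normc_ge0 ?lef_pV2 ?posrE//; lra.
have -> : 16 * (2 * M / s / s) * s = 4 * (24 * M / r) by rewrite /s; field; rewrite gt_eqF.
rewrite -E normcM => H.
have := cauchy_kernel w s0; have := normc_ge0 l; nra.
Qed.

(** If the average speed exceeded K + e, then by the triangle inequality it would do so on one half,
    and bisection would contradict the local bound at the limit point. The distance is left abstract
    because both the modulus and the chordal distance are used. *)
Lemma mean_value_dist (T : Type) (dist : T -> T -> R) (p : R -> T) (a b K : R) :
  (forall x y, dist x y = dist y x) ->
  (forall x y u : T, dist x u <= dist x y + dist y u) -> a <= b ->
  (forall t, a <= t <= b -> forall e, 0 < e -> exists2 d, 0 < d &
     forall s, a <= s <= b -> `|s - t| < d -> dist (p s) (p t) <= (K + e) * `|s - t|) ->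
  dist (p a) (p b) <= K * (b - a).
Proof.
move=> dC dT; rewrite le_eqVlt => /predU1P[<-|ab] H.
  have aa : a <= a <= a by rewrite lexx.
  have [d d0 /(_ a aa)] := H a aa 1 ltr01.
  by rewrite subrr normr0 !mulr0; apply.
rewrite leNgt; apply/negP => L.
pose e := (dist (p a) (p b) / (b - a) - K) / 2.
have ba : 0 < b - a by lra.
have e0 : 0 < e by rewrite divr_gt0// subr_gt0 ltr_pdivlMr.
pose P x y := [/\ a <= x, y <= b & (K + e) * (y - x) < dist (p x) (p y)].
have P0 : P a b.
  split=> //; have : K + e < dist (p a) (p b) / (b - a).
    by move: e0; rewrite /e; lra.
  by rewrite ltr_pdivlMr.
have [x y xy [p1 p2 p3]|t ht {}H'] := bisection ab P0.
  have := dT (p x) (p ((x + y) / 2)) (p y) => tri.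
  case: (ltP ((K + e) * ((x + y) / 2 - x)) (dist (p x) (p ((x + y) / 2)))) => c.
    by left; split=> //; lra.
  by right; split => //; [lra|lra].
have [d d0 hd] := H t ht e e0.
have [x [y [/andP[xt ty] /andP[xy0 xyd] [p1 p2]]]] := H' d d0.
apply/negP; rewrite -leNgt; apply: le_trans (dT _ (p t) _) _.
have hx : dist (p x) (p t) <= (K + e) * (t - x).
  rewrite -[t - x]ger0_norm ?subr_ge0// distrC; apply: hd; first by lra.
  by rewrite distrC ger0_norm ?subr_ge0//; lra.
have hy : dist (p t) (p y) <= (K + e) * (y - t).
  rewrite dC -[y - t]ger0_norm ?subr_ge0//; apply: hd; first by lra.
  by rewrite ger0_norm ?subr_ge0//; lra.
lra.
Qed.

Lemma mean_value f z v M : 0 <= M ->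
  (forall t : R, 0 <= t <= 1 -> exists2 l, cder f (z + t%:C * v) l & normc l <= M) ->
  normc (f (z + v) - f z) <= M * normc v.
Proof.
move=> M0 H.
have := @mean_value_dist C (fun x y => normc (x - y)) (fun t => f (z + t%:C * v)) 0 1 (M * normc v).
rewrite subr0 mulr1 mul1r mul0r addr0 normcB; apply => //.
- exact: normcB.
- by move=> x y w; exact: normc_dist_trans.
- move=> t /H[l fl lM] e e0.
  have v0 := normc_ge0 v.
  have e1 : 0 < e / (normc v + 1) by rewrite divr_gt0//; lra.
  have [d d0 hd] := cder_eps fl e1.
  exists (d / (normc v + 1)) => [|s _]; first by rewrite divr_gt0//; lra.
  rewrite ltr_pdivlMr; last by lra.
  move=> hs; have := hd ((s - t)%:C * v); rewrite normcM normc_real => hh.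
  have {hh} := hh _; have -> : z + t%:C * v + (s - t)%:C * v = z + s%:C * v.
    by rewrite rmorphB; ring.
  have s0 : 0 <= `|s - t| by [].
  move=> /(_ ltac:(nra)) hh.
  have -> : f (z + s%:C * v) - f (z + t%:C * v) =
     (f (z + s%:C * v) - f (z + t%:C * v) - l * ((s - t)%:C * v)) + l * ((s - t)%:C * v) by ring.
  apply: le_trans (le_normcD _ _) _; rewrite [normc (l * _)]normcM normcM normc_real.
  have h1 : normc l * (`|s - t| * normc v) <= M * (`|s - t| * normc v).
    by rewrite ler_wpM2r// mulr_ge0.
  have h2 : e / (normc v + 1) * (`|s - t| * normc v) <= e * `|s - t|.
    rewrite mulrAC ler_pdivrMr; last by lra.
    have : 0 <= e * `|s - t| by rewrite mulr_ge0// ltW.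
    lra.
  lra.
Qed.

Lemma normc_segment z v w (t : R) : 0 <= t <= 1 ->
  normc (z + t%:C * v - w) <= Num.max (normc (z - w)) (normc (z + v - w)).
Proof.
move=> /andP[t0 t1].
have -> : z + t%:C * v - w = (1 - t)%:C * (z - w) + t%:C * (z + v - w).
  by rewrite rmorphB rmorph1; ring.
apply: le_trans (le_normcD _ _) _; rewrite !normcM !normc_real !ger0_norm ?subr_ge0//.
set m := Num.max _ _.
have m1 : normc (z - w) <= m by rewrite le_max lexx.
have m2 : normc (z + v - w) <= m by rewrite le_max lexx orbT.
have := ler_wpM2l t0 m2; have t10 : 0 <= 1 - t by lra.
have := ler_wpM2l t10 m1; lra.
Qed.

Lemma hol_mean_value f w r M : 0 <= M -> hol f w r ->
  (forall z, normc (z - w) < r -> normc (deriv1 f z) <= M) ->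
  forall x y, normc (x - w) < r -> normc (y - w) < r -> normc (f y - f x) <= M * normc (y - x).
Proof.
move=> M0 hf hM x y hx hy.
have -> : f y = f (x + (y - x)) by congr f; ring.
apply: mean_value => // t ht.
have H : normc (x + t%:C * (y - x) - w) < r.
  apply: le_lt_trans (normc_segment _ _ _ ht) _; rewrite gt_max hx.
  by have -> : x + (y - x) - w = y - w by ring.
by exists (deriv1 f (x + t%:C * (y - x))); [exact: hol_deriv1 H|exact: hM].
Qed.

End CauchyConsequences.

(** * Local theory of holomorphic functions *)

Section HolomorphicFunctions.
Context {R : realType}.
Local Open Scope complex_scope.
Local Open Scope ring_scope.
Local Notation C := R[i].
Local Notation Re := (@complex.Re R).
Local Notation Im := (@complex.Im R).
Implicit Types (f g k : C -> C) (z w l h v : C) (r s d e M : R) (n m : nat).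

Lemma cauchy_limit (u : nat -> R) :
  (forall e, 0 < e -> exists N, forall n m, (N <= n)%N -> (N <= m)%N -> `|u n - u m| <= e) ->
  exists l : R, forall e, 0 < e -> exists N, forall n, (N <= n)%N -> `|u n - l| <= e.
Proof.
move=> H; have /cauchy_cvgP cu : cauchy (u @ \oo).
  apply/cauchy_ballP => e e0; have [N hN] := H (e / 2) ltac:(lra).
  exists (u @` [set n | (N <= n)%N], u @` [set n | (N <= n)%N]).
    by split; exists N => // n Nn; exists n.
  move=> [_ _] [/= [n hn <-] [m hm <-]].
  by rewrite /ball /=; have := hN n m hn hm; lra.
exists (lim (u @ \oo)) => e e0.
have /cvgrPdist_le/(_ _ e0)[N _ hN] : u @ \oo --> lim (u @ \oo) by exact: cu.
by exists N => n /hN; rewrite distrC.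
Qed.

Lemma ccauchy_limit (u : nat -> C) :
  (forall e, 0 < e -> exists N, forall n m, (N <= n)%N -> (N <= m)%N -> normc (u n - u m) <= e) ->
  exists l, forall e, 0 < e -> exists N, forall n, (N <= n)%N -> normc (u n - l) <= e.
Proof.
move=> H.
have [a ha] : exists l : R, forall e, 0 < e -> exists N, forall n, (N <= n)%N -> `|Re (u n) - l| <= e.
  apply: cauchy_limit => e /H[N hN]; exists N => n m hn hm.
  exact: le_trans (Re_lip _ _) (hN _ _ hn hm).
have [b hb] : exists l : R, forall e, 0 < e -> exists N, forall n, (N <= n)%N -> `|Im (u n) - l| <= e.
  apply: cauchy_limit => e /H[N hN]; exists N => n m hn hm.
  exact: le_trans (Im_lip _ _) (hN _ _ hn hm).
exists (a +i* b) => e e0; have [N hN] := ha (e / 2) ltac:(lra); have [K hK] := hb (e / 2) ltac:(lra).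
exists (maxn N K) => n; rewrite geq_max => /andP[/hN h1 /hK h2].
by apply: le_trans (normc_le_ReIm _) _; rewrite !raddfB /=; lra.
Qed.

(* Cauchy's estimate applied twice, to the difference quotients of a function bounded by [M]. *)
Definition second_order_bound M r := 24 * (48 * M / r) / (r / 8).

Lemma second_order_bound_ge0 M r : 0 <= M -> 0 < r -> 0 <= second_order_bound M r.
Proof. by move=> M0 r0; rewrite !(divr_ge0, mulr_ge0)// ltW. Qed.

Section BoundedHolomorphic.
Variables (f : C -> C) (w : C) (r M : R).
Hypotheses (r0 : 0 < r) (hf : hol f w r) (hM : forall z, normc (z - w) < r -> normc (f z) <= M).

Let M0 : 0 <= M.
Proof. by apply: le_trans (hM (z := w) _); rewrite ?normc_ge0// subrr normc0. Qed.

Let fder z : normc (z - w) < r -> cder f z (deriv1 f z).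
Proof. exact: hol_deriv1. Qed.

Lemma le_deriv1 z s : 0 < s -> normc (z - w) + s <= r -> normc (deriv1 f z) <= 24 * M / s.
Proof.
move=> s0 hz; apply: (@le_cder _ f z) => //.
- exact: hol_sub hf.
- by move=> u hu; apply: hM; apply: le_lt_trans (normc_dist_trans z _ _) _; lra.
- by apply: fder; lra.
Qed.

Let q h z := (f (z + h) - f z) / h.

Let shift_in z h s : normc (z - w) < s -> normc h < r - s -> normc (z + h - w) < r.
Proof.
move=> hz hh; have -> : z + h - w = (z - w) + h by ring.
by apply: le_lt_trans (le_normcD _ _) _; lra.
Qed.

Let dq h z : h != 0 -> normc h < r / 4 -> normc (z - w) < r / 2 ->
  cder (q h) z ((deriv1 f (z + h) - deriv1 f z) / h).
Proof.
have r_gt0 := r0; move=> h0 hh hz; have hh2 : normc h < r - r / 2 by lra.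
have hz1 : normc (z - w) < r by lra.
apply: cder_eq (cderM (cderB (_ : cder (fun v => f (v + h)) z (deriv1 f (z + h)))
   (fder _)) (cder_cst h^-1 z)) _.
- have := @cder_shift _ f h 1 z (deriv1 f (z + h)); rewrite mul1r mulr1 [h + z]addrC => H.
  apply: (cder_ext (r := 1) _ _ (H _)) => // [v _|]; first by rewrite mul1r addrC.
  by apply: fder; apply: shift_in hz hh2.
- by [].
- by rewrite mulr0 addr0.
Qed.

(** For fixed h the difference quotient [q h] is holomorphic, bounded by 48 M / r through the mean
    value inequality, and its derivative is (f'(z + h) - f'(z)) / h. Cauchy's estimate on a disc of
    radius r / 8 bounds this. *)
Lemma deriv1_lip z h : normc (z - w) < r / 8 -> normc h < r / 4 ->
  normc (deriv1 f (z + h) - deriv1 f z) <= second_order_bound M r * normc h.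
Proof.
have r_gt0 := r0; move=> hz hh; have [->|h0] := eqVneq h 0; first by rewrite addr0 subrr normc0 mulr0.
have M1 v : normc (v - w) < r / 2 -> normc (deriv1 f v) <= 48 * M / r.
  move=> hv; have -> : 48 * M / r = 24 * M / (r / 2) by field; rewrite gt_eqF.
  by apply: le_deriv1; lra.
have M10 : 0 <= 48 * M / r by rewrite !(divr_ge0, mulr_ge0)// ltW.
have hf2 : hol f w (r / 2) by move=> v hv; apply: hf; lra.
have r8 : 0 < r / 8 by lra.
have hq : hol (q h) z (r / 8).
  move=> v hv; eexists; apply: dq => //.
  by apply: le_lt_trans (normc_dist_trans z _ _) _; lra.
have bq v : normc (v - z) < r / 8 -> normc (q h v) <= 48 * M / r.
  move=> hv; have vw : normc (v - w) < r / 4.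
    by apply: le_lt_trans (normc_dist_trans z _ _) _; lra.
  have vhw : normc (v + h - w) < r / 2.
    have -> : v + h - w = (v - w) + h by ring.
    by apply: le_lt_trans (le_normcD _ _) _; lra.
  have := hol_mean_value M10 hf2 M1 (x := v) (y := v + h); rewrite [v + h - v]addrAC subrr add0r.
  move=> /(_ ltac:(lra) vhw) H.
  by rewrite /q normcM normcV ler_pdivrMr ?normc_gt0.
have hzr : normc (z - w) < r / 2 by lra.
have := le_cder r8 hq bq (dq h0 hh hzr).
rewrite normcM normcV ler_pdivrMr ?normc_gt0//.
Qed.

Lemma taylor1 z h : normc (z - w) < r / 8 -> normc h < r / 4 ->
  normc (f (z + h) - f z - deriv1 f z * h) <= second_order_bound M r * normc h ^+ 2.
Proof.
have r_gt0 := r0; move=> hz hh.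
have K0 : 0 <= second_order_bound M r by exact: second_order_bound_ge0.
have := @mean_value _ (fun v => f v - deriv1 f z * (v - z)) z h (second_order_bound M r * normc h).
rewrite subrr mulr0 subr0 [z + h - z]addrAC subrr add0r expr2 mulrA addrAC.
apply; first by rewrite mulr_ge0 ?normc_ge0.
move=> t /andP[t0 t1].
have th : normc (t%:C * h) <= normc h.
  by rewrite normcM normc_real ger0_norm//; have := normc_ge0 h; nra.
exists (deriv1 f (z + t%:C * h) - deriv1 f z).
  apply: cderB.
    by apply: fder; apply: (@shift_in _ _ (r / 8)) => //; lra.
  have := cder_affine (- deriv1 f z * z) (deriv1 f z) (z + t%:C * h).
  by apply: (cder_ext (r := 1)) => // v _; ring.
apply: le_trans (deriv1_lip hz _) _; first by lra.
by rewrite ler_wpM2l.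
Qed.

Let diff_quotient_close z h : normc (z - w) < r / 8 -> h != 0 -> normc h < r / 4 ->
  normc (q h z - deriv1 f z) <= second_order_bound M r * normc h.
Proof.
have r_gt0 := r0; move=> hz h0 hh; have H := taylor1 hz hh.
have hp : 0 < normc h by rewrite normc_gt0.
rewrite -(ler_pM2r hp) -normcM -mulrA -expr2; apply: le_trans H.
by rewrite le_eqVlt; apply/orP; left; apply/eqP; congr normc; rewrite /q; field.
Qed.

(** The quotient L h = (f'(w + h) - f'(w)) / h is the derivative of [q h] at w. Since [q h] and
    [q k] are both close to f', Cauchy's estimate applied to [q h - q k] shows that L satisfies the
    Cauchy criterion as h tends to 0. *)
Lemma cder_deriv1_center : exists l, cder (deriv1 f) w l.
Proof.
have r_gt0 := r0; pose A := second_order_bound M r.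
have A0 : 0 <= A by exact: second_order_bound_ge0.
pose B := 24 * A / (r / 8).
have B0 : 0 <= B by rewrite !(divr_ge0, mulr_ge0)// ltW.
pose L h := (deriv1 f (w + h) - deriv1 f w) / h.
have w0 : normc (w - w) = 0 by rewrite subrr normc0.
have LL h (k : C) : h != 0 -> k != 0 -> normc h < r / 4 -> normc k < r / 4 ->
    normc (L h - L k) <= B * (normc h + normc k).
  move=> h0 k0 hh hk; have r8 : 0 < r / 8 by lra.
  have -> : B * (normc h + normc k) = 24 * (A * (normc h + normc k)) / (r / 8).
    by rewrite /B; field; rewrite gt_eqF.
  apply: (@le_cder _ (fun z => q h z - q k z) w) => //.
  - by move=> z hz; eexists; apply: cderB; apply: dq => //; lra.
  - move=> z hz; have := diff_quotient_close hz h0 hh; have := diff_quotient_close hz k0 hk.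
    rewrite -/A => h1 h2.
    have -> : q h z - q k z = (q h z - deriv1 f z) - (q k z - deriv1 f z) by ring.
    by apply: le_trans (le_normcB _ _) _; lra.
  - by apply: cderB; apply: dq => //; lra.
(* The limit is first taken along this sequence of increments, then compared with every small h. *)
pose hn n : C := (r / 8 / 2 ^+ n)%:C.
have hn0 n : hn n != 0.
  by rewrite -normc_gt0 normc_real gtr0_norm divr_gt0 ?exprn_gt0// divr_gt0.
have hnE n : normc (hn n) = r / 8 / 2 ^+ n.
  by rewrite normc_real gtr0_norm// divr_gt0 ?exprn_gt0// divr_gt0.
have hn_lt e : 0 < e -> exists N, forall n, (N <= n)%N -> normc (hn n) < e.
  move=> e0; have r8 : 0 < r / 8 by lra.
  have [N hN] := ltr_pow2_shrink r8 e0; exists N => n Nn; rewrite hnE.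
  apply: le_lt_trans hN; rewrite ler_pM2l// lef_pV2 ?posrE ?exprn_gt0//.
  by rewrite ler_weXn2l// ler1n.
have hn4 n : normc (hn n) < r / 4.
  rewrite hnE ltr_pdivrMr ?exprn_gt0//.
  have : 1 <= 2 ^+ n :> R by rewrite exprn_ege1// ler1n.
  nra.
have [l hl] : exists l, forall e, 0 < e -> exists N, forall n, (N <= n)%N -> normc (L (hn n) - l) <= e.
  apply: ccauchy_limit => e e0.
  have e1 : 0 < e / (2 * B + 1) by rewrite divr_gt0//; lra.
  have [N hN] := hn_lt _ e1; exists N => n m /hN h1 /hN h2.
  apply: le_trans (LL _ _ (hn0 n) (hn0 m) (hn4 n) (hn4 m)) _.
  move: h1 h2; rewrite !ltr_pdivlMr; try lra.
  have := normc_ge0 (hn n); have := normc_ge0 (hn m); nra.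
have lim h : h != 0 -> normc h < r / 4 -> normc (L h - l) <= B * normc h.
  move=> h0 hh; apply/ler_addgt0Pr => e e0.
  have [N1 hN1] := hl (e / 2) ltac:(lra).
  have e1 : 0 < e / (2 * (B + 1)) by rewrite divr_gt0// mulr_gt0//; lra.
  have [N2 hN2] := hn_lt _ e1; pose n := maxn N1 N2.
  have := hN1 n (leq_maxl _ _); have := hN2 n (leq_maxr _ _) => h1 h2.
  have h3 := LL _ _ h0 (hn0 n) hh (hn4 n).
  have h4 : B * normc (hn n) <= e / 2.
    move: h1; rewrite ltr_pdivlMr; last by rewrite mulr_gt0//; lra.
    have := normc_ge0 (hn n); nra.
  have -> : L h - l = (L h - L (hn n)) + (L (hn n) - l) by ring.
  apply: le_trans (le_normcD _ _) _; lra.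
exists l; apply: eps_cder => e e0; exists (Num.min (r / 4) (e / (B + 1))).
  by rewrite lt_min !divr_gt0//; lra.
have B1 : 0 < B + 1 by lra.
move=> h; rewrite lt_min => /andP[h1]; rewrite ltr_pdivlMr// => h2; have [->|h0] := eqVneq h 0.
  by rewrite addr0 mulr0 subrr subr0 normc0 mulr0.
have -> : deriv1 f (w + h) - deriv1 f w - l * h = (L h - l) * h by rewrite /L; field.
rewrite normcM; apply: ler_wpM2r; first exact: normc_ge0.
apply: (le_trans (lim h h0 h1)); have := normc_ge0 h; nra.
Qed.

End BoundedHolomorphic.

Lemma hol_bounded f w r : 0 < r -> hol f w r -> exists s M,
  [/\ 0 < s, s <= r & forall z, normc (z - w) < s -> normc (f z) <= M].
Proof.
move=> r0 hf; have [l /cder_ccont/(_ _ ltr01)[d d0 hd]] : exists l, cder f w l.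
  by apply: hf; rewrite subrr normc0.
exists (Num.min d r), (normc (f w) + 1); split; rewrite ?lt_min ?d0// ?ge_min ?lexx ?orbT//.
move=> z; rewrite lt_min => /andP[/hd h _].
by have := le_normc_sub (f z) (f w); lra.
Qed.

Lemma hol_deriv1_hol f w r : hol f w r -> hol (deriv1 f) w r.
Proof.
move=> hf z hz; have r0 : 0 < r - normc (z - w) by lra.
have hfz : hol f z (r - normc (z - w)) by apply: hol_sub hf; lra.
have [s [M [s0 sr hM]]] := hol_bounded r0 hfz.
have hfs : hol f z s by move=> v hv; apply: hfz; lra.
exact: cder_deriv1_center s0 hfs hM.
Qed.

End HolomorphicFunctions.

(** * Orders of zeros, Weierstrass's and Hurwitz's theorems *)

Section ZerosAndLimits.
Context {R : realType}.
Local Open Scope complex_scope.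
Local Open Scope ring_scope.
Local Notation C := R[i].
Implicit Types (f g k : C -> C) (z w l h v : C) (r s d e M c A : R) (n m : nat) (u : nat -> C -> C).

Lemma quadratic_remainder f z h r A l : 0 <= A -> hol f z r -> normc h < r ->
  (forall t : R, 0 <= t <= 1 ->
     normc (deriv1 f (z + t%:C * h) - deriv1 f z - l * (t%:C * h)) <= A) ->
  normc (f (z + h) - f z - deriv1 f z * h - l / 2 * h ^+ 2) <= A * normc h.
Proof.
move=> A0 hf hh hA.
pose p v := f v - (deriv1 f z * (v - z) + l / 2 * ((v - z) * (v - z))).
have -> : f (z + h) - f z - deriv1 f z * h - l / 2 * h ^+ 2 = p (z + h) - p z.
  by rewrite /p; ring.
apply: mean_value => // t /andP[t0 t1].
have th : normc (t%:C * h) <= normc h.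
  by rewrite normcM normc_real ger0_norm//; have := normc_ge0 h; nra.
exists (deriv1 f (z + t%:C * h) - deriv1 f z - l * (t%:C * h)); last by apply: hA; rewrite t0.
have cz v : cder (fun v => v - z) v 1.
  by have := cderB (cder_id v) (cder_cst z v); rewrite subr0.
apply: cder_eq (cderB (hol_deriv1 hf _)
   (cderD (cderZ (deriv1 f z) (cz _)) (cderZ (l / 2) (cderM (cz _) (cz _))))) _.
  by rewrite addrAC subrr add0r; lra.
by field.
Qed.

(** Only the point w matters: there the second order expansion of f shows that k has derivative
    f''(w) / 2. Iterating this extracts powers of z - w without power series. *)
Lemma hol_divided_difference f w r : 0 < r -> hol f w r ->
  exists2 k, hol k w r & (forall z, f z = f w + (z - w) * k z) /\ k w = deriv1 f w.
Proof.
move=> r0 hf; pose k z := if z == w then deriv1 f w else (f z - f w) / (z - w).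
exists k; last first.
  split; last by rewrite /k eqxx.
  move=> z; rewrite /k; case: eqVneq => [->|zw]; first by rewrite subrr mul0r addr0.
  by rewrite mulrC divfK ?subr_eq0// addrC subrK.
move=> z hz; have [->|zw] := eqVneq z w; last first.
  have zw0 : 0 < normc (z - w) by rewrite normc_gt0 subr_eq0.
  have := cderM (cderB (hol_deriv1 hf hz) (cder_cst (f w) z)) (cder_inv_sub zw).
  move=> H; eexists; apply: cder_ext zw0 _ H => v hv; rewrite /k.
  by case: eqVneq hv => // ->; rewrite normcB ltxx.
have w0 : normc (w - w) < r by rewrite subrr normc0.
have [l fl] := hol_deriv1_hol hf w0.
exists (l / 2); apply: eps_cder => e e0; have [d d0 hd] := cder_eps fl e0.
exists (Num.min d r) => [|h]; rewrite lt_min ?d0// => /andP[h1 h2].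
have [->|h0] := eqVneq h 0; first by rewrite addr0 mulr0 subrr subr0 normc0 mulr0.
have hp : 0 < normc h by rewrite normc_gt0.
have wh : (w + h == w) = false by rewrite -subr_eq0 addrAC subrr add0r (negPf h0).
have H : normc (f (w + h) - f w - deriv1 f w * h - l / 2 * h ^+ 2) <= e * normc h * normc h.
  apply: (@quadratic_remainder _ _ _ r) => // [|t /andP[t0 t1]].
    by rewrite mulr_ge0// ltW.
  have th : normc (t%:C * h) <= normc h.
    by rewrite normcM normc_real ger0_norm//; have := normc_ge0 h; nra.
  apply: le_trans (hd _ _) _; first exact: le_lt_trans th h1.
  by rewrite ler_pM2l.
rewrite -(ler_pM2r hp) -normcM; apply: le_trans H.
rewrite /k wh eqxx le_eqVlt; apply/orP; left; apply/eqP; congr normc.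
by rewrite [w + h - w]addrAC subrr add0r; field.
Qed.

Lemma hol_factor f w r m : 0 < r -> hol f w r ->
  (exists n k, [/\ hol k w r, k w != 0 & forall z, f z = (z - w) ^+ n * k z]) \/
  (exists2 k, hol k w r & forall z, f z = (z - w) ^+ m * k z).
Proof.
move=> r0 hf; elim: m => [|m [|[k hk fk]]]; last 1 first.
- have [k' hk' [kE _]] := hol_divided_difference r0 hk.
  have [k0|k0] := eqVneq (k w) 0; last by left; exists m, k.
  by right; exists k' => // z; rewrite fk kE k0 add0r exprSr mulrA.
- by right; exists f => // z; rewrite expr0 mul1r.
- by left.
Qed.

(** Suppose f = (z - w)^m k for every m. On the annulus of radii r / 4 and r / 2 around z one has |v
    - w| >= 3 r / 16, so [le_center] gives |k(z)| <= 4 M / (3 r / 16)^m. As |z - w| < r / 16, this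
    makes |f(z)| at most 4 M / 2^m, for every m. *)
Lemma hol_zero_order_bounded f w r M : 0 < r -> hol f w r ->
  (forall z, normc (z - w) < r -> normc (f z) <= M) ->
  (exists n k, [/\ hol k w r, k w != 0 & forall z, f z = (z - w) ^+ n * k z]) \/
  (forall z, normc (z - w) < r / 16 -> f z = 0).
Proof.
move=> r0 hf hM; case: (pselect (exists n k,
  [/\ hol k w r, k w != 0 & forall z, f z = (z - w) ^+ n * k z])) => [|nk]; first by left.
right=> z hz; apply: normc_lt_eq0 => e e0.
have M0 : 0 <= M by apply: le_trans (hM w _); rewrite ?normc_ge0// subrr normc0.
have M1 : 0 < 4 * M + 1 by lra.
have [m hm] := ltr_pow2_shrink M1 e0.
have [//|[k hk fk]] := hol_factor m r0 hf.
have a0 : 0 < 3 * r / 16 by lra.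
have kz : normc (k z) <= 4 * (M / (3 * r / 16) ^+ m).
  apply: (@le_center _ _ _ (r / 4)) => [|v hv|v /andP[v1 v2]]; first by lra.
    by apply: hk; apply: le_lt_trans (normc_dist_trans z _ _) _; lra.
  have hvr : normc (v - w) < r.
    by apply: le_lt_trans (normc_dist_trans z _ _) _; lra.
  have hv2 : 3 * r / 16 <= normc (v - w).
    by have := normc_dist_trans w v z; rewrite [normc (w - z)]normcB; lra.
  rewrite ler_pdivlMr ?exprn_gt0//; apply: le_trans (hM _ hvr).
  rewrite fk normcM normcX mulrC ler_wpM2r ?normc_ge0//.
  by rewrite lerXn2r ?nnegrE ?normc_ge0// ltW.
rewrite fk normcM normcX; apply: le_trans (ltW hm).
apply: le_trans (_ : (normc (z - w)) ^+ m * (4 * (M / (3 * r / 16) ^+ m)) <= _).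
  by rewrite ler_wpM2l// exprn_ge0// normc_ge0.
have -> : normc (z - w) ^+ m * (4 * (M / (3 * r / 16) ^+ m)) =
    4 * M * (normc (z - w) / (3 * r / 16)) ^+ m.
  by move: (3 * r / 16) => a; rewrite expr_div_n; ring.
have : (normc (z - w) / (3 * r / 16)) ^+ m <= (2^-1) ^+ m.
  have q0 : 0 <= normc (z - w) / (3 * r / 16) by rewrite divr_ge0 ?normc_ge0 ?(ltW a0).
  have q1 : normc (z - w) / (3 * r / 16) <= 2^-1 by rewrite ler_pdivrMr//; lra.
  by rewrite lerXn2r ?nnegrE ?invr_ge0.
rewrite exprVn => H; apply: le_trans (ler_wpM2l _ H) _; first by lra.
by rewrite ler_wpM2r ?invr_ge0 ?exprn_ge0//; lra.
Qed.

Lemma hol_zero_order f w r : 0 < r -> hol f w r ->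
  (exists n k d c, [/\ 0 < d, 0 < c, hol k w d, forall z, f z = (z - w) ^+ n * k z &
     forall z, normc (z - w) < d -> c <= normc (k z)]) \/
  (exists2 d, 0 < d & forall z, normc (z - w) < d -> f z = 0).
Proof.
move=> r0 hf; have [s [M [s0 sr hM]]] := hol_bounded r0 hf.
have hfs : hol f w s by move=> v hv; apply: hf; lra.
have [[n [k [hk kw fk]]]|H] := hol_zero_order_bounded s0 hfs hM; last first.
  by right; exists (s / 16) => //; rewrite divr_gt0.
left; have [l /cder_ccont ck] : exists l, cder k w l by apply: hk; rewrite subrr normc0.
have [d d0 hd] := ccont_neq0 ck kw.
exists n, k, (Num.min d s), (normc (k w) / 2); split => //.
- by rewrite lt_min d0.
- by rewrite divr_gt0// normc_gt0.
- by move=> v; rewrite lt_min => /andP[_]; exact: hk.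
- by move=> z; rewrite lt_min => /andP[/hd/ltW].
Qed.

Lemma hol_isolated_zero f w r : 0 < r -> hol f w r ->
  (exists2 d, 0 < d & forall z, z != w -> normc (z - w) < d -> f z != 0) \/
  (exists2 d, 0 < d & forall z, normc (z - w) < d -> f z = 0).
Proof.
move=> r0 /(hol_zero_order r0)[[n [k [d [c [d0 c0 _ fk hc]]]]]|]; last by right.
left; exists d => // z zw /hc hz; rewrite fk mulf_neq0 ?expf_neq0 ?subr_eq0//.
by rewrite -normc_gt0; apply: lt_le_trans hz.
Qed.

Definition cvg_unif u g w r := forall e, 0 < e ->
  exists N, forall n, (N <= n)%N -> forall z, normc (z - w) < r -> normc (u n z - g z) <= e.

Definition eventually_hol u w r := exists N, forall n, (N <= n)%N -> hol (u n) w r.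

Lemma cvg_unif_sub u g w r v s : normc (v - w) + s <= r -> cvg_unif u g w r -> cvg_unif u g v s.
Proof.
move=> vs cu e /cu[N hN]; exists N => n /hN H z hz; apply: H.
by apply: le_lt_trans (normc_dist_trans v _ _) _; lra.
Qed.

(** Cauchy's estimate on differences makes the derivatives at w a Cauchy sequence. The second order
    bound [taylor1] holds with one constant for all late n, so it survives the passage to the limit
    and shows that g is differentiable at w. *)
Lemma weierstrass_center u g w r : 0 < r -> eventually_hol u w r -> cvg_unif u g w r ->
  exists2 l, cder g w l & forall e, 0 < e ->
    exists N, forall n, (N <= n)%N -> normc (deriv1 (u n) w - l) <= e.
Proof.
move=> r0 [N0 hN0] cu; have w0 : normc (w - w) = 0 by rewrite subrr normc0.
have du n : (N0 <= n)%N -> cder (u n) w (deriv1 (u n) w).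
  by move=> hn; apply: hol_deriv1 (hN0 _ hn) _; rewrite w0.
have [l hl] : exists l, forall e, 0 < e ->
    exists N, forall n, (N <= n)%N -> normc (deriv1 (u n) w - l) <= e.
  apply: ccauchy_limit => e e0; have [N hN] := cu (e * r / 48) ltac:(nra).
  exists (maxn N N0) => n m; rewrite !geq_max => /andP[n1 n2] /andP[m1 m2].
  have -> : e = 24 * (e * r / 24) / r by field; rewrite gt_eqF.
  apply: (@le_cder _ (fun z => u n z - u m z) w) => //.
  - move=> z hz; eexists; apply: cderB; first exact: hol_deriv1 (hN0 _ n2) hz.
    exact: hol_deriv1 (hN0 _ m2) hz.
  - move=> z hz; have := hN _ n1 _ hz; have := hN _ m1 _ hz => h1 h2.
    have -> : u n z - u m z = (u n z - g z) - (u m z - g z) by ring.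
    by apply: le_trans (le_normcB _ _) _; lra.
  - by apply: cderB; exact: du.
exists l => //.
have [N1 hN1] := cu (1 / 2) ltac:(lra); pose K := maxn N0 N1.
have [s [M [s0 sr hM]]] := hol_bounded r0 (hN0 K (leq_maxl _ _)).
have bM n : (K <= n)%N -> forall z, normc (z - w) < s -> normc (u n z) <= M + 1.
  rewrite geq_max => /andP[_ n1] z hz; have hzr : normc (z - w) < r by lra.
  have h1 := hN1 _ n1 _ hzr; have h2 := hN1 K (leq_maxr _ _) _ hzr; have h3 := hM _ hz.
  have -> : u n z = (u n z - g z) - (u K z - g z) + u K z by ring.
  apply: le_trans (le_normcD _ _) _; have := le_normcB (u n z - g z) (u K z - g z); lra.
set B := second_order_bound (M + 1) s.
have M10 : 0 <= M + 1.
  by apply: le_trans (bM K (leqnn _) w _); rewrite ?normc_ge0// w0.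
have B0 : 0 <= B by exact: second_order_bound_ge0.
have key h : normc h < s / 4 -> normc (g (w + h) - g w - l * h) <= B * normc h ^+ 2.
  move=> hh; apply/ler_addgt0Pr => e e0; have nh := normc_ge0 h.
  have e1 : 0 < e / (4 * (normc h + 1)) by rewrite divr_gt0//; nra.
  have [N2 hN2] := hl _ e1; have [N3 hN3] := cu (e / 4) ltac:(lra).
  pose n := maxn K (maxn N2 N3).
  have nK : (K <= n)%N by rewrite leq_max leqnn.
  have n2 : (N2 <= n)%N by rewrite !leq_max leqnn orbT.
  have n3 : (N3 <= n)%N by rewrite !leq_max leqnn !orbT.
  have n0 : (N0 <= n)%N by apply: leq_trans nK; exact: leq_maxl.
  have hs : hol (u n) w s by move=> z hz; apply: (hN0 _ n0); lra.
  have t1 : normc (u n (w + h) - u n w - deriv1 (u n) w * h) <= B * normc h ^+ 2.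
    by apply: taylor1 hs (bM _ nK) _ _ _ hh => //; rewrite w0; lra.
  have whr : normc (w + h - w) < r by rewrite addrAC subrr add0r; lra.
  have h1 := hN3 _ n3 _ whr; have h2 : normc (u n w - g w) <= e / 4 by apply: hN3 => //; rewrite w0.
  have h3 : normc ((deriv1 (u n) w - l) * h) <= e / 4.
    rewrite normcM; apply: le_trans (ler_wpM2r nh (hN2 _ n2)) _.
    by rewrite mulrAC ler_pdivrMr; clear -nh e0; nra.
  have -> : g (w + h) - g w - l * h = (u n (w + h) - u n w - deriv1 (u n) w * h)
    - (u n (w + h) - g (w + h)) + (u n w - g w) + (deriv1 (u n) w - l) * h by ring.
  apply: le_trans (le_normcD _ _) _; apply: le_trans (lerD (le_normcD _ _) (lexx _)) _.
  apply: le_trans (lerD (lerD (le_normcB _ _) (lexx _)) (lexx _)) _.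
  lra.
apply: eps_cder => e e0; exists (Num.min (s / 4) (e / (B + 1))).
  by rewrite lt_min !divr_gt0//; lra.
have B1 : 0 < B + 1 by lra.
move=> h; rewrite lt_min => /andP[h1]; rewrite ltr_pdivlMr// => h2.
by apply: le_trans (key _ h1) _; have := normc_ge0 h; rewrite expr2; nra.
Qed.

Lemma weierstrass u g w r : 0 < r -> eventually_hol u w r -> cvg_unif u g w r -> hol g w r.
Proof.
move=> r0 [N hN] cu z hz; have s0 : 0 < r - normc (z - w) by lra.
have [||l gl _] := @weierstrass_center u g z _ s0; last by exists l.
- by exists N => n /hN; apply: hol_sub; lra.
- by apply: cvg_unif_sub cu; lra.
Qed.

Lemma cvg_unif_deriv1 u g w r s : 0 < s -> s < r -> eventually_hol u w r -> cvg_unif u g w r ->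
  cvg_unif (fun n => deriv1 (u n)) (deriv1 g) w s.
Proof.
move=> s0 sr hu cu; have r0 : 0 < r by lra.
have hg := weierstrass r0 hu cu; move: hu => [N1 hN1].
move=> e e0; have d0 : 0 < r - s by lra.
have [N hN] := cu (e * (r - s) / 24) ltac:(nra).
exists (maxn N N1) => n; rewrite geq_max => /andP[n1 n2] z hz.
have -> : e = 24 * (e * (r - s) / 24) / (r - s) by field; rewrite gt_eqF.
have hzr : normc (z - w) < r by lra.
apply: (@le_cder _ (fun z => u n z - g z) z) => //.
- move=> v hv; have hvr : normc (v - w) < r.
    by apply: le_lt_trans (normc_dist_trans z _ _) _; lra.
  eexists; apply: cderB; first exact: hol_deriv1 (hN1 _ n2) hvr.
  exact: hol_deriv1 hg hvr.
- move=> v hv; apply: hN => //.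
  by apply: le_lt_trans (normc_dist_trans z _ _) _; lra.
- apply: cderB; first exact: hol_deriv1 (hN1 _ n2) hzr.
  exact: hol_deriv1 hg hzr.
Qed.

(** Instead of the argument principle, [le_center] is applied to 1 / u_j. If the zero of g had
    finite order, |g| would be bounded below on an annulus, so 1 / u_j would be bounded at w,
    although u_j(w) tends to 0. *)
Lemma hurwitz u g w r : 0 < r -> eventually_hol u w r -> cvg_unif u g w r ->
  (exists N, forall n, (N <= n)%N -> forall z, normc (z - w) < r -> u n z != 0) ->
  g w = 0 -> exists2 d, 0 < d & forall z, normc (z - w) < d -> g z = 0.
Proof.
move=> r0 hu cu [N2 hN2] gw; have hg := weierstrass r0 hu cu; move: hu => [N1 hN1].
have [[n [k [d [c [d0 c0 _ gk hc]]]]]|//] := hol_zero_order r0 hg; exfalso.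
pose s := Num.min d r / 4.
have m0 : 0 < Num.min d r by rewrite lt_min d0.
have md : Num.min d r <= d by rewrite ge_min lexx.
have mr : Num.min d r <= r by rewrite ge_min lexx orbT.
have s0 : 0 < s by rewrite divr_gt0.
have sd : 2 * s < d by rewrite /s; lra.
have sr : 2 * s < r by rewrite /s; lra.
pose m := s ^+ n * c; have mp : 0 < m by rewrite mulr_gt0 ?exprn_gt0.
have gm z : s <= normc (z - w) <= 2 * s -> m <= normc (g z).
  move=> /andP[z1 z2]; rewrite gk normcM normcX ler_pM ?exprn_ge0 ?(ltW s0) ?(ltW c0)//.
    by rewrite lerXn2r ?nnegrE ?normc_ge0 ?(ltW s0).
  by apply: hc; lra.
(* On the annulus |u_j| >= 8 m / 9, hence |u_j(w)| >= 2 m / 9 by [le_center], against |u_j(w)| <= m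
   / 9. *)
have [N hN] := cu (m / 9) ltac:(lra); pose j := maxn N (maxn N1 N2).
have jN : (N <= j)%N by rewrite leq_max leqnn.
have j1 : (N1 <= j)%N by rewrite !leq_max leqnn orbT.
have j2 : (N2 <= j)%N by rewrite !leq_max leqnn !orbT.
have w0 : normc (w - w) < r by rewrite subrr normc0.
have : normc ((u j w)^-1) <= 4 * (m * 8 / 9)^-1.
  apply: (@le_center _ (fun z => (u j z)^-1) _ s) => // z hz.
    have zr : normc (z - w) < r by lra.
    by eexists; apply: cderV (hN2 _ j2 _ zr) (hol_deriv1 (hN1 _ j1) zr).
  have zr : normc (z - w) < r by lra.
  have := hN _ jN _ zr; have := gm _ hz; have := le_normc_sub (g z) (u j z).
  rewrite [normc (g z - _)]normcB normcV => h1 h2 h3.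
  by rewrite lef_pV2 ?posrE; clear -h1 h2 h3 mp; lra.
have := hN _ jN _ w0; rewrite gw subr0 normcV => h1.
have u0 : 0 < normc (u j w) by rewrite normc_gt0; exact: hN2.
have -> : 4 * (m * 8 / 9)^-1 = (m * 2 / 9)^-1 by field; rewrite gt_eqF.
by rewrite lef_pV2 ?posrE; clear -h1 u0 mp; lra.
Qed.

End ZerosAndLimits.

(** * Complex normed spaces *)

Section RealNorm.
Context {R : realType}.
Local Open Scope complex_scope.
Local Open Scope ring_scope.
Local Notation C := R[i].
Variable V : normedModType C.
Implicit Types (v w x y z : V) (a : C) (r d e : R).

(** The norm of a normed space over [R[i]] has values in [R[i]]; this is the same number in [R]. *)
Definition nv v : R := complex.Re `|v|.

Lemma nvE v : `|v| = (nv v)%:C.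
Proof. by rewrite /nv RRe_real// ger0_real. Qed.

Lemma nv_ge0 v : 0 <= nv v.
Proof. by rewrite -ler0c -nvE. Qed.

Lemma nvD v w : nv (v + w) <= nv v + nv w.
Proof. by have := ler_normD v w; rewrite !nvE -rmorphD lecR. Qed.

Lemma nv_trans w x y : nv (x - y) <= nv (x - w) + nv (w - y).
Proof. by apply: le_trans (nvD _ _); rewrite addrA subrK. Qed.

Lemma nvB v w : nv (v - w) = nv (w - v).
Proof. by rewrite /nv distrC. Qed.

Lemma nvZ a v : nv (a *: v) = normc a * nv v.
Proof. by apply: complexI; rewrite -nvE normrZ nvE rmorphM. Qed.

Lemma nv0 : nv (0 : V) = 0.
Proof. by rewrite /nv normr0. Qed.

Lemma nv_eq0 v : (nv v == 0) = (v == 0).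
Proof. by rewrite -[v == 0]normr_eq0 nvE fmorph_eq0. Qed.

Lemma ball_nv z r w : ball z r%:C w = (nv (z - w) < r) :> Prop.
Proof. by rewrite -ball_normE /ball_ /= nvE ltcR. Qed.

Lemma nbhs_nv z (U : set V) :
  nbhs z U <-> exists2 d, 0 < d & forall w, nv (w - z) < d -> U w.
Proof.
split=> [/nbhs_ballP[e /= e0 eU]|[d d0 dU]].
  have eE : e = (complex.Re e)%:C by rewrite RRe_real// gtr0_real.
  exists (complex.Re e) => [|w]; first by rewrite -ltcR -eE.
  by rewrite nvB => hw; apply: eU; rewrite eE ball_nv.
apply/nbhs_ballP; exists d%:C; first by rewrite /= ltcR.
by move=> w; rewrite ball_nv nvB => /dU.
Qed.

Lemma compact_total_bounded (A : set V) e : compact A -> 0 < e ->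
  exists s : seq V, forall w, A w -> exists2 x, x \in s & nv (w - x) < e.
Proof.
rewrite compact_cover => cA e0.
have [||D' _ hD] := cA _ setT (fun x => ball x e%:C).
- by move=> x _; exact: ball_open.
- by move=> x _; exists x => //; rewrite ball_nv subrr nv0.
exists (finmap.enum_fset D') => w /hD[x /= xD]; rewrite ball_nv nvB => hw.
by exists x.
Qed.

End RealNorm.

Section CompactSets.
Context {R : realType}.
Local Open Scope complex_scope.
Local Open Scope ring_scope.
Local Notation C := R[i].
Local Notation Re := (@complex.Re R).
Local Notation Im := (@complex.Im R).
Implicit Types (w z : C) (r : R).

Lemma nv_normc z : nv (z : C) = normc z.
Proof. by []. Qed.

Lemma nbhs_normc z (U : set C) :
  nbhs z U <-> exists2 d : R, 0 < d & forall w, normc (w - z) < d -> U w.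
Proof. exact: nbhs_nv. Qed.

Lemma compact_square a b c d : compact [set z : C | a <= Re z <= b /\ c <= Im z <= d].
Proof.
pose f (p : R * R) : C := p.1 +i* p.2.
have -> : [set z : C | a <= Re z <= b /\ c <= Im z <= d] = f @` (`[a, b] `*` `[c, d]).
  apply/seteqP; split => [[x y] /= [hx hy]|_ [[x y] [/= hx hy] <-]].
    by exists (x, y) => //; rewrite /= !in_itv.
  by move: hx hy; rewrite !in_itv.
apply: continuous_compact; last by apply: compact_setX; exact: segment_compact.
apply: continuous_subspaceT => -[x y] U /nbhs_normc[e e0 eU].
apply/nbhs_ballP; exists (e / 2) => /= [|[x' y'] [/= hx hy]]; first by lra.
apply: eU; apply: le_lt_trans (normc_le_ReIm _) _.
move: hx hy; rewrite /ball /= [`|x - _|]distrC [`|y - _|]distrC; lra.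
Qed.

Lemma compact_disc w r : compact [set z : C | normc (z - w) <= r].
Proof.
apply: subclosed_compact (@compact_square (Re w - r) (Re w + r) (Im w - r) (Im w + r)) _.
- rewrite -openC openE => z /= /negP; rewrite -ltNge => hz; apply/nbhs_normc.
  exists (normc (z - w) - r) => [|v hv]; first by rewrite subr_gt0.
  apply/negP; rewrite -ltNge; have := normc_dist_trans v z w.
  by rewrite [normc (z - v)]normcB; lra.
- move=> z /= hz; have := Re_lip z w; have := Im_lip z w.
  by rewrite !ler_norml; lra.
Qed.

Lemma disc_max (p : C -> R) w r : 0 <= r ->
  (forall z, normc (z - w) <= r -> forall e, 0 < e -> exists2 d, 0 < d &
     forall v, normc (v - z) < d -> `|p v - p z| < e) ->
  exists2 z0, normc (z0 - w) <= r & forall z, normc (z - w) <= r -> p z <= p z0.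
Proof.
move=> r0 cp.
have A0 : [set z : C | normc (z - w) <= r] !=set0 by exists w; rewrite /= subrr normc0.
have [|z0] := @compact_EVT_max _ _ p _ A0 (@compact_disc w r).
  apply: continuous_in_subspaceT => z; rewrite inE /= => hz.
  move=> U /nbhs_ballP[e /= e0 eU]; have [d d0 hd] := cp _ hz _ e0.
  by apply/nbhs_normc; exists d => // v /hd hv; apply: eU; rewrite /ball /= distrC.
by rewrite inE /= => h0 hm; exists z0 => // z hz; apply: hm; rewrite inE.
Qed.

Lemma disc_max_norm (f : C -> C) w r : 0 <= r -> (forall z, normc (z - w) <= r -> ccont f z) ->
  exists2 z0, normc (z0 - w) <= r & forall z, normc (z - w) <= r -> normc (f z) <= normc (f z0).
Proof.
move=> r0 cf; apply: (@disc_max (fun z => normc (f z))) => // z /cf cz e /cz[d d0 hd].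
exists d => // v /hd; apply: le_lt_trans; rewrite ler_norml le_normc_sub andbT.
by have := le_normc_sub (f z) (f v); rewrite [normc (f z - _)]normcB; lra.
Qed.

Lemma disc_bounded (f : C -> C) w r : 0 <= r -> (forall z, normc (z - w) <= r -> ccont f z) ->
  exists2 M, 0 <= M & forall z, normc (z - w) <= r -> normc (f z) <= M.
Proof.
move=> r0 cf; have [z0 _ hm] := disc_max_norm r0 cf.
by exists (normc (f z0)); rewrite ?normc_ge0.
Qed.

End CompactSets.

Section RowVectors.
Context {R : realType}.
Local Open Scope complex_scope.
Local Open Scope ring_scope.
Local Notation C := R[i].
Variable n : nat.
Implicit Types (v w z : 'rV[C]_n) (r : R).

Lemma nv_rV_lt v r : 0 < r -> (nv v < r) <-> (forall i, normc (v 0 i) < r).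
Proof.
move=> r0; have H : ball v r%:C 0 <-> forall i, normc (v 0 i) < r.
  split => [h i|h].
    by case: h => _ /(_ 0 i); rewrite ball_nv mxE subr0 nv_normc.
  by split=> [|i j]; [rewrite ltcR|rewrite ball_nv mxE subr0 nv_normc ord1].
by rewrite -H ball_nv subr0.
Qed.

Lemma compact_polydisc z r : compact [set v : 'rV[C]_n | forall i, normc (v 0 i - z 0 i) <= r].
Proof. by apply: (@rV_compact C n (fun i => [set x | normc (x - z 0 i) <= r])) => i; exact: compact_disc. Qed.

End RowVectors.

(** * Entire functions with three totally ramified values *)

Section EntireFunctions.
Context {R : realType}.
Local Open Scope complex_scope.
Local Open Scope ring_scope.
Local Notation C := R[i].
Implicit Types (f g h k : C -> C) (z w l v : C) (r s d e M : R) (n m : nat).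

Definition entire f := forall z, exists l, cder f z l.

Lemma entire_hol f w r : entire f -> hol f w r.
Proof. by move=> ef z _; exact: ef. Qed.

Lemma entire_cder f z : entire f -> cder f z (deriv1 f z).
Proof. by move=> /(_ z)[l fl]; rewrite (deriv1E fl). Qed.

Lemma entire_deriv1 f : entire f -> entire (deriv1 f).
Proof.
move=> ef z; have z1 : normc (z - z) < 1 by rewrite subrr normc0.
exact: hol_deriv1_hol (@entire_hol f z 1 ef) z z1.
Qed.

Lemma entire_ccont f z : entire f -> ccont f z.
Proof. by move=> /(_ z)[l /cder_ccont]. Qed.

Lemma hol_identity f w r M d : 0 < r -> hol f w r ->
  (forall z, normc (z - w) < r -> normc (f z) <= M) ->
  0 < d -> (forall z, normc (z - w) < d -> f z = 0) ->
  forall z, normc (z - w) < r / 16 -> f z = 0.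
Proof.
move=> r0 hf hM d0 f0; have [[n [k [hk kw fk]]]|//] := hol_zero_order_bounded r0 hf hM.
exfalso; have [l /cder_ccont ck] : exists l, cder k w l by apply: hk; rewrite subrr normc0.
have [c c0 hc] := ccont_neq0 ck kw.
have m0 : 0 < Num.min c d by rewrite lt_min c0.
pose t : C := (Num.min c d / 2)%:C.
have tE : normc t = Num.min c d / 2 by rewrite normc_real gtr0_norm// divr_gt0.
have td : normc (w + t - w) < Num.min c d by rewrite addrAC subrr add0r tE; lra.
move: td; rewrite lt_min => /andP[/hc h1 /f0]; rewrite fk addrAC subrr add0r => /eqP.
rewrite mulf_eq0 expf_eq0 -normc_eq0 tE gt_eqF ?andbF ?divr_gt0//= -normc_eq0 => /eqP h2.
by move: h1; rewrite h2; have := normc_ge0 (k w); lra.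
Qed.

(** An entire function is bounded on every disc, so a single disc with 16 times the needed radius
    suffices; no chain of discs is required. *)
Lemma entire_identity f w d : entire f -> 0 < d -> (forall z, normc (z - w) < d -> f z = 0) ->
  forall z, f z = 0.
Proof.
move=> ef d0 f0 z; pose r := 16 * (normc (z - w) + 1).
have zr : normc (z - w) < r / 16 by rewrite /r; have := normc_ge0 (z - w); lra.
have r0 : 0 < r by have := normc_ge0 (z - w); lra.
have [M _ hM] := disc_bounded (ltW r0) (fun z (_ : normc (z - w) <= r) => entire_ccont z ef).
by apply: (hol_identity r0 (entire_hol ef) (fun z hz => hM z (ltW hz)) d0 f0).
Qed.

Lemma entire_bounded_deriv1 f M : entire f -> (forall z, normc (f z) <= M) ->
  forall z, deriv1 f z = 0.
Proof.
move=> ef hM z; apply: normc_lt_eq0 => e e0.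
have M0 : 0 <= M by apply: le_trans (hM 0); exact: normc_ge0.
have r0 : 0 < 24 * (M + 1) / e by rewrite divr_gt0//; lra.
apply: le_trans (le_cder r0 (entire_hol ef) (fun z _ => hM z) (entire_cder z ef)) _.
by rewrite ler_pdivrMr// [e * _]mulrC divfK ?gt_eqF//; lra.
Qed.

Lemma entire_deriv1_cst f : entire f -> (forall z, deriv1 f z = 0) -> forall z, f z = f 0.
Proof.
move=> ef f0 z; apply: subr0_eq; apply: normc_lt_eq0 => e e0.
have := @mean_value _ f 0 z 0 (lexx _); rewrite add0r mul0r => H.
apply: le_trans _ (ltW e0); apply: H => t _; exists 0; rewrite ?normc0//.
exact: cder_eq (entire_cder _ ef) (f0 _).
Qed.

Lemma ccont_punctured_zero f z d : ccont f z -> 0 < d ->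
  (forall w, w != z -> normc (w - z) < d -> f w = 0) -> f z = 0.
Proof.
move=> cf d0 f0; apply/eqP; apply: contraT => fz.
have [c c0 hc] := ccont_neq0 cf fz.
have m0 : 0 < Num.min c d by rewrite lt_min c0.
pose t : C := (Num.min c d / 2)%:C.
have tE : normc t = Num.min c d / 2 by rewrite normc_real gtr0_norm// divr_gt0.
have td : normc (z + t - z) < Num.min c d by rewrite addrAC subrr add0r tE; lra.
have tz : z + t != z by rewrite -subr_eq0 addrAC subrr add0r -normc_gt0 tE divr_gt0.
move: td; rewrite lt_min => /andP[/hc h1 /(f0 _ tz) h2].
by move: h1; rewrite h2 normc0; have := normc_ge0 (f z); lra.
Qed.

Lemma cderX f z l n : cder f z l -> cder (fun w => f w ^+ n.+1) z (n.+1%:R * f z ^+ n * l).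
Proof.
move=> fl; elim: n => [|n IH].
  by apply: cder_eq (cder_ext ltr01 _ fl) _ => [w _|]; rewrite ?expr1 ?expr0 ?mul1r.
apply: cder_eq (cder_ext ltr01 (fun w _ => esym (exprSr (f w) n.+1)) (cderM IH fl)) _.
by rewrite exprSr -[n.+2]addn1 natrD; ring.
Qed.

Lemma cder_subl w z : cder (fun u => u - w) z 1.
Proof. by have := cderB (cder_id z) (cder_cst w z); rewrite subr0. Qed.

(* A multiple zero of f of order n gives a zero of f'^2 of order 2n - 2 >= n. *)
Lemma multiple_zero_quotient f z : entire f -> f z = 0 -> deriv1 f z = 0 ->
  (forall d, 0 < d -> exists2 w, normc (w - z) < d & f w != 0) ->
  exists d k, [/\ 0 < d, hol k z d &
    forall w, normc (w - z) < d -> deriv1 f w ^+ 2 = k w * f w].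
Proof.
move=> ef fz f'z nz.
have [[n [k [d [c [d0 c0 hk fk kc]]]]]|[d d0 f0]] :=
  hol_zero_order ltr01 (@entire_hol f z 1 ef); last first.
  by have [w /f0 ->] := nz d d0; rewrite eqxx.
have kn0 w : normc (w - z) < d -> k w != 0.
  by move=> /kc h; rewrite -normc_gt0; lra.
have z0 : normc (z - z) < d by rewrite subrr normc0.
have [l kl] := hk _ z0.
case: n fk => [|[|n]] fk.
- by have := kn0 _ z0; have := fk z; rewrite fz expr0 mul1r => <-; rewrite eqxx.
- have := cderM (cder_subl z z) kl; rewrite subrr mul0r addr0 mul1r => H.
  have := cder_ext ltr01 (fun w _ => esym (etrans (fk w) (congr1 (fun x => x * k w) (expr1 (w - z))))) H.
  move=> /deriv1E; rewrite f'z => k0; by have := kn0 _ z0; rewrite -k0 eqxx.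
(* With f = (w - z)^(n+2) k one has f' = (w - z)^(n+1) q, hence f'^2 / f = (w - z)^n q^2 / k. *)
pose q w := n.+2%:R * k w + (w - z) * deriv1 k w.
exists d, (fun w => (w - z) ^+ n * q w ^+ 2 / k w); split => //.
  move=> w hw.
  have ch u : cder (fun w => w - z) u 1 := cder_subl z u.
  have [b cqb] : exists b, cder q w b.
    have [m hm] := hol_deriv1_hol hk hw.
    by eexists; apply: cderD (cderZ _ (hol_deriv1 hk hw)) (cderM (ch w) hm).
  have [b1 hb1] : exists b1, cder (fun w => (w - z) ^+ n) w b1.
    case: (n) => [|j]; last by eexists; exact: cderX (ch w).
    by exists 0; apply: cder_ext ltr01 _ (cder_cst 1 w) => u _; rewrite expr0.
  eexists; apply: cderM (cderM hb1 (cderX 1 cqb)) (cderV (kn0 _ hw) (hol_deriv1 hk hw)).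
move=> w hw.
have : cder f w (n.+2%:R * (w - z) ^+ n.+1 * 1 * k w + (w - z) ^+ n.+2 * deriv1 k w).
  apply: (cder_ext ltr01 (fun u _ => esym (fk u))).
  exact: cderM (cderX n.+1 (cder_subl z w)) (hol_deriv1 hk hw).
move=> /deriv1E ->; rewrite fk /q !exprS; have k0 := kn0 _ hw.
by field.
Qed.

End EntireFunctions.

(** * The chordal metric *)

Section Chordal.
Context {R : realType}.
Local Open Scope complex_scope.
Local Open Scope ring_scope.
Local Notation C := R[i].
Implicit Types (a b : C) (f : C -> C) (z v l : C) (M r e : R).

(* [(chord1 a, chord3 a)] is the stereographic image of [a] on the sphere of radius 1/2
   centred at (0, 1/2); the point at infinity corresponds to (0, 0). *)
Definition chord3 a : R := (1 + normc a ^+ 2)^-1.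
Definition chord1 a : C := a * (chord3 a)%:C.
(** Equivalent to the chordal distance, and free of square roots of sums. *)
Definition chord_dist a b := normc (chord1 a - chord1 b) + `|chord3 a - chord3 b|.

Lemma chord_den_gt0 a : 0 < 1 + normc a ^+ 2.
Proof. by rewrite ltr_wpDr// sqr_ge0. Qed.

Lemma chord3_gt0 a : 0 < chord3 a.
Proof. by rewrite invr_gt0 chord_den_gt0. Qed.

Lemma chord3_le1 a : chord3 a <= 1.
Proof. by rewrite invf_le1 ?chord_den_gt0// lerDl sqr_ge0. Qed.

Lemma chord_distC a b : chord_dist a b = chord_dist b a.
Proof. by rewrite /chord_dist normcB distrC. Qed.

Lemma chord_dist_trans a b c : chord_dist a c <= chord_dist a b + chord_dist b c.
Proof.
rewrite /chord_dist; have := normc_dist_trans (chord1 b) (chord1 a) (chord1 c).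
by have := ler_distD (chord3 b) (chord3 a) (chord3 c); lra.
Qed.

(** The gain is the factor [chord3 a], that is 1 / (1 + |a|^2): it cancels the growth allowed by
    |f'| <= M (1 + |f|^2). The constant 6 is 4 for [chord1] plus 2 for [chord3]. *)
Lemma chord_dist_local a b : normc (b - a) <= 1 ->
  chord_dist b a <= 6 * normc (b - a) * chord3 a.
Proof.
move=> ba; set D := normc (b - a) in ba *.
have D0 : 0 <= D by exact: normc_ge0.
have A0 := normc_ge0 a; have B0 := normc_ge0 b.
have pa := chord_den_gt0 a; have pb := chord_den_gt0 b.
have ab1 : normc a - normc b <= D by rewrite /D normcB le_normc_sub.
have ab2 : normc b - normc a <= D by rewrite /D le_normc_sub.
pose t := `|normc a ^+ 2 - normc b ^+ 2|.
have ht : t <= D * (2 * normc b + 1).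
  rewrite /t subr_sqr normrM; apply: ler_pM => //; first by rewrite ler_norml; lra.
  by rewrite ger0_norm; lra.
have t0 : 0 <= t by exact: normr_ge0.
have h3 : `|chord3 b - chord3 a| = t / (1 + normc b ^+ 2) * chord3 a.
  have -> : chord3 b - chord3 a = (normc a ^+ 2 - normc b ^+ 2) / (1 + normc b ^+ 2) * chord3 a.
    by rewrite /chord3; field; rewrite !gt_eqF.
  by rewrite 2!normrM normfV [`|1 + _|]gtr0_norm// [`|chord3 a|]gtr0_norm ?chord3_gt0.
have b3 : t / (1 + normc b ^+ 2) <= 2 * D.
  rewrite ler_pdivrMr//; apply: le_trans ht _; rewrite expr2.
  have : 0 <= (normc b - 1 / 2) ^+ 2 by exact: sqr_ge0.
  rewrite expr2; nra.
have h1 : normc (chord1 b - chord1 a) <= (D + normc b * t / (1 + normc b ^+ 2)) * chord3 a.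
  have -> : chord1 b - chord1 a =
     (b - a) * (chord3 a)%:C + b * (chord3 b - chord3 a)%:C.
    by rewrite /chord1 rmorphB; ring.
  apply: le_trans (le_normcD _ _) _; rewrite !normcM !normc_real h3.
  by rewrite [`|chord3 a|]gtr0_norm ?chord3_gt0//; rewrite le_eqVlt; apply/orP; left;
    apply/eqP; rewrite -/D; ring.
have b1 : normc b * t / (1 + normc b ^+ 2) <= 3 * D.
  rewrite ler_pdivrMr//; apply: le_trans (ler_wpM2l B0 ht) _; rewrite expr2.
  have : 0 <= (normc b - 1 / 2) ^+ 2 by exact: sqr_ge0.
  rewrite expr2; nra.
have c0 := chord3_gt0 a.
have u1 : (D + normc b * t / (1 + normc b ^+ 2)) * chord3 a <= 4 * D * chord3 a.
  by rewrite ler_pM2r//; lra.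
have u2 : t / (1 + normc b ^+ 2) * chord3 a <= 2 * D * chord3 a by rewrite ler_pM2r.
by rewrite /chord_dist h3; lra.
Qed.

Lemma chord_dist_mean f z v M :
  (forall t : R, 0 <= t <= 1 -> exists2 l, cder f (z + t%:C * v) l &
     normc l * normc v <= M * (1 + normc (f (z + t%:C * v)) ^+ 2)) ->
  chord_dist (f (z + v)) (f z) <= 6 * M.
Proof.
move=> H.
have := @mean_value_dist R C chord_dist (fun t => f (z + t%:C * v)) 0 1 (6 * M).
rewrite subr0 mulr1 mul1r mul0r addr0 chord_distC; apply => //.
- exact: chord_distC.
- by move=> a b c; exact: chord_dist_trans.
- move=> t /H[l fl lM] e e0; have v0 := normc_ge0 v.
  have e1 : 0 < e / (6 * (normc v + 1)) by rewrite divr_gt0//; lra.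
  have [d d0 hd] := cder_eps fl e1.
  have [c c0 hc] := cder_ccont fl ltr01.
  exists (Num.min d c / (normc v + 1)) => [|s _].
    by rewrite divr_gt0 ?lt_min ?d0//; lra.
  rewrite ltr_pdivlMr; last by lra.
  move=> hs; have s0 : 0 <= `|s - t| by [].
  have : normc ((s - t)%:C * v) < Num.min d c by rewrite normcM normc_real; nra.
  have E : z + t%:C * v + (s - t)%:C * v = z + s%:C * v by rewrite rmorphB; ring.
  rewrite lt_min => /andP[/hd + h2]; rewrite E => h1.
  have /ltW h3 : normc (f (z + s%:C * v) - f (z + t%:C * v)) < 1.
    by apply: hc; rewrite -E addrAC subrr add0r.
  apply: le_trans (chord_dist_local h3) _.
  set A := f (z + t%:C * v) in lM h1 h3 *.
  have pa := chord_den_gt0 A.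
  have h4 : normc (f (z + s%:C * v) - A) <=
      (M * (1 + normc A ^+ 2) + e / 6) * `|s - t|.
    have -> : f (z + s%:C * v) - A = (f (z + s%:C * v) - A - l * ((s - t)%:C * v))
      + l * ((s - t)%:C * v) by ring.
    apply: le_trans (le_normcD _ _) _; rewrite [normc (l * _)]normcM.
    move: h1; rewrite normcM normc_real => h1.
    have u1 : normc l * (`|s - t| * normc v) <= M * (1 + normc A ^+ 2) * `|s - t|.
      by rewrite [`|s - t| * _]mulrC mulrA ler_wpM2r.
    have u2 : e / (6 * (normc v + 1)) * (`|s - t| * normc v) <= e / 6 * `|s - t|.
      rewrite mulrAC ler_pdivrMr; last by lra.
      have : 0 <= e * `|s - t| by rewrite mulr_ge0// ltW.
      by lra.
    lra.
  have c30 := chord3_gt0 A; have c31 := chord3_le1 A.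
  apply: le_trans (_ : 6 * ((M * (1 + normc A ^+ 2) + e / 6) * `|s - t|) * chord3 A <= _).
    by rewrite ler_pM2r// ler_pM2l.
  have -> : 6 * ((M * (1 + normc A ^+ 2) + e / 6) * `|s - t|) * chord3 A =
     6 * M * `|s - t| * ((1 + normc A ^+ 2) * chord3 A) + e * `|s - t| * chord3 A by field.
  have -> : (1 + normc A ^+ 2) * chord3 A = 1 by rewrite /chord3 divff ?gt_eqF.
  have : e * `|s - t| * chord3 A <= e * `|s - t| by rewrite ler_piMr ?mulr_ge0// ltW.
  lra.
Qed.

End Chordal.

(** * The differential equation of a totally ramified entire function *)

Section ThreeRamifiedValues.
Context {R : realType}.
Local Open Scope complex_scope.
Local Open Scope ring_scope.
Local Notation C := R[i].
Implicit Types (f g h k : C -> C) (z w v x y : C) (r s d e M : R).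

Lemma deriv1_sub_cst g x z : entire g -> deriv1 (fun w => g w - x) z = deriv1 g z.
Proof.
move=> eg; apply: deriv1E; apply: cder_eq (cderB (entire_cder z eg) (cder_cst x z)) _.
by rewrite subr0.
Qed.

Lemma entire_not_locally_cst g x z d : entire g -> deriv1 g 0 != 0 -> 0 < d ->
  exists2 w, normc (w - z) < d & g w - x != 0.
Proof.
move=> eg g0 d0; apply: contrapT => H; move: g0; apply/negP; rewrite negbK.
have e1 : entire (fun w => g w - x).
  by move=> w; eexists; apply: cderB; [exact: entire_cder eg|exact: cder_cst].
have gx : forall w, g w - x = 0.
  apply: (@entire_identity _ (fun w => g w - x) z d) => // w hw.
  by apply/eqP; apply: contrapT => /negP gw; apply: H; exists w.
rewrite -(deriv1_sub_cst x 0 eg); apply/eqP/deriv1E.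
by apply: (cder_ext (r := 1)) (cder_cst 0 _) => // w _; rewrite gx.
Qed.

(** Near z the factors g - y and g - y' do not vanish, so only the multiple zero of g - x has to be
    divided out. *)
Lemma totally_ramified_quotient g x y y' z : entire g -> deriv1 g 0 != 0 ->
  g z = x -> deriv1 g z = 0 -> x != y -> x != y' ->
  exists d k, [/\ 0 < d, hol k z d & forall w, normc (w - z) < d ->
    deriv1 g w ^+ 2 = k w * ((g w - x) * (g w - y) * (g w - y'))].
Proof.
move=> eg g0 gz g'z xy xy'.
have e1 : entire (fun w => g w - x).
  by move=> w; eexists; apply: cderB; [exact: entire_cder eg|exact: cder_cst].
have [|||d [k [d0 hk fk]]] := multiple_zero_quotient e1 (z := z).
- by rewrite gz subrr.
- by rewrite deriv1_sub_cst.
- by move=> d d0; exact: entire_not_locally_cst.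
pose p w := (g w - y) * (g w - y').
have cp w : cder p w (deriv1 g w * (g w - y') + (g w - y) * deriv1 g w).
  by apply: cderM; apply: cder_eq (cderB (entire_cder w eg) (cder_cst _ w)) _; rewrite subr0.
have pz : p z != 0 by rewrite /p gz mulf_neq0 ?subr_eq0.
have [c c0 hc] := ccont_neq0 (cder_ccont (cp z)) pz.
have pn w : normc (w - z) < c -> p w != 0.
  by move=> /hc; rewrite -normc_gt0; have := normc_ge0 (p z); lra.
exists (Num.min c d), (fun w => k w / p w); split; first by rewrite lt_min c0.
  move=> w; rewrite lt_min => /andP[h1 h2]; eexists.
  exact: cderM (hol_deriv1 hk h2) (cderV (pn _ h1) (cp w)).
move=> w; rewrite lt_min => /andP[h1 h2]; rewrite -(deriv1_sub_cst x w eg) fk//.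
transitivity (k w / p w * p w * (g w - x)); first by rewrite divfK// pn.
by rewrite /p; ring.
Qed.

Lemma second_derivative_bound f w r M : 0 < r -> hol f w r ->
  (forall z, normc (z - w) < r -> normc (f z) <= M) ->
  normc (deriv1 f w) <= 24 * M / r /\
  normc (deriv1 (deriv1 f) w) <= 24 * (48 * M / r) / (r / 2).
Proof.
move=> r0 hf hM; have w0 : normc (w - w) = 0 by rewrite subrr normc0.
split; first by apply: (le_cder r0 hf hM); apply: (hol_deriv1 hf); rewrite w0.
apply: (@le_cder _ (deriv1 f) w); first by lra.
- by move=> z hz; apply: (hol_deriv1_hol hf); lra.
- move=> z hz; have -> : 48 * M / r = 24 * M / (r / 2) by field; rewrite gt_eqF.
  by apply: (le_deriv1 hf hM); lra.
- by apply: (hol_deriv1 (hol_deriv1_hol hf)); rewrite w0.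
Qed.

(* At a point where |T| or |T'| is not small, the equations y'^2 = h T(y) and
   2 h y'' = h' y' + h^2 T'(y) bound h in terms of the derivatives. *)
Lemma chart_bound (h h' y1 y2 T T' : C) (c B K : R) : 0 < c -> 0 <= B -> 0 <= K ->
  c <= normc T + normc T' -> y1 ^+ 2 = h * T -> 2 * h * y2 = h' * y1 + h ^+ 2 * T' ->
  normc y1 <= B -> normc y2 <= B -> normc h' <= K * normc h ->
  normc h <= 2 / c * (B ^+ 2 + 2 * B + K * B).
Proof.
move=> c0 B0 K0 hc E1 E2 b1 b2 bh; have h0 := normc_ge0 h.
rewrite mulrAC ler_pdivlMr//.
case: (lerP (c / 2) (normc T)) => hT.
  have : normc h * normc T <= B ^+ 2.
    by rewrite -normcM -E1 normcX lerXn2r ?nnegrE ?normc_ge0.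
  have : normc h * (c / 2) <= normc h * normc T by rewrite ler_wpM2l.
  have : 0 <= K * B by rewrite mulr_ge0.
  by lra.
have hT' : c / 2 <= normc T' by lra.
have [->|hn] := eqVneq h 0.
  by rewrite normc0 mul0r mulr_ge0 ?addr_ge0 ?mulr_ge0 ?exprn_ge0.
have hp : 0 < normc h by rewrite normc_gt0.
have : normc h * (normc h * normc T') <= normc h * (2 * B + K * B).
  rewrite mulrA -expr2 -normcX -normcM.
  have -> : h ^+ 2 * T' = 2 * h * y2 - h' * y1 by rewrite E2; ring.
  apply: le_trans (le_normcB _ _) _; rewrite !normcM normc_nat.
  have u1 : normc h * normc y2 <= normc h * B by rewrite ler_wpM2l.
  have u2 : normc h' * normc y1 <= K * normc h * B by rewrite ler_pM ?normc_ge0.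
  lra.
rewrite ler_pM2l// => H.
have : normc h * (c / 2) <= normc h * normc T' by rewrite ler_wpM2l.
have : 0 <= B ^+ 2 by exact: sqr_ge0.
lra.
Qed.

(** Compactness of the disc. It supplies the constant of [chart_bound], for P with P' and for Q with
    Q'. *)
Lemma disc_pos_lower_bound (p q : C -> C) : (forall z, ccont p z) -> (forall z, ccont q z) ->
  (forall z, p z = 0 -> q z != 0) ->
  exists2 c : R, 0 < c & forall z, normc z <= 1 -> c <= normc (p z) + normc (q z).
Proof.
move=> cp cq pq.
have [z _ e e0|z0 _ hm] := @disc_max _ (fun z => - (normc (p z) + normc (q z))) 0 1 ler01.
  have e2 : 0 < e / 2 by lra.
  have [d d0 hd] := cp z _ e2; have [c c0 hc] := cq z _ e2.
  exists (Num.min d c) => [|v]; rewrite lt_min ?d0// => /andP[/hd h1 /hc h2].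
  have := le_normc_sub (p v) (p z); have := le_normc_sub (q v) (q z).
  have := le_normc_sub (p z) (p v); have := le_normc_sub (q z) (q v).
  by rewrite [normc (p z - _)]normcB [normc (q z - _)]normcB ltr_norml; lra.
exists (normc (p z0) + normc (q z0)) => [|z hz]; last first.
  by have := hm z; rewrite subr0 => /(_ hz); lra.
have p0 := normc_ge0 (p z0); have q0 := normc_ge0 (q z0).
have [pz|pz] := eqVneq (p z0) 0; last by rewrite ltr_pwDl// normc_gt0.
by rewrite pz normc0 add0r normc_gt0 pq.
Qed.

Section Ramified.
Variables (a b c : C) (g : C -> C).
Hypotheses (ab : a != b) (ac : a != c) (bc : b != c) (eg : entire g).
Hypothesis gsharp : forall z, normc (deriv1 g z) <= 2 * (1 + normc (g z) ^+ 2).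
Hypothesis ram : forall z, g z = a \/ g z = b \/ g z = c -> deriv1 g z = 0.
Hypothesis g0 : deriv1 g 0 != 0.

Let P w := (w - a) * (w - b) * (w - c).
Let P' w := (w - b) * (w - c) + (w - a) * (w - c) + (w - a) * (w - b).
(* The homogeneous form of the quartic with roots a, b, c and infinity, at infinity. *)
Let Q y := y * ((1 - a * y) * (1 - b * y) * (1 - c * y)).
Let Q' y := (1 - a * y) * (1 - b * y) * (1 - c * y)
  - y * (a * (1 - b * y) * (1 - c * y) + b * (1 - a * y) * (1 - c * y) + c * (1 - a * y) * (1 - b * y)).

Let cderP w : cder P w (P' w).
Proof.
apply: cder_eq (cderM (cderM (cder_subl a w) (cder_subl b w)) (cder_subl c w)) _.
by rewrite /P'; ring.
Qed.

Let cderL x w : cder (fun y => 1 - x * y) w (- x).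
Proof.
by apply: cder_eq (cderB (cder_cst 1 w) (cderZ x (cder_id w))) _; ring.
Qed.

Let cderQ w : cder Q w (Q' w).
Proof.
apply: cder_eq (cderM (cder_id w) (cderM (cderM (cderL a w) (cderL b w)) (cderL c w))) _.
by rewrite /Q'; ring.
Qed.

Let contP' w : ccont P' w.
Proof.
have cs x : ccont (fun w => w - x) w by exact: cder_ccont (cder_subl _ _).
by apply: ccontD; [apply: ccontD|]; apply: ccontM; exact: cs.
Qed.

Let contQ' w : ccont Q' w.
Proof.
have cs x : ccont (fun w => 1 - x * w) w by exact: cder_ccont (cderL _ _).
have cx x : ccont (fun=> x) w by exact: ccont_cst.
apply: ccontB; first by apply: ccontM => //; exact: ccontM.
apply: ccontM; first exact: ccont_id.
by apply: ccontD; [apply: ccontD|]; apply: ccontM => //; apply: ccontM.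
Qed.

Let eg' : entire (deriv1 g) := entire_deriv1 eg.

Let dPg w : cder (fun w => P (g w)) w (P' (g w) * deriv1 g w).
Proof. exact: cder_comp (entire_cder w eg) (cderP _). Qed.

Let local_quotient z : exists dk : R * (C -> C), [/\ 0 < dk.1, hol dk.2 z dk.1 &
  forall w, normc (w - z) < dk.1 -> deriv1 g w ^+ 2 = dk.2 w * P (g w)].
Proof.
have [ga|gna] := eqVneq (g z) a.
  have [d [k [d0 hk fk]]] := totally_ramified_quotient eg g0 ga (ram (or_introl ga)) ab ac.
  by exists (d, k).
have [gb|gnb] := eqVneq (g z) b.
  have ba : b != a by rewrite eq_sym.
  have gz : deriv1 g z = 0 by apply: ram; right; left.
  have [d [k [d0 hk fk]]] := totally_ramified_quotient eg g0 gb gz ba bc.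
  exists (d, k); split => // w hw; rewrite fk// /P /=; ring.
have [gc|gnc] := eqVneq (g z) c.
  have ca : c != a by rewrite eq_sym.
  have cb : c != b by rewrite eq_sym.
  have gz : deriv1 g z = 0 by apply: ram; right; right.
  have [d [k [d0 hk fk]]] := totally_ramified_quotient eg g0 gc gz ca cb.
  exists (d, k); split => // w hw; rewrite fk// /P /=; ring.
have Pz : P (g z) != 0 by rewrite !mulf_neq0 ?subr_eq0.
have [d d0 hd] := ccont_neq0 (cder_ccont (dPg z)) Pz.
have Pn w : normc (w - z) < d -> P (g w) != 0.
  by move=> /hd; rewrite -normc_gt0; have := normc_ge0 (P (g z)); lra.
exists (d, fun w => deriv1 g w ^+ 2 / P (g w)); split => //.
  move=> w hw; eexists.
  exact: (cderM (cderX 1 (entire_cder w eg')) (@cderV _ (fun w => P (g w)) _ _ (Pn _ hw) (dPg w))).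
by move=> w /Pn Pw; rewrite divfK.
Qed.

Let Pg_isolated z : exists2 d : R, 0 < d & forall w, w != z -> normc (w - z) < d -> P (g w) != 0.
Proof.
have ePg : entire (fun w => P (g w)) by move=> w; eexists; exact: dPg.
have [//|[d d0 hd]] := hol_isolated_zero ltr01 (@entire_hol _ _ z 1 ePg).
have Pg0 := entire_identity ePg d0 hd.
have [[e k] /= [e0 _ hk]] := local_quotient 0.
have := hk 0; rewrite subrr normc0 Pg0 mulr0 => /(_ e0)/eqP.
by rewrite expf_eq0/= (negPf g0).
Qed.

(** The value of h at z is that of the local quotient centred at z. Local quotients agree wherever
    P(g) is nonzero, and the zeros of P(g) are isolated, so h coincides near z with the quotient
    centred there. *)
Lemma ramified_quotient : exists2 h, entire h & forall z, deriv1 g z ^+ 2 = h z * P (g z).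
Proof.
have /choice[dk hdk] := local_quotient.
exists (fun z => (dk z).2 z); last first.
  by move=> z; have [d0 _ H] := hdk z; apply: H; rewrite subrr normc0.
move=> z; have [d0 hk fk] := hdk z; have [d d1 hd] := Pg_isolated z.
have z0 : normc (z - z) < (dk z).1 by rewrite subrr normc0.
have [l kl] := hk _ z0; exists l.
apply: (cder_ext (r := Num.min d (dk z).1)) kl; first by rewrite lt_min d1.
move=> w; rewrite lt_min => /andP[h1 h2].
have [->//|wz] := eqVneq w z.
have [e0 _ H] := hdk w; apply: (mulIf (hd _ wz h1)).
by rewrite -fk// H// subrr normc0.
Qed.

Variable h : C -> C.
Hypotheses (eh : entire h) (hE : forall z, deriv1 g z ^+ 2 = h z * P (g z)).

(** Differentiating g'^2 = h P(g), multiplying by h and replacing h P(g) by g'^2 gives the equation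
    multiplied by g'. The factor g' is cancelled off its isolated zeros, and at those by
    continuity. *)
Lemma quotient_equation z :
  2 * h z * deriv1 (deriv1 g) z = deriv1 h z * deriv1 g z + h z ^+ 2 * P' (g z).
Proof.
pose F w := 2 * h w * deriv1 (deriv1 g) w - (deriv1 h w * deriv1 g w + h w ^+ 2 * P' (g w)).
have gF w : deriv1 g w * F w = 0.
  have c1 := cderX 1 (entire_cder w eg').
  have c2 := cderM (entire_cder w eh) (dPg w).
  have := cder_uniq c1 (cder_ext ltr01 (fun v _ => esym (hE v)) c2); rewrite expr1 => E.
  have -> : deriv1 g w * F w = h w * (2 * deriv1 g w * deriv1 (deriv1 g) w)
     - (deriv1 h w * deriv1 g w ^+ 2 + h w ^+ 2 * P' (g w) * deriv1 g w) by rewrite /F; ring.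
  by rewrite E hE; ring.
have cF : ccont F z.
  have ce k : entire k -> ccont k z by move=> ek; exact: entire_ccont.
  have cP : ccont (fun w => P' (g w)) z by apply: ccont_comp (contP' _); exact: entire_ccont.
  have chX : ccont (fun w => h w ^+ 2) z by apply: cder_ccont (cderX 1 (entire_cder z eh)).
  apply: ccontB.
    apply: ccontM; last by apply: ce; exact: entire_deriv1.
    by apply: ccontM; [exact: ccont_cst|exact: ce].
  by apply: ccontD; apply: ccontM => //; apply: ce => //; exact: entire_deriv1.
suff : F z = 0 by move=> /subr0_eq.
have [[d d0 hd]|[d d0 hd]] := hol_isolated_zero ltr01 (@entire_hol _ _ z 1 eg').
  apply: (ccont_punctured_zero cF d0) => w wz /(hd _ wz) gw.
  by have /eqP := gF w; rewrite mulf_eq0 (negPf gw) => /eqP.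
by have := entire_identity eg' d0 hd 0 => H; move: g0; rewrite H eqxx.
Qed.

Let G w := (g w)^-1.

Let dG w : g w != 0 -> cder G w (- deriv1 g w / g w ^+ 2).
Proof. by move=> gw; apply: cderV => //; exact: entire_cder. Qed.

Let ddG w : g w != 0 ->
  cder (deriv1 G) w (- deriv1 (deriv1 g) w / g w ^+ 2 + 2 * deriv1 g w ^+ 2 / g w ^+ 3).
Proof.
move=> gw; have [d d0 hd] := ccont_neq0 (entire_ccont w eg) gw.
have gn v : normc (v - w) < d -> g v != 0.
  by move=> /hd; rewrite -normc_gt0; have := normc_ge0 (g w); lra.
have cg2 : cder (fun v => g v ^+ 2) w (2 * g w ^+ 1 * deriv1 g w).
  exact: cderX (entire_cder w eg).
have g2 : g w ^+ 2 != 0 by rewrite expf_neq0.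
have := cderM (cderN (entire_cder w eg')) (@cderV _ (fun v => g v ^+ 2) _ _ g2 cg2).
move=> H; apply: cder_eq (cder_ext d0 _ H) _ => [v /gn gv|].
  by rewrite (deriv1E (dG gv)).
by field.
Qed.

(** The same h serves at infinity: G' = - g' / g^2 and Q(1/g) = P(g) / g^4. *)
Lemma chart_infinity_equations w : g w != 0 ->
  deriv1 G w ^+ 2 = h w * Q (G w) /\
  2 * h w * deriv1 (deriv1 G) w = deriv1 h w * deriv1 G w + h w ^+ 2 * Q' (G w).
Proof.
move=> gw; rewrite (deriv1E (dG gw)) (deriv1E (ddG gw)); split.
  have -> : (- deriv1 g w / g w ^+ 2) ^+ 2 = deriv1 g w ^+ 2 / g w ^+ 4 by field.
  by rewrite hE /P /Q /G; field.
have -> : 2 * h w * (- deriv1 (deriv1 g) w / g w ^+ 2 + 2 * deriv1 g w ^+ 2 / g w ^+ 3) =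
   - (2 * h w * deriv1 (deriv1 g) w) / g w ^+ 2 + 4 * h w * deriv1 g w ^+ 2 / g w ^+ 3 by field.
by rewrite quotient_equation hE /P /P' /Q' /G; field.
Qed.

(* Points at distance at most 1/40 have images under g at chordal distance at most 3/10. *)
Let r0 : R := 40^-1.

(** On the whole disc of radius [r0] one of the charts g, 1/g is bounded by 2. Between |a| <= 1 and
    |a| > 2 the coordinate [chord3] drops from at least 1/2 to below 1/5, and 3/10 is this gap;
    likewise it is at most 1/2 for |a| >= 1 and above 4/5 for |a| < 1/2. *)
Lemma spherical_disc z w : normc (w - z) < r0 ->
  (normc (g z) <= 1 -> normc (g w) <= 2) /\ (1 <= normc (g z) -> 1 / 2 <= normc (g w)).
Proof.
move=> hw.
have H : chord_dist (g w) (g z) <= 6 * (2 * normc (w - z)).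
  have -> : g w = g (z + (w - z)) by congr g; ring.
  apply: chord_dist_mean => t _; exists (deriv1 g (z + t%:C * (w - z))); first exact: entire_cder.
  by rewrite mulrAC ler_wpM2r ?normc_ge0 ?gsharp.
have h3 : `|chord3 (g w) - chord3 (g z)| <= 3 / 10.
  have : 0 <= normc (chord1 (g w) - chord1 (g z)) by exact: normc_ge0.
  by move: H; rewrite /chord_dist; move: hw; rewrite /r0; lra.
have pz := chord_den_gt0 (g z); have pw := chord_den_gt0 (g w).
have nz := normc_ge0 (g z); have nw := normc_ge0 (g w).
have ez : chord3 (g z) * (1 + normc (g z) ^+ 2) = 1 by rewrite mulVf ?gt_eqF.
have ew : chord3 (g w) * (1 + normc (g w) ^+ 2) = 1 by rewrite mulVf ?gt_eqF.
have cz := chord3_gt0 (g z); have cw := chord3_gt0 (g w).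
move: h3; rewrite ler_norml => /andP[l1 l2]; split => hz.
- rewrite leNgt; apply/negP => hg.
  have z2 : normc (g z) ^+ 2 <= 1 by rewrite exprn_ile1.
  have w2 : 4 < normc (g w) ^+ 2 by rewrite expr2; nra.
  have : 1 / 2 <= chord3 (g z) by nra.
  have : chord3 (g w) < 1 / 5 by nra.
  lra.
- rewrite leNgt; apply/negP => hg.
  have z2 : 1 <= normc (g z) ^+ 2 by rewrite exprn_ege1.
  have w2 : normc (g w) ^+ 2 < 1 / 4 by rewrite expr2; nra.
  have : chord3 (g z) <= 1 / 2 by nra.
  have : 4 / 5 < chord3 (g w) by nra.
  lra.
Qed.


Let r00 : 0 < r0.
Proof. by rewrite invr_gt0. Qed.

Let P_simple w : P w = 0 -> P' w != 0.
Proof.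
move=> /eqP; rewrite /P /P' !mulf_eq0 -orbA !subr_eq0 => /or3P[] /eqP ->.
- by rewrite subrr !mul0r !addr0 mulf_neq0 ?subr_eq0.
- by rewrite subrr !mul0r mulr0 addr0 add0r mulf_neq0 ?subr_eq0// eq_sym.
- by rewrite subrr !mulr0 !add0r mulf_neq0 ?subr_eq0// eq_sym.
Qed.

Let Q_simple y : Q y = 0 -> Q' y != 0.
Proof.
have key (x x1 x2 : C) : 1 - x * y = 0 -> x != x1 -> x != x2 ->
    y * (x * (1 - x1 * y) * (1 - x2 * y)) != 0.
  move=> /subr0_eq xy n1 n2.
  have y0 : y != 0 by apply/eqP => y0; move/eqP: xy; rewrite y0 mulr0 oner_eq0.
  have x0 : x != 0 by apply/eqP => x0; move/eqP: xy; rewrite x0 mul0r oner_eq0.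
  by rewrite xy -!mulrBl !mulf_neq0 ?subr_eq0.
move=> /eqP; rewrite /Q !mulf_eq0 -orbA => /or4P[] /eqP y0.
- by rewrite /Q' y0 !mulr0 !subr0 !mul0r subr0 !mulr1 oner_neq0.
- have := key a b c y0 ab ac; rewrite -oppr_eq0; congr (_ != 0).
  by rewrite /Q' y0; ring.
- have := key b a c y0; rewrite eq_sym => /(_ ab bc); rewrite -oppr_eq0; congr (_ != 0).
  by rewrite /Q' y0; ring.
- have := key c a b y0; rewrite ![c == _]eq_sym => /(_ ac bc); rewrite -oppr_eq0; congr (_ != 0).
  by rewrite /Q' y0; ring.
Qed.

Let G_chart z : 1 <= normc (g z) -> hol G z r0 /\
  forall w, normc (w - z) < r0 -> g w != 0 /\ normc (G w) <= 2.
Proof.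
move=> gz; have H w : normc (w - z) < r0 -> g w != 0 /\ normc (G w) <= 2.
  move=> /spherical_disc[_ /(_ gz) hw]; split; first by rewrite -normc_gt0; lra.
  by rewrite normcV -[2]invrK lef_pV2 ?posrE; lra.
by split=> // w /H[gw _]; eexists; exact: dG.
Qed.

Ltac keep_section_hypotheses :=
  clear -ab ac bc eg gsharp ram g0 cderP cderL cderQ contP' contQ' eg' dPg
  local_quotient Pg_isolated eh hE dG ddG r00 P_simple Q_simple G_chart.

(** [chart_bound] needs |h'| <= K |h|, which holds at a maximum point z1 of |h(z)| (1 - |z - z0|)^2
    on the unit disc around z0, with K = 192 / t and t = 1 - |z1 - z0|. The weight t^2 at z1 absorbs
    the factor 1 / t, and the resulting bound on |h(z0)| does not depend on z0. *)
Lemma quotient_bounded : exists H0 : R, forall z, normc (h z) <= H0.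
Proof.
have contP w : ccont P w := cder_ccont (cderP w).
have contQ w : ccont Q w := cder_ccont (cderQ w).
have [c1 c10 hc1] := disc_pos_lower_bound contP contP' P_simple.
have [c2 c20 hc2] := disc_pos_lower_bound contQ contQ' Q_simple.
pose cc := Num.min c1 c2.
have cc0 : 0 < cc by rewrite lt_min c10.
have cc1 : cc <= c1 by rewrite ge_min lexx.
have cc2 : cc <= c2 by rewrite ge_min lexx orbT.
have r0ge : 0 <= r0 := ltW r00.
have b1 : 0 <= 24 * 2 / r0 by rewrite !(divr_ge0, mulr_ge0).
have b2 : 0 <= 24 * (48 * 2 / r0) / (r0 / 2) by rewrite !(divr_ge0, mulr_ge0).
pose B := 24 * 2 / r0 + 24 * (48 * 2 / r0) / (r0 / 2).
have B0 : 0 <= B by exact: addr_ge0.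
have B1 : 24 * 2 / r0 <= B by rewrite lerDl.
have B2 : 24 * (48 * 2 / r0) / (r0 / 2) <= B by rewrite lerDr.
exists (2 / cc * (B ^+ 2 + 2 * B + 192 * B)) => z0.
pose F z := h z * ((1 - (normc (z - z0))%:C) * (1 - (normc (z - z0))%:C)).
have cF z : ccont F z.
  have cd : ccont (fun z => 1 - (normc (z - z0))%:C) z.
    by apply: ccontB; [exact: ccont_cst|exact: ccont_norm (ccontB (ccont_id _) (ccont_cst _ _))].
  by apply: ccontM; [exact: entire_ccont|exact: ccontM].
have FE z : normc (F z) = normc (h z) * (1 - normc (z - z0)) ^+ 2.
  rewrite /F !normcM -[1 - _](rmorphB (real_complex R) 1) normc_real -expr2.
  by rewrite real_normK// num_real.
have [z1 hz1 hmax] := @disc_max_norm _ F z0 1 ler01 (fun z _ => cF z).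
have h00 : normc (h z0) <= normc (F z1).
  apply: le_trans (hmax z0 _); last by rewrite subrr normc0.
  by rewrite FE subrr normc0 subr0 expr1n mulr1.
apply: le_trans h00 _; rewrite FE; set t := 1 - normc (z1 - z0).
have nz10 := normc_ge0 (z1 - z0).
have t1 : t <= 1 by rewrite /t; lra.
have RHS0 : 0 <= B ^+ 2 + 2 * B + 192 * B.
  have := exprn_ge0 2 B0; lra.
have cc20 : 0 <= 2 / cc by rewrite divr_ge0// ltW.
have : 0 <= t by rewrite subr_ge0.
rewrite le_eqVlt => /predU1P[<-|t0]; first by rewrite expr0n mulr0 mulr_ge0.
have n0 : 0 <= 192 :> R by rewrite ler0n.
have K0 : 0 <= 192 / t by rewrite divr_ge0 ?(ltW t0).
(* On the disc of radius t / 2 around z1 the weight is at least a quarter of its value at z1, so |h|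
   <= 4 |h(z1)| there; Cauchy's estimate gives 24 * 4 / (t / 2). *)
have bh : normc (deriv1 h z1) <= 192 / t * normc (h z1).
  have t20 : 0 < t / 2 by move: t0; keep_section_hypotheses; lra.
  have -> : 192 / t * normc (h z1) = 24 * (4 * normc (h z1)) / (t / 2) by field; rewrite gt_eqF.
  apply: (le_cder t20 (entire_hol eh) _ (entire_cder z1 eh)) => z hz.
  have zz0 := normc_dist_trans z1 z z0.
  have h1 : normc (z - z0) <= 1 by move: zz0 hz hz1; rewrite /t; keep_section_hypotheses; lra.
  have t2 : t / 2 <= 1 - normc (z - z0) by move: zz0 hz hz1; rewrite /t; keep_section_hypotheses; lra.
  have := hmax z h1; rewrite !FE -/t => h2.
  have tt : 0 < (t / 2) ^+ 2 by rewrite exprn_gt0.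
  rewrite -(ler_pM2r tt); have -> : 4 * normc (h z1) * (t / 2) ^+ 2 = normc (h z1) * t ^+ 2 by field.
  apply: le_trans h2; rewrite ler_wpM2l ?normc_ge0//.
  by rewrite lerXn2r ?nnegrE ?(ltW t20)//; move: t2 t20; keep_section_hypotheses; lra.
have main : normc (h z1) <= 2 / cc * (B ^+ 2 + 2 * B + 192 / t * B).
  case: (lerP (normc (g z1)) 1) => gz1.
    have [d1 d2] := second_derivative_bound r00 (entire_hol eg)
      (fun w hw => (spherical_disc hw).1 gz1).
    apply: (chart_bound cc0 B0 K0 _ (hE z1) (quotient_equation z1)) => //.
    - exact: le_trans cc1 (hc1 _ gz1).
    - exact: le_trans d1 B1.
    - exact: le_trans d2 B2.
  have [hG HG] := G_chart (ltW gz1).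
  have [d1 d2] := second_derivative_bound r00 hG (fun w hw => (HG w hw).2).
  have z11 : normc (z1 - z1) < r0 by rewrite subrr normc0.
  have [E1 E2] := chart_infinity_equations (HG _ z11).1.
  apply: (chart_bound cc0 B0 K0 _ E1 E2) => //.
  - apply: le_trans cc2 (hc2 _ _).
    by rewrite normcV invf_le1; move: gz1; keep_section_hypotheses; lra.
  - exact: le_trans d1 B1.
  - exact: le_trans d2 B2.
apply: le_trans (ler_wpM2r (sqr_ge0 t) main) _.
rewrite -[_ * t ^+ 2]mulrA; apply: ler_wpM2l => //.
have -> : (B ^+ 2 + 2 * B + 192 / t * B) * t ^+ 2 =
   (B ^+ 2 + 2 * B) * t ^+ 2 + 192 * B * t by field; rewrite gt_eqF.
have t2 : t ^+ 2 <= 1 by rewrite exprn_ile1// ltW.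
have u1 : (B ^+ 2 + 2 * B) * t ^+ 2 <= B ^+ 2 + 2 * B.
  by rewrite ler_piMr// addr_ge0 ?mulr_ge0 ?exprn_ge0.
have u2 : 192 * B * t <= 192 * B by rewrite (ler_piMr (mulr_ge0 n0 B0) t1).
move: u1 u2; keep_section_hypotheses; lra.
Qed.

(** Where G = 1/g is nearly 0, G' is nearly 0 because G'^2 = h Q(G), and G'' is nearly h / 2 because
    2 h G'' = h^2 Q'(G) with Q'(0) = 1. The quadratic term then keeps |G| >= 2 m on the annulus s <=
    |t| <= 2 s, and [le_center] bounds g at the centre by 2 / m, however large g was taken there. *)
Lemma ramified_contradiction : False.
Proof.
have [H0 hH] := quotient_bounded.
have h'0 := entire_bounded_deriv1 eh hH.
have hcst := entire_deriv1_cst eh h'0.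
have c00 : h 0 != 0.
  by apply: contra g0 => /eqP h0; have /eqP := hE 0; rewrite h0 mul0r expf_eq0.
have c0p : 0 < normc (h 0) by rewrite normc_gt0.
have unb (A : R) : exists z, A < normc (g z).
  apply: contrapT => H; move: g0; rewrite (entire_bounded_deriv1 (M := A) eg) ?eqxx// => z.
  by rewrite leNgt; apply/negP => Az; apply: H; exists z.
pose M' := 24 * 2 / (r0 / 2).
have r20 : 0 < r0 / 2 by rewrite divr_gt0.
have r0ge : 0 <= r0 := ltW r00.
have M'0 : 0 <= M' by rewrite !(divr_ge0, mulr_ge0).
pose K := second_order_bound M' (r0 / 2).
have K0 : 0 <= K by exact: second_order_bound_ge0.
have K10 : 0 < 256 * (K + 1) by rewrite mulr_gt0 ?ltr0n//; lra.
(* Small enough for the cubic remainder K (2 s)^3 to be at most m. *)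
pose s := Num.min (r0 / 20) (normc (h 0) / (256 * (K + 1))).
have s0 : 0 < s by rewrite lt_min !divr_gt0.
have sr : s <= r0 / 20 by rewrite ge_min lexx.
have sK : s * (256 * (K + 1)) <= normc (h 0).
  by rewrite -ler_pdivlMr// ge_min lexx orbT.
(* The quadratic term is at least 4 m on the annulus; the remainder takes away m, and the terms G(z)
   and G'(z) t at most m / 2 each. *)
pose m := normc (h 0) * s ^+ 2 / 32.
have m0 : 0 < m by rewrite divr_gt0// mulr_gt0// exprn_gt0.
have e10 : 0 < (m / (4 * s)) ^+ 2 / normc (h 0).
  by rewrite divr_gt0// exprn_gt0// divr_gt0// mulr_gt0.
have Q0 : Q 0 = 0 by rewrite /Q mul0r.
have Q'0 : Q' 0 = 1 by rewrite /Q' !mulr0 !subr0 !mul0r subr0 !mulr1.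
have [d1 d10 hd1] := cder_ccont (cderQ 0) e10.
have [d2 d20 hd2] := contQ' 0 (divr_gt0 ltr01 (ltr0Sn R 1)).
(* If |g(z)| > A, then |G(z)| is below [d1], [d2] and m / 2, and |g(z)| > 2 / m contradicts the
   final bound. *)
pose A := 1 + d1^-1 + d2^-1 + 2 / m.
have i1 : 0 < d1^-1 by rewrite invr_gt0.
have i2 : 0 < d2^-1 by rewrite invr_gt0.
have i3 : 0 < 2 / m by rewrite divr_gt0.
have [z hz] := unb A.
have gz1 : 1 <= normc (g z) by move: hz i1 i2 i3; rewrite /A; keep_section_hypotheses; lra.
have [hG HG] := G_chart gz1.
have Gsmall (d : R) : 0 < d -> d^-1 < normc (g z) -> normc (G z) < d.
  move=> d0 hd; rewrite normcV -[d]invrK ltf_pV2 ?posrE ?invr_gt0//.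
  by move: hd gz1; keep_section_hypotheses; lra.
have G1 : normc (G z) < d1 by apply: Gsmall => //; move: hz i1 i2 i3; rewrite /A; keep_section_hypotheses; lra.
have G2 : normc (G z) < d2 by apply: Gsmall => //; move: hz i1 i2 i3; rewrite /A; keep_section_hypotheses; lra.
have G3 : normc (G z) < m / 2.
  by apply: Gsmall; [rewrite divr_gt0|rewrite invf_div; move: hz i1 i2; rewrite /A; keep_section_hypotheses; lra].
have zz : normc (z - z) = 0 by rewrite subrr normc0.
have zr0 : normc (z - z) < r0 by rewrite zz.
have [E1 E2] := chart_infinity_equations (HG z zr0).1.
have hQ : normc (Q (G z)) < (m / (4 * s)) ^+ 2 / normc (h 0).
  by have := hd1 (G z); rewrite subr0 Q0 subr0 => /(_ G1).
have hQ' : 1 / 2 < normc (Q' (G z)).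
  have := hd2 (G z); rewrite subr0 Q'0 => /(_ G2).
  by have := le_normc_sub 1 (Q' (G z)); rewrite normc1 normcB; keep_section_hypotheses; lra.
have G'small : normc (deriv1 G z) < m / (4 * s).
  have q0 : 0 < m / (4 * s) by rewrite divr_gt0// mulr_gt0.
  rewrite -(@ltr_pXn2r _ 2) ?nnegrE ?normc_ge0 ?(ltW q0)//.
  by rewrite -normcX E1 hcst normcM mulrC -ltr_pdivlMr.
have G''E : deriv1 (deriv1 G) z = h 0 * Q' (G z) / 2.
  move: E2; rewrite h'0 mul0r add0r hcst => E2.
  apply: (mulfI (_ : 2 * h 0 != 0)); first by rewrite mulf_neq0// pnatr_eq0.
  by rewrite E2; field.
have hG' : hol (deriv1 G) z (r0 / 2).
  by move=> w hw; apply: (hol_deriv1_hol hG); apply: lt_le_trans hw _; rewrite ler_piMr// invf_le1// ler1n.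
have bG' w : normc (w - z) < r0 / 2 -> normc (deriv1 G w) <= M'.
  by move=> hw; apply: (le_deriv1 hG (fun w hw => (HG w hw).2) r20); move: hw; keep_section_hypotheses; lra.
have rem (t : C) : normc t <= 2 * s ->
    normc (G (z + t) - G z - deriv1 G z * t - deriv1 (deriv1 G) z / 2 * t ^+ 2)
    <= K * normc t ^+ 2 * normc t.
  move=> ht; have t0 := normc_ge0 t.
  apply: (quadratic_remainder (r := r0)) => //; first by rewrite mulr_ge0 ?exprn_ge0.
    by move: ht sr s0; keep_section_hypotheses; lra.
  move=> x /andP[x0 x1].
  have xt : normc (x%:C * t) <= normc t.
    by rewrite normcM normc_real ger0_norm// ler_piMl.
  apply: le_trans (taylor1 r20 hG' bG' _ _) _.
  - by rewrite zz; move: r20; keep_section_hypotheses; lra.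
  - by move: ht sr xt s0; keep_section_hypotheses; lra.
  - by rewrite ler_wpM2l// lerXn2r ?nnegrE ?normc_ge0.
have : normc (g z) <= 4 * (2 * m)^-1.
  apply: (@le_center _ g z s) => // w /andP[w1 w2].
  pose t := w - z; have wE : w = z + t by rewrite /t addrC subrK.
  have wr : normc (w - z) < r0 by move: w2 sr s0; keep_section_hypotheses; lra.
  have [gw _] := HG _ wr.
  rewrite -[g w]invrK normcV lef_pV2 ?posrE ?normc_gt0 ?invr_eq0//; last by rewrite mulr_gt0.
  rewrite -/(G w) wE; rewrite -/t in w1 w2.
  have t0 : 0 <= normc t by exact: normc_ge0.
  have a1 : K * normc t ^+ 2 * normc t <= m.
    apply: le_trans (_ : K * (2 * s) ^+ 2 * (2 * s) <= m).
      apply: ler_pM => //; first by apply: mulr_ge0 => //; exact: exprn_ge0.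
      apply: ler_wpM2l => //; have s20 : 0 <= 2 * s by rewrite mulr_ge0// ltW.
      by rewrite lerXn2r ?nnegrE.
    rewrite /m ler_pdivlMr//.
    have -> : K * (2 * s) ^+ 2 * (2 * s) * 32 = s * (256 * K) * s ^+ 2 by ring.
    by rewrite ler_wpM2r ?exprn_ge0 ?(ltW s0)//; move: sK s0; keep_section_hypotheses; lra.
  have a2 : normc (deriv1 G z * t) <= m / 2.
    rewrite normcM; apply: le_trans (_ : m / (4 * s) * (2 * s) <= m / 2).
      by rewrite ler_pM ?normc_ge0// ltW.
    by rewrite le_eqVlt; apply/orP; left; apply/eqP; field; rewrite gt_eqF.
  have a3 : 4 * m <= normc (deriv1 (deriv1 G) z / 2 * t ^+ 2).
    rewrite G''E normcM normcX !normcM !normcV !normc_nat.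
    have ss : s ^+ 2 <= normc t ^+ 2 by rewrite lerXn2r ?nnegrE ?(ltW s0).
    have s2 : 0 < s ^+ 2 by rewrite exprn_gt0.
    have v1 : normc (h 0) * (1 / 2) <= normc (h 0) * normc (Q' (G z)).
      by rewrite ler_wpM2l ?(ltW c0p)// ltW.
    have -> : 4 * m = normc (h 0) * (1 / 2) / 2 / 2 * s ^+ 2 by rewrite /m; field.
    by apply: ler_pM; rewrite ?(ltW s2)//; [rewrite !(divr_ge0, mulr_ge0)// ltW|move: v1; keep_section_hypotheses; lra].
  have := rem t w2; set X := deriv1 (deriv1 G) z / 2 * t ^+ 2 in a3 *.
  move=> a4.
  have : normc X <= normc (G (z + t)) + normc (G z) + normc (deriv1 G z * t)
     + normc (G (z + t) - G z - deriv1 G z * t - X).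
    have {1}-> : X = G (z + t) - G z - deriv1 G z * t - (G (z + t) - G z - deriv1 G z * t - X) by ring.
    apply: le_trans (le_normcB _ _) _; rewrite lerD2r.
    apply: le_trans (le_normcB _ _) _; rewrite lerD2r.
    exact: le_normcB.
  move: a1 a2 a3 a4 G3; keep_section_hypotheses; lra.
have -> : 4 * (2 * m)^-1 = 2 / m by field; rewrite gt_eqF.
by move: hz i1 i2; rewrite /A; keep_section_hypotheses; lra.
Qed.

End Ramified.

(** The conclusion concerns only the point 0, since that is where the limit of the rescaled
    functions has a nonzero derivative. *)
Theorem no_three_totally_ramified_values (a b c : C) g :
  a != b -> a != c -> b != c -> entire g ->
  (forall z, normc (deriv1 g z) <= 2 * (1 + normc (g z) ^+ 2)) ->
  (forall z, g z = a \/ g z = b \/ g z = c -> deriv1 g z = 0) -> deriv1 g 0 = 0.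
Proof.
move=> ab ac bc eg gs ram; apply/eqP; apply: contraT => g0.
have [h eh hE] := ramified_quotient ab ac bc eg ram g0.
by have := ramified_contradiction ab ac bc eg gs g0 eh hE.
Qed.

End ThreeRamifiedValues.

(** * Marty's theorem *)

Section DiagonalSubsequence.
Context {R : realType}.
Implicit Types (x : nat -> R) (e : R) (U : set_system nat).

(** The limit is the supremum of the levels a for which a <= x_k holds on a set of the
    ultrafilter. *)
Lemma ultrafilter_limit U x : UltraFilter U -> (forall k, `|x k| <= 1) ->
  exists l, forall e, 0 < e -> U [set k | `|x k - l| < e].
Proof.
move=> UU hx; have UF := @ultra_proper _ U UU.
pose A := [set a | U [set k | a <= x k]].
have A1 : A (-1).
  by apply: (filterS _ (@filterT _ U UF)) => k _ /=; have := hx k; rewrite ler_norml => /andP[].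
have ubA : ubound A 1.
  move=> a aU; have [k /= hk] := filter_ex aU.
  by apply: le_trans hk _; have := hx k; rewrite ler_norml => /andP[].
have sA : has_sup A by split; [exists (-1)|exists 1].
exists (sup A) => e e0.
have [a aA ha] := sup_adherent e0 sA.
have [h|h] := in_ultra_setVsetC [set k | sup A + e <= x k] UU.
  have : sup A + e <= sup A by apply: (ub_le_sup sA.2).
  by lra.
apply: (filterS _ (filterI aA h)) => k [/= h1 /negP]; rewrite -ltNge => h2.
by rewrite ltr_norml; lra.
Qed.

(** A single ultrafilter finer than the cofinite filter fixes the limits of all coordinates at once.
    The n-th index is then chosen beyond the previous one with the first n + 1 coordinates near
    their limits; no nested subsequences are needed. *)
Lemma diagonal_subsequence (x : nat -> nat -> R) : (forall j k, `|x j k| <= 1) ->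
  exists2 phi : nat -> nat, {homo phi : i j / (i < j)%N} &
    forall j e, 0 < e -> exists N, forall m n, (N <= m)%N -> (N <= n)%N ->
      `|x j (phi m) - x j (phi n)| <= e.
Proof.
move=> hx; have [U [UU FU]] := ultraFilterLemma (@eventually_filter).
have UF := @ultra_proper _ U UU.
have /choice[l hl] := fun j => ultrafilter_limit UU (hx j).
have good n : U [set k | forall j, (j <= n)%N -> `|x j k - l j| < n.+1%:R^-1].
  suff H m : U [set k | forall j, (j < m)%N -> `|x j k - l j| < n.+1%:R^-1] by exact: H n.+1.
  elim: m => [|m IH]; first by apply: (filterS _ (@filterT _ U UF)) => k _ j.
  have n0 : 0 < n.+1%:R^-1 :> R by rewrite invr_gt0 ltr0n.
  apply: (filterS _ (filterI IH (hl m _ n0))) => k [/= h1 h2] j; rewrite ltnS leq_eqVlt => /predU1P[->//|]; exact: h1.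
have big n m : exists k, (m < k)%N /\ forall j, (j <= n)%N -> `|x j k - l j| < n.+1%:R^-1.
  have mU : U [set k | (m < k)%N] by apply: FU; exists m.+1.
  by have [k [/= h1 h2]] := filter_ex (filterI mU (good n)); exists k.
have /choice[nx hnx] : forall p : nat * nat, exists k,
    (p.2 < k)%N /\ forall j, (j <= p.1)%N -> `|x j k - l j| < p.1.+1%:R^-1.
  by move=> [n m]; exact: big.
pose fix phi n := if n is m.+1 then nx (m.+1, phi m) else nx (0%N, 0%N).
exists phi.
  by apply: homo_ltn => [? ? ?|n]; [exact: ltn_trans|have [] := hnx (n.+1, phi n)].
have phil n j : (j <= n)%N -> `|x j (phi n) - l j| < n.+1%:R^-1.
  by case: n => [|n] jn; [have [_ /(_ j jn)] := hnx (0%N, 0%N)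
    |have [_ /(_ j jn)] := hnx (n.+1, phi n)].
move=> j e e0; have e2 : 0 < e / 2 by lra.
pose N0 := Num.bound (e / 2)^-1.
have small n : (N0 <= n)%N -> n.+1%:R^-1 < e / 2.
  move=> nN; rewrite -[e / 2]invrK ltf_pV2 ?posrE ?invr_gt0 ?ltr0n//.
  apply: lt_le_trans (archi_boundP _) _; first by rewrite invr_ge0 ltW.
  by rewrite ler_nat; apply: leqW.
exists (maxn j N0) => m n; rewrite !geq_max => /andP[jm Nm] /andP[jn Nn].
have h1 := lt_trans (phil _ _ jm) (small _ Nm); have h2 := lt_trans (phil _ _ jn) (small _ Nn).
have := ler_distD (l j) (x j (phi m)) (x j (phi n)); rewrite [`|l j - _|]distrC; lra.
Qed.

End DiagonalSubsequence.

(** * Recovering values and inverses from spherical coordinates *)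

Section SphericalLimits.
Context {R : realType}.
Local Open Scope complex_scope.
Local Open Scope ring_scope.
Local Notation C := R[i].
Local Notation Re := (@complex.Re R).
Local Notation Im := (@complex.Im R).
Implicit Types (a b z w : C) (e d : R).

Lemma normc_conj z : normc z^*%C = normc z.
Proof. by case: z => x y /=; rewrite sqrrN. Qed.

(** The equation of the sphere; being closed, it passes to the limit coordinates, in particular at
    infinity. *)
Lemma chord1_sqr a : normc (chord1 a) ^+ 2 = chord3 a * (1 - chord3 a).
Proof.
rewrite /chord1 normcM normc_real gtr0_norm ?chord3_gt0// exprMn.
have ac : chord3 a * (1 + normc a ^+ 2) = 1 by rewrite mulVf ?gt_eqF ?chord_den_gt0.
have -> : normc a ^+ 2 * chord3 a ^+ 2 = (chord3 a * (1 + normc a ^+ 2)) * chord3 a - chord3 a ^+ 2.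
  by ring.
by rewrite ac; ring.
Qed.

Lemma chord1_le1 a : normc (chord1 a) <= 1.
Proof.
rewrite -(@ler_pXn2r _ 2) ?nnegrE ?normc_ge0// expr1n chord1_sqr.
by have := chord3_gt0 a; have := chord3_le1 a; nra.
Qed.

Lemma chordE a : a = chord1 a / (chord3 a)%:C.
Proof. by rewrite /chord1 mulfK// fmorph_eq0 gt_eqF ?chord3_gt0. Qed.

(** The right side stays regular at the point at infinity, where [chord3] is 0, so 1/f can be
    followed to limits with infinite values. *)
Lemma chord_inverse a : a != 0 -> a^-1 = (chord1 a)^*%C / (1 - chord3 a)%:C.
Proof.
move=> a0; have na : 0 < normc a by rewrite normc_gt0.
have pa := chord_den_gt0 a.
have e3 : 1 - chord3 a = normc a ^+ 2 * chord3 a by rewrite /chord3; field; rewrite gt_eqF.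
have aa : a * a^*%C = (normc a ^+ 2)%:C by rewrite -sqr_normc rmorphXn.
have c0 : (chord3 a)%:C != 0 :> C by rewrite fmorph_eq0 gt_eqF ?chord3_gt0.
have n0 : (normc a ^+ 2)%:C != 0 :> C by rewrite fmorph_eq0 gt_eqF// exprn_gt0.
have cj (u : C) (s : R) : (u * s%:C)^*%C = u^*%C * s%:C.
  by case: u => x y; apply/eqP; rewrite eq_complex /=; apply/andP; split; apply/eqP; ring.
have -> : (1 - chord3 a)%:C = a * a^*%C * (chord3 a)%:C by rewrite e3 aa rmorphM.
rewrite /chord1 cj.
have ac0 : a^*%C != 0 by move: n0; rewrite -aa mulf_eq0 negb_or => /andP[].
by field; rewrite a0 ac0 c0.
Qed.

Lemma quotient_dist z w (s t d : R) : 0 < d -> d <= s -> d <= t -> normc w <= 1 ->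
  normc (z / s%:C - w / t%:C) <= normc (z - w) / d + `|s - t| / d ^+ 2.
Proof.
move=> d0 ds dt w1; have s0 : 0 < s by lra. have t0 : 0 < t by lra.
have sn : s%:C != 0 :> C by rewrite fmorph_eq0 gt_eqF.
have tn : t%:C != 0 :> C by rewrite fmorph_eq0 gt_eqF.
have -> : z / s%:C - w / t%:C = (z - w) / s%:C + w * ((t - s)%:C / (s%:C * t%:C)).
  by rewrite rmorphB; field; rewrite sn tn.
apply: le_trans (le_normcD _ _) _; rewrite !normcM !normcV !normcM !normc_real.
rewrite [`|s|]gtr0_norm// [`|t|]gtr0_norm//; apply: lerD.
  by rewrite ler_wpM2l ?normc_ge0// lef_pV2 ?posrE.
have st : 0 < s * t by rewrite mulr_gt0.
apply: le_trans (ler_wpM2r (divr_ge0 (normr_ge0 _) (ltW st)) w1) _.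
rewrite mul1r distrC; apply: ler_wpM2l => //.
by rewrite lef_pV2 ?posrE ?exprn_gt0// expr2 ler_pM// ltW.
Qed.

End SphericalLimits.

Section MartyNormality.
Context {R : realType}.
Local Open Scope complex_scope.
Local Open Scope ring_scope.
Local Notation C := R[i].
Variable V : normedModType C.
Implicit Types (u : V -> C) (x y z w v : V) (r e d M : R) (t l : C) (D : set V).

Definition totally_bounded_balls := forall r e, 0 < e ->
  exists s : seq V, forall w, nv w < r -> exists2 x, x \in s & nv (w - x) < e.

(** The sequence enumerates finite nets of mesh 1 / (m + 1) in the balls of radius m, for all m. The
    index bound [J] does not depend on the point of the ball, as the uniform Cauchy property
    requires. *)
Lemma dense_sequence : totally_bounded_balls -> exists q : nat -> V,
  forall z r e, 0 < e -> exists J, forall w, nv (w - z) < r ->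
    exists2 j, (j < J)%N & nv (w - q j) < e.
Proof.
move=> tb; have n0 m : 0 < m.+1%:R^-1 :> R by rewrite invr_gt0 ltr0n.
have /choice[s hs] := fun m : nat => tb m%:R _ (n0 m).
pose q j := if @unpickle (nat * nat)%type j is Some p then nth 0 (s p.1) p.2 else 0.
exists q => z r e e0.
pose m := maxn (Num.bound (nv z + `|r|)) (Num.bound e^-1).
have m1 : nv z + r <= m%:R.
  apply: le_trans (_ : nv z + `|r| <= _); first by rewrite lerD2l ler_norm.
  apply: ltW; apply: lt_le_trans (archi_boundP _) _; first by rewrite addr_ge0 ?nv_ge0.
  by rewrite ler_nat leq_maxl.
have m2 : m.+1%:R^-1 < e.
  rewrite -[e]invrK ltf_pV2 ?posrE ?invr_gt0 ?ltr0n//.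
  apply: lt_le_trans (archi_boundP _) _; first by rewrite invr_ge0 ltW.
  by rewrite ler_nat; apply: leqW; rewrite leq_maxr.
exists (\max_(i < size (s m)) (pickle (m, i : nat)).+1) => w hw.
have [|x xs wx] := hs m w.
  by apply: lt_le_trans m1; have := nvD (w - z) z; rewrite subrK; lra.
have im : (index x (s m) < size (s m))%N by rewrite index_mem.
exists (pickle (m, index x (s m))).
  exact: (@leq_bigmax _ (fun i : 'I_(size (s m)) => (pickle (m, i : nat)).+1) (Ordinal im)).
by rewrite /q pickleK /= nth_index//; apply: lt_trans m2.
Qed.

(** The inequality |Du(w) v| <= M |v| (1 + |u(w)|^2), expressed through complex lines, so that it
    applies alike to C and to C^n. *)
Definition spherical_bound u z r M := forall w, nv (w - z) < r -> forall v,
  exists2 l, cder (fun t => u (w + t *: v)) 0 l & normc l <= M * nv v * (1 + normc (u w) ^+ 2).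

Lemma slice_cder u w v t l : cder (fun s => u (w + t *: v + s *: v)) 0 l ->
  cder (fun s => u (w + s *: v)) t l.
Proof.
move=> h; have := @cder_shift _ (fun s => u (w + t *: v + s *: v)) (- t) 1 t l.
rewrite mul1r addNr mulr1 => /(_ h); apply: cder_ext ltr01 _ => s _.
by rewrite mul1r -addrA -scalerDl addrA subrr add0r.
Qed.

Lemma nv_segment z w v (t : R) : 0 <= t <= 1 ->
  nv (z + t%:C *: v - w) <= Num.max (nv (z - w)) (nv (z + v - w)).
Proof.
move=> /andP[t0 t1].
have -> : z + t%:C *: v - w = (1 - t)%:C *: (z - w) + t%:C *: (z + v - w).
  rewrite rmorphB rmorph1 scalerBl scale1r [z + v - w]addrAC [t%:C *: (_ + v)]scalerDr.
  by rewrite addrA subrK addrAC.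
apply: le_trans (nvD _ _) _; rewrite !nvZ !normc_real !ger0_norm ?subr_ge0//.
set m := Num.max _ _.
have m1 : nv (z - w) <= m by rewrite le_max lexx.
have m2 : nv (z + v - w) <= m by rewrite le_max lexx orbT.
have := ler_wpM2l t0 m2; have t10 : 0 <= 1 - t by lra.
have := ler_wpM2l t10 m1; lra.
Qed.

Lemma spherical_bound_chord u z r M x y : spherical_bound u z r M ->
  nv (x - z) < r -> nv (y - z) < r -> chord_dist (u y) (u x) <= 6 * (M * nv (y - x)).
Proof.
move=> hu hx hy.
have := @chord_dist_mean _ (fun t => u (x + t *: (y - x))) 0 1 (M * nv (y - x)).
rewrite add0r scale0r addr0 scale1r [x + (y - x)]addrC subrK; apply => t ht.
rewrite add0r mulr1.
have [l h1 h2] : exists2 l, cder (fun s => u (x + t%:C *: (y - x) + s *: (y - x))) 0 l &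
    normc l <= M * nv (y - x) * (1 + normc (u (x + t%:C *: (y - x))) ^+ 2).
  apply: hu; apply: le_lt_trans (nv_segment _ _ _ ht) _.
  by rewrite gt_max hx [x + (y - x)]addrC subrK.
by exists l; [exact: slice_cder|rewrite normc1 mulr1].
Qed.

Definition converges_near (u : nat -> V -> C) (g : V -> C) z := exists2 r, 0 < r &
  forall e, 0 < e -> exists N, forall k, (N <= k)%N -> forall w, nv (w - z) < r ->
    normc (u k w - g w) <= e.

Definition diverges_near (u : nat -> V -> C) z := exists2 r, 0 < r &
  forall A : R, exists N, forall k, (N <= k)%N -> forall w, nv (w - z) < r -> A < normc (u k w).

Section ChordalConvergence.
Variables (u : nat -> V -> C) (D : set V).
Hypothesis Dopen : forall z, D z -> exists2 r, 0 < r & forall w, nv (w - z) < r -> D w.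
Hypothesis hu : forall z, D z -> exists r M N, [/\ 0 < r, 0 <= M &
  forall k, (N <= k)%N -> spherical_bound (u k) z r M].

(** The Arzela-Ascoli step: a common Lipschitz constant 6 M for the chordal distance, with
    convergence at finitely many points of a net. The total error [e] is split into thirds, whence
    18 = 3 * 6. *)
Lemma chordal_cauchy (q : nat -> V) : (forall z r e, 0 < e -> exists J, forall w, nv (w - z) < r ->
    exists2 j, (j < J)%N & nv (w - q j) < e) ->
  (forall j e, 0 < e -> exists N, forall m n, (N <= m)%N -> (N <= n)%N ->
     chord_dist (u m (q j)) (u n (q j)) <= e) ->
  forall z, D z -> exists2 r, 0 < r & forall e, 0 < e -> exists N, forall m n,
    (N <= m)%N -> (N <= n)%N -> forall w, nv (w - z) < r -> chord_dist (u m w) (u n w) <= e.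
Proof.
move=> hq cq z /hu[r [M [N [r0 M0 hN]]]]; exists (r / 2); first by lra.
move=> e e0; pose d := Num.min (r / 2) (e / (18 * (M + 1))).
have M1 : 0 < 18 * (M + 1) by lra.
have d0 : 0 < d by rewrite lt_min !divr_gt0.
have dr : d <= r / 2 by rewrite ge_min lexx.
have de : d * (18 * (M + 1)) <= e by rewrite -ler_pdivlMr// ge_min lexx orbT.
have [J hJ] := hq z (r / 2) d d0.
have e3 : 0 < e / 3 by lra.
have /choice[K hK] := fun j => cq j _ e3.
exists (maxn N (\max_(j < J) K j)) => m n; rewrite !geq_max => /andP[m1 m2] /andP[n1 n2] w hw.
have [j jJ hj] := hJ w hw.
have Kj : (K j <= \max_(j < J) K j)%N := @leq_bigmax _ (fun j : 'I_J => K j) (Ordinal jJ).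
have hwr : nv (w - z) < r by lra.
have hqr : nv (q j - z) < r.
  by have := nv_trans w (q j) z; rewrite [nv (q j - w)]nvB; lra.
have := spherical_bound_chord (hN _ m1) hqr hwr; have := spherical_bound_chord (hN _ n1) hwr hqr.
rewrite [nv (q j - w)]nvB => h1 h2; have := hK j m n (leq_trans Kj m2) (leq_trans Kj n2).
have := chord_dist_trans (u m w) (u m (q j)) (u n w).
have := chord_dist_trans (u m (q j)) (u n (q j)) (u n w).
have : M * nv (w - q j) <= M * d by rewrite ler_wpM2l// ltW.
lra.
Qed.

(* [S1, S3] are the coordinates of the limit in the sphere; the limit is infinite where [S3] is 0. *)
Lemma chordal_limit : (forall z, D z -> exists2 r, 0 < r & forall e, 0 < e -> exists N, forall m n,
    (N <= m)%N -> (N <= n)%N -> forall w, nv (w - z) < r -> chord_dist (u m w) (u n w) <= e) ->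
  exists (S1 : V -> C) (S3 : V -> R), forall z, D z -> exists2 r, 0 < r & forall e, 0 < e ->
    exists N, forall k, (N <= k)%N -> forall w, nv (w - z) < r ->
      normc (chord1 (u k w) - S1 w) <= e /\ `|chord3 (u k w) - S3 w| <= e.
Proof.
move=> hc.
have zz z : nv (z - z) = 0 by rewrite subrr nv0.
have /choice[S hS] : forall z, exists p : C * R, D z -> forall e, 0 < e -> exists N, forall k,
    (N <= k)%N -> normc (chord1 (u k z) - p.1) <= e /\ `|chord3 (u k z) - p.2| <= e.
  move=> z; have [Dz|nDz] := pselect (D z); last by exists (0, 0).
  have [r r0 hr] := hc z Dz.
  have [|a ha] := @ccauchy_limit _ (fun k => chord1 (u k z)).
    move=> e /hr[N hN]; exists N => m n m1 n1; have := hN m n m1 n1 z; rewrite zz => /(_ r0).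
    by rewrite /chord_dist; have := normr_ge0 (chord3 (u m z) - chord3 (u n z)); lra.
  have [|b hb] := @cauchy_limit _ (fun k => chord3 (u k z)).
    move=> e /hr[N hN]; exists N => m n m1 n1; have := hN m n m1 n1 z; rewrite zz => /(_ r0).
    by rewrite /chord_dist; have := normc_ge0 (chord1 (u m z) - chord1 (u n z)); lra.
  exists (a, b) => _ e e0; have [N1 h1] := ha _ e0; have [N2 h2] := hb _ e0.
  by exists (maxn N1 N2) => k; rewrite geq_max => /andP[/h1 ? /h2 ?].
exists (fun z => (S z).1), (fun z => (S z).2) => z Dz.
have [r r0 hr] := hc z Dz; have [d d0 hd] := Dopen Dz.
exists (Num.min r d) => [|e e0]; first by rewrite lt_min r0.
have e2 : 0 < e / 2 by lra.
have [N hN] := hr _ e2; exists N => k Nk w; rewrite lt_min => /andP[h1 /hd Dw].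
have [N' hN'] := hS w Dw _ e2; pose n := maxn N N'.
have [] := hN' n (leq_maxr _ _); have := hN k n Nk (leq_maxl _ _) w h1.
rewrite /chord_dist.
have := normc_ge0 (chord1 (u k w) - chord1 (u n w)).
have := normr_ge0 (chord3 (u k w) - chord3 (u n w)).
have := normc_dist_trans (chord1 (u n w)) (chord1 (u k w)) (S w).1.
have := ler_distD (chord3 (u n w)) (chord3 (u k w)) (S w).2.
by clear -Dopen hu; move=> *; split; lra.
Qed.

Variables (S1 : V -> C) (S3 : V -> R).
Hypothesis hS : forall z, D z -> exists2 r, 0 < r & forall e, 0 < e ->
    exists N, forall k, (N <= k)%N -> forall w, nv (w - z) < r ->
      normc (chord1 (u k w) - S1 w) <= e /\ `|chord3 (u k w) - S3 w| <= e.

Let zz z : nv (z - z) = 0.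
Proof. by rewrite subrr nv0. Qed.

Lemma limit_chord_bounds z : D z -> [/\ 0 <= S3 z, normc (S1 z) <= 1 &
  normc (S1 z) ^+ 2 = S3 z * (1 - S3 z)].
Proof.
move=> /hS[r r0 hr].
have key e : 0 < e -> exists k, normc (chord1 (u k z) - S1 z) <= e /\ `|chord3 (u k z) - S3 z| <= e.
  by move=> /hr[N hN]; exists N; apply: hN => //; rewrite zz.
have S1le : normc (S1 z) <= 1.
  apply/ler_addgt0Pr => e /key[k [h1 _]]; have := chord1_le1 (u k z).
  by have := le_normc_sub (S1 z) (chord1 (u k z)); rewrite [normc (S1 z - _)]normcB; lra.
have S3ge : 0 <= S3 z.
  apply/ler_addgt0Pr => e /key[k [_]]; have := chord3_gt0 (u k z).
  by rewrite ler_norml; lra.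
have S3le : S3 z <= 1.
  apply/ler_addgt0Pr => e /key[k [_]]; have := chord3_le1 (u k z).
  by rewrite ler_norml; lra.
split=> //; apply: subr0_eq; apply: normr0_eq0; apply/eqP; rewrite eq_le normr_ge0 andbT.
apply/ler_addgt0Pr => e e0; rewrite add0r.
have [k [h1 h3]] := key (e / 4) ltac:(lra).
have n1 := chord1_le1 (u k z); have c1 := chord3_le1 (u k z); have c0 := chord3_gt0 (u k z).
have d1 : `|normc (S1 z) - normc (chord1 (u k z))| <= e / 4.
  have := le_normc_sub (S1 z) (chord1 (u k z)); have := le_normc_sub (chord1 (u k z)) (S1 z).
  by rewrite [normc (S1 z - _)]normcB ler_norml; lra.
have E : normc (S1 z) ^+ 2 - S3 z * (1 - S3 z) =
   (normc (S1 z) - normc (chord1 (u k z))) * (normc (S1 z) + normc (chord1 (u k z)))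
   + (chord3 (u k z) - S3 z) * (1 - (chord3 (u k z) + S3 z)).
  have /eqP := chord1_sqr (u k z); rewrite -subr_eq0 => /eqP H.
  by rewrite -[LHS]subr0 -H; ring.
rewrite E; apply: le_trans (ler_normD _ _) _; rewrite !normrM.
have s1 := normc_ge0 (S1 z); have s2 := normc_ge0 (chord1 (u k z)).
have u1 : `|normc (S1 z) - normc (chord1 (u k z))| * `|normc (S1 z) + normc (chord1 (u k z))| <= e / 4 * 2.
  by apply: ler_pM => //; rewrite ger0_norm; lra.
have u2 : `|chord3 (u k z) - S3 z| * `|1 - (chord3 (u k z) + S3 z)| <= e / 4 * 2.
  by apply: ler_pM => //; rewrite ler_norml; lra.
lra.
Qed.

Lemma limit_chord_lip z : D z -> exists r M, [/\ 0 < r, 0 <= M & forall w, nv (w - z) < r ->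
  `|S3 w - S3 z| <= M * nv (w - z)].
Proof.
move=> Dz; have [r [M [N [r0 M0 hN]]]] := hu Dz; have [d d0 hd] := hS Dz.
exists (Num.min r d), (6 * M); split; rewrite ?lt_min ?r0//; first by lra.
move=> w; rewrite lt_min => /andP[h1 h2]; apply/ler_addgt0Pr => e e0.
have [N' hN'] := hd (e / 2) ltac:(lra); pose k := maxn N N'.
have kN : (N <= k)%N := leq_maxl _ _; have kN' : (N' <= k)%N := leq_maxr _ _.
have zr : nv (z - z) < r by rewrite zz.
have := spherical_bound_chord (hN _ kN) zr h1; rewrite /chord_dist.
have zd : nv (z - z) < d by rewrite zz.
have [_] := hN' _ kN' w h2; have [_] := hN' _ kN' z zd.
have := normc_ge0 (chord1 (u k w) - chord1 (u k z)).
have := ler_distD (chord3 (u k z)) (chord3 (u k w)) (S3 z).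
have := ler_distD (chord3 (u k w)) (S3 w) (S3 z); rewrite [`|S3 w - chord3 _|]distrC; lra.
Qed.

Lemma limit_finite_open z : D z -> 0 < S3 z ->
  exists2 r, 0 < r & forall w, nv (w - z) < r -> S3 z / 2 < S3 w.
Proof.
move=> Dz Sz; have [r [M [r0 M0 h]]] := limit_chord_lip Dz.
have d0 : 0 < S3 z / (2 * (M + 1)) by rewrite divr_gt0//; lra.
exists (Num.min r (S3 z / (2 * (M + 1)))) => [|w]; first by rewrite lt_min r0.
rewrite lt_min => /andP[/h]; rewrite ltr_pdivlMr; last by lra.
by rewrite ler_norml; have := nv_ge0 (w - z); lra.
Qed.

Lemma slice_in z v (s t : C) (d : R) : nv v < d / 33 -> normc (t - 0) < 33 ->
  nv (z + t *: v - z) < d.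
Proof.
by move=> hv; rewrite addrAC subrr add0r nvZ subr0; have := nv_ge0 v; have := normc_ge0 t; nra.
Qed.

(** Near z the functions 1 / u_k are holomorphic without zeros on complex lines, and their limit
    vanishes at z. Hurwitz's theorem makes the limit vanish near the centre of each line; the
    identity theorem carries this to a ball of fixed size, independent of the direction. *)
Lemma limit_infinite_open z : D z -> S3 z = 0 ->
  exists2 r, 0 < r & forall w, nv (w - z) < r -> S3 w = 0.
Proof.
move=> Dz Sz; have [r [M [r0 M0 h]]] := limit_chord_lip Dz.
have [r1 [M1 [N1 [r10 M10 hN1]]]] := hu Dz; have [d d0 hd] := hS Dz.
have [p p0 hp] := Dopen Dz.
(* The last term gives S3 <= 1/4 on the ball, so that late u_k have [chord3] at most 1/2, that is
   |u_k| >= 1. *)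
pose c := Num.min (Num.min r p) (Num.min (Num.min r1 d) (4 * (M + 1))^-1).
have c4 : 0 < (4 * (M + 1))^-1 by rewrite invr_gt0; lra.
have c0 : 0 < c by rewrite !lt_min r0 r10 d0 c4 p0.
have cin w : nv (w - z) < c -> [/\ nv (w - z) < r, D w, nv (w - z) < r1, nv (w - z) < d & S3 w <= 1 / 4].
  rewrite !lt_min => /andP[/andP[a1 a5] /andP[/andP[a2 a3] a4]]; split => //; first exact: hp.
  have := h _ a1; rewrite Sz subr0 => h1.
  have := ler_norm (S3 w); move: a4; rewrite -[_^-1]mul1r ltr_pdivlMr; last by lra.
  by have := nv_ge0 (w - z); lra.
have [N2 hN2] := hd (1 / 4) ltac:(lra); pose N := maxn N1 N2.
have big k w : (N <= k)%N -> nv (w - z) < c -> chord3 (u k w) <= 1 / 2 /\ 1 <= normc (u k w).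
  rewrite geq_max => /andP[k1 k2] /cin[_ _ a2 a3 a4].
  have [_] := hN2 _ k2 w a3; rewrite ler_norml => h3.
  have c3 : chord3 (u k w) <= 1 / 2 by lra.
  split=> //; have cw := chord3_gt0 (u k w); have pw := chord_den_gt0 (u k w).
  have ew : chord3 (u k w) * (1 + normc (u k w) ^+ 2) = 1 by rewrite mulVf ?gt_eqF.
  have n0 := normc_ge0 (u k w).
  rewrite leNgt; apply/negP => hlt; have : normc (u k w) ^+ 2 < 1 by rewrite exprn_ilt1.
  by clear -ew c3 cw Dopen hu hS zz; nra.
(* With v = w - z the line z + t v stays in the c-ball for |t| < 33. The identity theorem then
   reaches |t| < 33 / 16, which contains the parameter 1 of w. *)
exists (c / 33) => [|w hw]; first by lra.
pose v := w - z.
have inc (t : C) : normc (t - 0) < 33 -> nv (z + t *: v - z) < c by exact: slice_in.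
pose f k t := (u k (z + t *: v))^-1.
pose F (t : C) := (S1 (z + t *: v))^*%C / (1 - S3 (z + t *: v))%:C.
have un0 k (t : C) : (N <= k)%N -> normc (t - 0) < 33 -> u k (z + t *: v) != 0.
  by move=> /big hk /inc/hk[_ hn]; rewrite -normc_gt0; lra.
have hf k : (N <= k)%N -> hol (f k) 0 33.
  move=> Nk t ht; have k1 : (N1 <= k)%N := leq_trans (leq_maxl _ _) Nk.
  have [_ _ a2 _ _] := cin _ (inc _ ht).
  have [l hl _] := hN1 _ k1 _ a2 v; have hl' := slice_cder hl.
  by eexists; apply: (cderV (f := fun s => u k (z + s *: v)) (un0 _ _ Nk ht) hl').
have cf : cvg_unif f F 0 33.
  move=> e e0; have [N3 hN3] := hd (e / 8) ltac:(lra).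
  exists (maxn N N3) => k; rewrite geq_max => /andP[k1 k3] t ht.
  have ic := inc t ht; have [_ Dw a2 a3 a4] := cin _ ic; have [b1 _] := big _ _ k1 ic.
  have [h1 h3] := hN3 _ k3 _ a3.
  have [s1 s2 _] := limit_chord_bounds Dw.
  rewrite /f /F chord_inverse ?un0//.
  have half : 0 < 1 / 2 :> R by clear -Dopen hu hS zz; lra.
  apply: le_trans (quotient_dist _ half _ _ _) _; [clear -a4 b1 Dopen hu hS zz; lra|clear -a4 b1 Dopen hu hS zz; lra|by rewrite normc_conj|].
  have -> : (chord1 (u k (z + t *: v)))^*%C - (S1 (z + t *: v))^*%C =
     (chord1 (u k (z + t *: v)) - S1 (z + t *: v))^*%C by rewrite rmorphB.
  rewrite normc_conj; have -> : 1 - chord3 (u k (z + t *: v)) - (1 - S3 (z + t *: v)) =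
     - (chord3 (u k (z + t *: v)) - S3 (z + t *: v)) by ring.
  rewrite normrN; set A := normc _ in h1 *; set B := `|_| in h3 *.
  have -> : A / (1 / 2) + B / (1 / 2) ^+ 2 = 2 * A + 4 * B by field.
  clear -h1 h3 e0 Dopen hu hS zz; lra.
have F0 : F 0 = 0.
  rewrite /F scale0r addr0; have [_ _] := limit_chord_bounds Dz.
  rewrite Sz mul0r => /eqP; rewrite expf_eq0 /= => /eqP/eq0_normc ->.
  by rewrite conjc0 mul0r.
have hfe : eventually_hol f 0 33 by exists N.
have r33 : 0 < 33 :> R by lra.
have nz : exists N, forall n, (N <= n)%N -> forall t, normc (t - 0) < 33 -> f n t != 0.
  by exists N => n Nn t ht; rewrite invr_eq0 un0.
have [b b0 hb] := hurwitz r33 hfe cf nz F0.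
have hF := weierstrass r33 hfe cf.
have FM t : normc (t - 0) < 33 -> normc (F t) <= 2.
  move=> ht; have [_ Dw a2 a3 a4] := cin _ (inc t ht).
  have [s1 s2 _] := limit_chord_bounds Dw.
  rewrite normcM normcV normc_real gtr0_norm; last by clear -a4 Dopen hu hS zz; lra.
  rewrite normc_conj.
  by rewrite ler_pdivrMr; clear -s2 a4 Dopen hu hS zz; lra.
have F1 := hol_identity r33 hF FM b0 hb (z := 1).
have {}F1 : F 1 = 0 by apply: F1; rewrite subr0 normc1; clear -Dopen hu hS zz; lra.
have vw : z + 1 *: v = w by rewrite scale1r addrC subrK.
have wc : nv (w - z) < c by clear -hw c0 Dopen hu hS zz; lra.
have [_ Dw _ _ a4] := cin _ wc; have [s1 _ s3] := limit_chord_bounds Dw.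
move/eqP: F1; rewrite /F vw mulf_eq0 conjc_eq0 invr_eq0 fmorph_eq0 => /orP[|] /eqP F1.
  move: s3; rewrite F1 normc0 expr0n => /esym/eqP; rewrite mulf_eq0 => /orP[/eqP//|/eqP].
  by clear -a4 Dopen hu hS zz; lra.
clear -F1 a4 Dopen hu hS zz; lra.
Qed.

End ChordalConvergence.

(** Connectedness is assumed as constancy of locally constant predicates, which is available for the
    plane through segments and for a domain through clopen sets. Holomorphy of the limit is left to
    the callers. *)
Theorem marty_normality D (u : nat -> V -> C) : totally_bounded_balls ->
  (forall z, D z -> exists2 r, 0 < r & forall w, nv (w - z) < r -> D w) ->
  (forall B : V -> Prop, (forall z, D z -> exists2 r, 0 < r & forall w, nv (w - z) < r ->
      (B w <-> B z)) -> forall z w, D z -> D w -> B z -> B w) ->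
  (forall z, D z -> exists r M N, [/\ 0 < r, 0 <= M &
     forall k, (N <= k)%N -> spherical_bound (u k) z r M]) ->
  exists2 phi : nat -> nat, {homo phi : i j / (i < j)%N} &
    (exists g, forall z, D z -> converges_near (u \o phi) g z) \/
    (forall z, D z -> diverges_near (u \o phi) z).
Proof.
move=> tb Dopen Dconn hu; have [q hq] := dense_sequence tb.
(* The three real coordinates on the sphere at each point of the dense sequence are interleaved
   modulo 3 into one family. *)
pose x j k := if (j %% 3 == 0)%N then complex.Re (chord1 (u k (q (j %/ 3)%N)))
  else if (j %% 3 == 1)%N then complex.Im (chord1 (u k (q (j %/ 3)%N)))
  else chord3 (u k (q (j %/ 3)%N)).
have [|phi hphi hc] := @diagonal_subsequence R x.
  move=> j k; rewrite /x; case: ifP => _; last case: ifP => _.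
  - exact: le_trans (normRe_le _) (chord1_le1 _).
  - exact: le_trans (normIm_le _) (chord1_le1 _).
  - by rewrite ger0_norm ?chord3_le1// ltW ?chord3_gt0.
exists phi => //.
have phi_ge k : (k <= phi k)%N.
  by elim: k => // k IH; apply: leq_ltn_trans IH _; exact: hphi.
have hu' z : D z -> exists r M N, [/\ 0 < r, 0 <= M &
    forall k, (N <= k)%N -> spherical_bound ((u \o phi) k) z r M].
  move=> /hu[r [M [N [r0 M0 hN]]]]; exists r, M, N; split => // k Nk.
  by apply: hN; apply: leq_trans Nk (phi_ge k).
have cq j e : 0 < e -> exists N, forall m n, (N <= m)%N -> (N <= n)%N ->
     chord_dist ((u \o phi) m (q j)) ((u \o phi) n (q j)) <= e.
  move=> e0; have e3 : 0 < e / 3 by lra.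
  have m0 : (3 * j %% 3 = 0)%N by rewrite modnMr.
  have m1 : ((3 * j + 1) %% 3 = 1)%N by rewrite mulnC modnMDl.
  have m2 : ((3 * j + 2) %% 3 = 2)%N by rewrite mulnC modnMDl.
  have d0 : (3 * j %/ 3 = j)%N by rewrite mulKn.
  have d1 : ((3 * j + 1) %/ 3 = j)%N by rewrite mulnC divnMDl// divn_small ?addn0.
  have d2 : ((3 * j + 2) %/ 3 = j)%N by rewrite mulnC divnMDl// divn_small ?addn0.
  have [N0 h0] := hc (3 * j)%N _ e3; have [N1 h1] := hc (3 * j + 1)%N _ e3.
  have [N2 h2] := hc (3 * j + 2)%N _ e3.
  exists (maxn N0 (maxn N1 N2)) => m n; rewrite !geq_max => /and3P[a0 a1 a2] /and3P[b0 b1 b2].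
  have := h0 _ _ a0 b0; have := h1 _ _ a1 b1; have := h2 _ _ a2 b2.
  rewrite /x m0 m1 m2 d0 d1 d2 /= -!raddfB /= /chord_dist => t2 t1 t0.
  apply: le_trans (lerD (normc_le_ReIm _) (lexx _)) _; lra.
have [S1 [S3 hS]] := chordal_limit Dopen (chordal_cauchy hu' hq cq).
have [[z0 [Dz0 Sz0]]|fin] := pselect (exists z, D z /\ S3 z = 0).
  right=> z Dz; have Sz : S3 z = 0.
    apply: (Dconn (fun w => S3 w = 0) _ z0 z) => // w Dw.
    have [s0 _ _] := limit_chord_bounds hS Dw.
    have [Sw|Sw] := eqVneq (S3 w) 0.
      have [r r0 hr] := limit_infinite_open Dopen hu' hS Dw Sw.
      by exists r => // w' /hr ->; rewrite Sw.
    have Swp : 0 < S3 w by rewrite lt_neqAle eq_sym Sw.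
    have [r r0 hr] := limit_finite_open hu' hS Dw Swp.
    by exists r => // w' /hr hw'; split => h; exfalso; [lra|move: Swp; rewrite h ltxx].
  have [r r0 hr] := limit_infinite_open Dopen hu' hS Dz Sz.
  have [d d0 hd] := hS z Dz.
  exists (Num.min r d) => [|A]; first by rewrite lt_min r0.
  (* If [chord3] is at most the inverse of this number, then |u_k|^2 >= |A|^2 + 1. *)
  have B0 : 0 < 1 + `|A| ^+ 2 + 1 by rewrite addr_gt0// ltr_wpDr// sqr_ge0.
  have [N hN] := hd (1 + `|A| ^+ 2 + 1)^-1 ltac:(by rewrite invr_gt0).
  exists N => k Nk w; rewrite lt_min => /andP[w1 w2].
  have [_] := hN _ Nk w w2; rewrite (hr _ w1) subr0 gtr0_norm ?chord3_gt0// /chord3.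
  rewrite lef_pV2 ?posrE ?chord_den_gt0// => h.
  apply: le_lt_trans (ler_norm A) _.
  rewrite -(@ltr_pXn2r _ 2) ?nnegrE ?normc_ge0//; lra.
left; exists (fun w => S1 w / (S3 w)%:C) => z Dz.
have [s0 _ _] := limit_chord_bounds hS Dz.
have Sz : 0 < S3 z.
  by rewrite lt_neqAle s0 andbT; apply/eqP => h; apply: fin; exists z.
have [r r0 hr] := limit_finite_open hu' hS Dz Sz.
have [d d0 hd] := hS z Dz; have [p p0 hp] := Dopen z Dz.
exists (Num.min (Num.min r d) p) => [|e e0]; first by rewrite !lt_min r0 d0.
pose c := S3 z / 4; have c0 : 0 < c by rewrite /c; lra.
pose K := 1 / c + 1 / c ^+ 2.
have K0 : 0 < K by rewrite addr_gt0// divr_gt0// exprn_gt0.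
have [N1 hN1] := hd c c0; have [N2 hN2] := hd (e / K) ltac:(by rewrite divr_gt0).
exists (maxn N1 N2) => k; rewrite geq_max => /andP[k1 k2] w.
rewrite !lt_min => /andP[/andP[w1 w2] w3]; rewrite {1}[(u \o phi) k w]chordE.
have [_] := hN1 _ k1 w w2; have [h1 h2] := hN2 _ k2 w w2; rewrite ler_norml => h3.
have Sw := hr _ w1; have [_ sl _] := limit_chord_bounds hS (hp _ w3).
apply: le_trans (quotient_dist _ c0 _ _ sl) _; [by rewrite /c in h3 *; clear -h3 Sw Sz; lra|by rewrite /c; clear -Sw Sz; lra|].
have cc : 0 <= c^-1 by rewrite invr_ge0 ltW.
have cc2 : 0 <= (c ^+ 2)^-1 by rewrite invr_ge0 ltW// exprn_gt0.
have := ler_wpM2r cc h1; have := ler_wpM2r cc2 h2.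
have eK : e / K * c^-1 + e / K * (c ^+ 2)^-1 = e.
  by rewrite -mulrDr /K !mul1r divfK// gt_eqF// -[X in X + _]mul1r -[X in _ + X]mul1r.
clear -eK; lra.
Qed.

End MartyNormality.

(** * Zalcman's rescaling *)

Section Zalcman.
Context {R : realType}.
Local Open Scope complex_scope.
Local Open Scope ring_scope.
Local Notation C := R[i].
Implicit Types (f g : C -> C) (z w v a b c : C) (r s d e M L : R).

(** Bisecting a segment on which [B] changes would produce a point near which [B] is not
    constant. *)
Lemma segment_connected_set (V : normedModType C) (B : V -> Prop) :
  (forall z : V, exists2 r, 0 < r & forall w : V, nv (w - z) < r -> (B w <-> B z)) ->
  forall z w : V, B z -> B w.
Proof.
move=> hB z w Bz; apply: contrapT => nBw.
pose p (t : R) := z + t%:C *: (w - z).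
pose P x y := B (p x) /\ ~ B (p y).
have P01 : P 0 1 by rewrite /P /p scale0r addr0 scale1r addrC subrK.
have [x y xy [Bx nBy]|t _ H] := bisection ltr01 P01.
  by have [Bm|nBm] := pselect (B (p ((x + y) / 2))); [right|left].
have [r r0 hr] := hB (p t); have v0 := nv_ge0 (w - z).
have [|x [y [/andP[xt ty] /andP[_ xy] [Bx nBy]]]] := H (r / (nv (w - z) + 1)).
  by rewrite divr_gt0//; lra.
move: xy; rewrite ltr_pdivlMr; last by lra.
have near q : x <= q <= y -> nv (p q - p t) <= (y - x) * nv (w - z).
  move=> hq; have -> : p q - p t = (q - t)%:C *: (w - z).
    by rewrite /p opprD addrACA subrr add0r -scalerBl rmorphB.
  by rewrite nvZ normc_real ler_wpM2r// ler_norml; lra.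
move=> xy; have hx : nv (p x - p t) < r by apply: le_lt_trans (near x _) _; nra.
have hy : nv (p y - p t) < r by apply: le_lt_trans (near y _) _; nra.
by apply: nBy; apply/(hr _ hy)/(hr _ hx).
Qed.

(* The maximum of f#(z) (s - |z|) over the disc |z| <= s is the centre of the rescaling. *)
Lemma zalcman_rescaling f r s L : 0 < s -> s < r -> 0 < L -> hol f 0 r ->
  L * (1 + normc (f 0) ^+ 2) < normc (deriv1 f 0) ->
  exists (z1 : C) (rho : R), [/\ 0 < rho, rho * L <= 1,
    forall w, normc w < L * s -> normc (z1 + rho%:C * w) < s,
    forall w, normc w <= L * s / 2 -> rho * normc (deriv1 f (z1 + rho%:C * w)) <=
       2 * (1 + normc (f (z1 + rho%:C * w)) ^+ 2) &
    rho * normc (deriv1 f z1) = 1 + normc (f z1) ^+ 2].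
Proof.
move=> s0 sr L0 hf hL.
(* The weighted spherical derivative is |F|; it is written as the modulus of a continuous complex
   function to fit [disc_max_norm]. *)
pose F z := deriv1 f z * (1 + (normc (f z))%:C * (normc (f z))%:C)^-1 * (s%:C - (normc (z - 0))%:C).
have den z : 1 + (normc (f z))%:C * (normc (f z))%:C = (1 + normc (f z) ^+ 2)%:C :> C.
  by rewrite rmorphD rmorph1 rmorphXn expr2.
have dn z : 0 < 1 + normc (f z) ^+ 2 by exact: chord_den_gt0.
have cF z : normc (z - 0) <= s -> ccont F z.
  move=> hz; have hzr : normc (z - 0) < r by lra.
  have [l fl] := hol_deriv1_hol hf hzr.
  have cn : ccont (fun z => (normc (f z))%:C) z by exact: ccont_norm (cder_ccont (hol_deriv1 hf hzr)).
  apply: ccontM; last first.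
    apply: ccontB; first exact: ccont_cst.
    exact: ccont_norm (ccontB (ccont_id _) (ccont_cst _ _)).
  apply: ccontM; first exact: cder_ccont fl.
  apply: ccontV; first by rewrite den fmorph_eq0 gt_eqF.
  by apply: ccontD; [exact: ccont_cst|exact: ccontM].
have FE z : normc (z - 0) <= s ->
    normc (F z) = normc (deriv1 f z) / (1 + normc (f z) ^+ 2) * (s - normc z).
  rewrite subr0 => hz; rewrite /F den !normcM normcV normc_real gtr0_norm//.
  by rewrite subr0 -(rmorphB (real_complex R)) normc_real ger0_norm// subr_ge0.
have [z1 hz1 hmax] := disc_max_norm (ltW s0) cF.
pose q z := normc (deriv1 f z) / (1 + normc (f z) ^+ 2).
have z00 : normc (0 - 0 : C) <= s by rewrite subrr normc0 ltW.
have h1 : L * s < q z1 * (s - normc z1).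
  have := hmax 0 z00; rewrite !FE// normc0 subr0; apply: lt_le_trans.
  by rewrite ltr_pM2r// ltr_pdivlMr.
have hz1' : normc z1 <= s by move: hz1; rewrite subr0.
have nz1 := normc_ge0 z1.
have Ls : 0 < L * s by rewrite mulr_gt0.
have q0 : 0 < q z1.
  rewrite ltNge; apply/negP => q0; have : q z1 * (s - normc z1) <= 0 by nra.
  by lra.
have qL : L <= q z1.
  by rewrite -(ler_pM2r s0); apply: le_trans (ltW h1) _; rewrite ler_pM2l//; lra.
have rq : (q z1)^-1 * q z1 = 1 by rewrite mulVf// gt_eqF.
(* The scale is the inverse of f#(z1), which normalises the spherical derivative at the centre to 1.
   For |w| <= L s / 2 the point stays within half the distance of z1 to the circle |z| = s, so the
   weight at least halves no further and f# is at most 2 f#(z1). *)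
exists z1, (q z1)^-1; split.
- by rewrite invr_gt0.
- by rewrite -[X in _ <= X]rq ler_pM2l ?invr_gt0.
- move=> w hw; apply: le_lt_trans (le_normcD _ _) _.
  rewrite normcM normc_real gtr0_norm ?invr_gt0// -ltrBrDl.
  by rewrite mulrC ltr_pdivrMr// [X in _ < X]mulrC; exact: lt_trans hw h1.
- move=> w hw; set z := z1 + _.
  have hz : normc z - normc z1 <= (s - normc z1) / 2.
    apply: le_trans (le_normc_sub _ _) _; rewrite /z addrAC subrr add0r.
    rewrite normcM normc_real gtr0_norm ?invr_gt0// mulrC ler_pdivrMr//; lra.
  have hzs : normc (z - 0) <= s by rewrite subr0; lra.
  have := hmax z hzs; rewrite !FE// -/(q z) -/(q z1) => H.
  have t0 : 0 < s - normc z1 by nra.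
  have qz0 : 0 <= q z by rewrite divr_ge0 ?normc_ge0// ltW.
  have H2 : q z <= 2 * q z1.
    rewrite -(ler_pM2r t0); nra.
  have -> : normc (deriv1 f z) = q z * (1 + normc (f z) ^+ 2) by rewrite /q divfK// gt_eqF.
  rewrite mulrA ler_pM2r// mulrC ler_pdivrMr//.
- have -> : normc (deriv1 f z1) = q z1 * (1 + normc (f z1) ^+ 2) by rewrite /q divfK// gt_eqF.
  by rewrite mulrA rq mul1r.
Qed.

Lemma totally_bounded_C : totally_bounded_balls C.
Proof.
move=> r e e0; have [s hs] := compact_total_bounded (@compact_disc R 0 r) e0.
by exists s => w hw; apply: hs; rewrite /= subr0; exact: ltW.
Qed.

Section RescaledSequence.
Variables (g : nat -> C -> C) (a b c : C) (s M : R).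
Hypotheses (s0 : 0 < s) (M0 : 0 <= M) (ab : a != b) (ac : a != c) (bc : b != c).
Hypothesis hg : forall k, hol (g k) 0 (k.+1%:R * s).
Hypothesis gs : forall k w, normc w <= k.+1%:R * s / 2 ->
  normc (deriv1 (g k) w) <= 2 * (1 + normc (g k w) ^+ 2).
Hypothesis g1 : forall k, normc (deriv1 (g k) 0) = 1 + normc (g k 0) ^+ 2.
Hypothesis gr : forall k w, normc w < k.+1%:R * s -> g k w = a \/ g k w = b \/ g k w = c ->
  normc (deriv1 (g k) w) * k.+1%:R <= M.

Let large (A : R) : exists N, forall k, (N <= k)%N -> A < k.+1%:R * s / 2.
Proof.
have s1 := s0; pose N := Num.bound (2 * `|A| / s); exists N => k Nk.
have := archi_boundP (divr_ge0 (mulr_ge0 (ler0n R 2) (normr_ge0 A)) (ltW s0)).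
rewrite -/N ltr_pdivrMr// => h1.
have h2 : N%:R <= k.+1%:R :> R by rewrite ler_nat leqW.
by have := ler_norm A; have := ler_wpM2r (ltW s0) h2; lra.
Qed.

(** A finite limit h is entire, has h'(0) nonzero and is totally ramified over a, b and c, which
    [no_three_totally_ramified_values] forbids. An infinite limit is incompatible with the
    normalisation [g1] at 0. *)
Lemma rescaled_sequence_contradiction : False.
Proof.
have s_gt0 := s0; have M_ge0 := M0.
have sb (z : C) : exists r M N, [/\ 0 < r, 0 <= M &
    forall k, (N <= k)%N -> spherical_bound (V := C) (g k) z r M].
  have [N hN] := large (normc z + 1); exists 1, 2, N; split => // k /hN hk w hw v.
  have hw1 : normc w < k.+1%:R * s / 2.
    by have hwz : normc (w - z) < 1 := hw; have := le_normc_sub w z; lra.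
  have nw := normc_ge0 w.
  have hw2 : normc (w - 0) < k.+1%:R * s by rewrite subr0; lra.
  have cv : cder (fun t => w + t * v) 0 v.
    by apply: cder_eq (cderD (cder_cst w 0) (cderM (cder_id 0) (cder_cst v 0))) _; ring.
  exists (deriv1 (g k) w * v).
    have := @cder_comp _ (g k) (fun t => w + t * v) 0 (deriv1 (g k) w) v.
    rewrite mul0r addr0 => H; exact: (H cv (hol_deriv1 (@hg k) hw2)).
  rewrite normcM nv_normc mulrAC ler_wpM2r ?normc_ge0//; exact: gs (ltW hw1).
have [|||phi hphi H] := @marty_normality _ C setT g totally_bounded_C.
- by move=> z _; exists 1.
- move=> B hB z w _ _; apply: segment_connected_set => v.
  by have [r r0 hr] := hB v I; exists r.
- by move=> z _; exact: sb.
have phi_ge k : (k <= phi k)%N by elim: k => // k IH; apply: leq_ltn_trans IH _; exact: hphi.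
have hol_near z : eventually_hol (g \o phi) z 1.
  have [N hN] := large (normc z + 1); exists N => k Nk w hw.
  apply: hg; rewrite subr0; have := hN _ (leq_trans Nk (phi_ge k)).
  by have := le_normc_sub w z; have := normc_ge0 w; lra.
have zz : normc (0 - 0 : C) = 0 by rewrite subrr normc0.
case: H => [[h hh]|hdiv]; last first.
  have [d d0 hd] := hdiv 0 I; pose m := Num.min d 1.
  have m0 : 0 < m by rewrite lt_min d0 ltr01.
  have md : m <= d by rewrite ge_min lexx.
  have m1 : m <= 1 by rewrite ge_min lexx orbT.
  (* If |f| > 25 / m on the disc of radius m, Cauchy's estimate for 1/f gives |f'(0)| / |f(0)|^2 <=
     24/25, whereas by [g1] this ratio is 1 + 1 / |f(0)|^2. *)
  pose A := 25 / m; have A0 : 0 < A by rewrite divr_gt0.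
  have [N hN] := hd A; have [N' hN'] := hol_near 0; pose k := maxn N N'.
  have := hN k (leq_maxl _ _) => {}hN; have := hN' k (leq_maxr _ _) => {}hN'.
  set f := (g \o phi) k in hN hN'.
  have fA w : normc (w - 0) < m -> A < normc (f w) by move=> hw; apply: hN; rewrite nv_normc; lra.
  have fn w : normc (w - 0) < m -> f w != 0.
    by move=> /fA hw; rewrite -normc_gt0; exact: lt_trans hw.
  have hG : hol (fun w => (f w)^-1) 0 m.
    by move=> w hw; eexists; apply: cderV (fn _ hw) (hol_deriv1 hN' _); lra.
  have f0 : f 0 != 0 by apply: fn; rewrite zz.
  have dG : cder (fun w => (f w)^-1) 0 (- deriv1 f 0 / f 0 ^+ 2).
    by apply: cderV f0 (hol_deriv1 hN' _); rewrite zz ltr01.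
  have hb w : normc (w - 0) < m -> normc ((f w)^-1) <= A^-1.
    by move=> /fA hw; rewrite normcV lef_pV2 ?posrE ?(lt_trans A0 hw)// ltW.
  have := le_cder m0 hG hb dG.
  have -> : 24 * A^-1 / m = 24 / 25 by rewrite /A; field; rewrite gt_eqF.
  have fp : 0 < normc (f 0) ^+ 2 by rewrite exprn_gt0// normc_gt0.
  rewrite normcM normcN normcV normcX ler_pdivrMr//.
  have -> : normc (deriv1 f 0) = 1 + normc (f 0) ^+ 2 := g1 (phi k).
  lra.
have cu z : exists r, [/\ 0 < r, r <= 1, eventually_hol (g \o phi) z r & cvg_unif (g \o phi) h z r].
  have [r r0 hr] := hh z I; have [N hN] := hol_near z.
  exists (Num.min r 1); split; rewrite ?lt_min ?r0 ?ltr01 ?ge_min ?lexx ?orbT//.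
    by exists N => k /hN; apply: hol_sub; rewrite subrr normc0 add0r ge_min lexx orbT.
  move=> e /hr[N' hN']; exists N' => k /hN' hk w; rewrite lt_min => /andP[hw _]; exact: hk.
have eh : entire h.
  move=> z; have [r [r0 _ h1 h2]] := cu z.
  by apply: (weierstrass r0 h1 h2); rewrite subrr normc0.
have cd z : exists r, [/\ 0 < r, r <= 1, cvg_unif (g \o phi) h z r &
    cvg_unif (fun n => deriv1 ((g \o phi) n)) (deriv1 h) z r].
  have [r [r0 r1 h1 h2]] := cu z; exists (r / 2); split; try lra.
    by apply: cvg_unif_sub h2; rewrite subrr normc0; lra.
  by apply: cvg_unif_deriv1 h1 h2; lra.
have approx z e : 0 < e -> exists n, normc z <= (phi n).+1%:R * s / 2 /\
    normc (g (phi n) z - h z) <= e /\ normc (deriv1 (g (phi n)) z - deriv1 h z) <= e.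
  move=> e0; have [r [r0 _ h1 h2]] := cd z; have [N1 H1] := h1 e e0; have [N2 H2] := h2 e e0.
  have [N3 H3] := large (normc z); pose n := maxn N1 (maxn N2 N3).
  have n1 : (N1 <= n)%N by rewrite leq_max leqnn.
  have n2 : (N2 <= n)%N by rewrite !leq_max leqnn orbT.
  have n3 : (N3 <= n)%N by rewrite !leq_max leqnn !orbT.
  have z0 : normc (z - z) < r by rewrite subrr normc0.
  exists n; split; first by apply/ltW/H3; exact: leq_trans (phi_ge n).
  by split; [exact: H1|exact: H2].
have hs z : normc (deriv1 h z) <= 2 * (1 + normc (h z) ^+ 2).
  apply/ler_addgt0Pr => e e0; have n0 := normc_ge0 (h z).
  pose e1 := Num.min 1 (e / (3 + 4 * normc (h z))).
  have d0 : 0 < 3 + 4 * normc (h z) by lra.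
  have e10 : 0 < e1 by rewrite lt_min ltr01 divr_gt0.
  have e11 : e1 <= 1 by rewrite ge_min lexx.
  have e12 : e1 * (3 + 4 * normc (h z)) <= e by rewrite -ler_pdivlMr// ge_min lexx orbT.
  have [n [nz [h1 h2]]] := approx z e1 e10; have := gs nz.
  set u := g (phi n) z in h1 *; set u' := deriv1 (g (phi n)) z in h2 * => uu.
  have := le_normc_sub (deriv1 h z) u'; rewrite normcB => a1.
  have a2 : normc u <= normc (h z) + e1 by have := le_normc_sub u (h z); lra.
  have a3 : normc u ^+ 2 <= (normc (h z) + e1) ^+ 2.
    by rewrite lerXn2r ?nnegrE ?normc_ge0// addr_ge0// ltW.
  have a4 : e1 ^+ 2 <= e1 by rewrite expr2 ler_piMr// ltW.
  have a5 : (normc (h z) + e1) ^+ 2 = normc (h z) ^+ 2 + 2 * e1 * normc (h z) + e1 ^+ 2 by ring.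
  lra.
have h'0 : deriv1 h 0 != 0.
  have [n [_ [_ h2]]] := approx 0 (1 / 2) ltac:(lra).
  rewrite -normc_gt0; have := g1 (phi n); have := sqr_ge0 (normc (g (phi n) 0)).
  by have := le_normc_sub (deriv1 (g (phi n)) 0) (deriv1 h 0); lra.
(* If h'(z) were nonzero, the derivatives of late functions would stay away from 0 near z, while by
   [gr] they are O(1/k) at points over a, b, c. So the value h(z) would be omitted near z, and
   Hurwitz's theorem would make h constant there. *)
have hram z : h z = a \/ h z = b \/ h z = c -> deriv1 h z = 0.
  move=> hz; apply/eqP; apply: contraT => h'z; have := h'z; rewrite -normc_gt0 => hp.
  have [d d0 hd] := ccont_neq0 (entire_ccont z (entire_deriv1 eh)) h'z.
  have [r [r0 r1 h1 h2]] := cd z; pose x := h z.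
  pose p := Num.min d r; have p0 : 0 < p by rewrite lt_min d0.
  have pd : p <= d by rewrite ge_min lexx.
  have pr : p <= r by rewrite ge_min lexx orbT.
  set eta := normc (deriv1 h z) in hp hd.
  have [N1 H1] := h2 (eta / 4) ltac:(lra); have [N2 H2] := hol_near z.
  have [N3 H3] := large (4 * M / eta * s); have [N4 H4] := large (normc z + 1).
  pose N := maxn (maxn N1 N2) (maxn N3 N4).
  have cx : cder (fun=> x) z 0 := cder_cst x z.
  have hx : exists2 d, 0 < d & forall w, normc (w - z) < d -> h w - x = 0.
    apply: (@hurwitz _ (fun n w => (g \o phi) n w - x) (fun w => h w - x) z p p0).
    - exists N2 => n /H2 hn w hw; eexists; apply: cderB; last exact: cder_cst.
      by apply: hol_deriv1 hn _; lra.
    - move=> e e0; have [N' hN'] := h1 e e0; exists N' => n /hN' hn w hw.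
      have -> : (g \o phi) n w - x - (h w - x) = (g \o phi) n w - h w by ring.
      by apply: hn; lra.
    - exists N => n; rewrite /N !geq_max => /andP[/andP[n1 n2] /andP[n3 n4]] w hw.
      rewrite subr_eq0; apply/eqP => gw.
      have wd : normc (w - z) < d by lra.
      have wr : normc (w - z) < r by lra.
      have u1 := hd w wd; have u2 := H1 n n1 w wr.
      have u3 : eta / 4 <= normc (deriv1 (g (phi n)) w).
        have := le_normc_sub (deriv1 h w) (deriv1 (g (phi n)) w).
        by rewrite normcB /= in u2 *; lra.
      have wn : normc w < (phi n).+1%:R * s.
        have := H4 _ (leq_trans n4 (phi_ge n)); have := le_normc_sub w z.
        by have := normc_ge0 w; lra.
      have gwabc : g (phi n) w = a \/ g (phi n) w = b \/ g (phi n) w = c.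
        by rewrite /= in gw; rewrite gw.
      have := gr wn gwabc; have := H3 _ (leq_trans n3 (phi_ge n)).
      set K := (phi n).+1%:R; have K0 : 0 < K by rewrite ltr0n.
      rewrite -mulrA [K * _]mulrC mulrC => h3 h4.
      have : 4 * M / eta < K / 2.
        by rewrite -(ltr_pM2r s_gt0); lra.
      rewrite ltr_pdivrMr// => h5.
      have : eta / 4 * K <= normc (deriv1 (g (phi n)) w) * K by rewrite ler_pM2r.
      by lra.
    - by rewrite subrr.
  have [q q0 hq] := hx; rewrite -(negbTE h'z); apply/eqP/deriv1E.
  apply: (cder_ext q0 _ (cder_cst x z)) => w /hq /subr0_eq -> //.
by move: h'0; rewrite (no_three_totally_ramified_values ab ac bc eh hs hram) eqxx.
Qed.

End RescaledSequence.
End Zalcman.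

(** * Several complex variables *)

Section LappanBound.
Context {R : realType}.
Local Open Scope complex_scope.
Local Open Scope ring_scope.
Local Notation C := R[i].
Implicit Types (f : C -> C) (z w a b c : C) (r s M K : R).

(** [K] depends on a, b, c, r and M alone: this uniformity comes from arguing by contradiction with
    a sequence of functions, and lets the bound hold on all complex lines at once. *)
Theorem lappan_bound a b c r M : a != b -> a != c -> b != c -> 0 < r -> 0 <= M ->
  exists2 K, 0 <= K & forall f, hol f 0 r ->
    (forall z, normc z < r -> f z = a \/ f z = b \/ f z = c -> normc (deriv1 f z) <= M) ->
    normc (deriv1 f 0) <= K * (1 + normc (f 0) ^+ 2).
Proof.
move=> ab ac bc r0 M0; apply: contrapT => H.
have bad (k : nat) : exists f, [/\ hol f 0 r,
   (forall z, normc z < r -> f z = a \/ f z = b \/ f z = c -> normc (deriv1 f z) <= M) &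
   k.+1%:R * (1 + normc (f 0) ^+ 2) < normc (deriv1 f 0)].
  apply: contrapT => nf; apply: H; exists k.+1%:R => // f hf hM.
  by rewrite leNgt; apply/negP => hlt; apply: nf; exists f.
have /choice[f hf] := bad; pose s := r / 2.
have s0 : 0 < s by rewrite divr_gt0.
have sr : s < r by rewrite /s; lra.
have resc (k : nat) : exists zr : C * R, [/\ 0 < zr.2, zr.2 * k.+1%:R <= 1,
    forall w, normc w < k.+1%:R * s -> normc (zr.1 + zr.2%:C * w) < s,
    forall w, normc w <= k.+1%:R * s / 2 -> zr.2 * normc (deriv1 (f k) (zr.1 + zr.2%:C * w)) <=
       2 * (1 + normc (f k (zr.1 + zr.2%:C * w)) ^+ 2) &
    zr.2 * normc (deriv1 (f k) zr.1) = 1 + normc (f k zr.1) ^+ 2].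
  have [h1 h2 h3] := hf k; have k0 : 0 < k.+1%:R :> R by rewrite ltr0n.
  by have [z1 [rho h]] := zalcman_rescaling s0 sr k0 h1 h3; exists (z1, rho).
have /choice[zr hzr] := resc.
pose g k w := f k ((zr k).1 + (zr k).2%:C * w).
have dg k w : normc w < k.+1%:R * s ->
    cder (g k) w (deriv1 (f k) ((zr k).1 + (zr k).2%:C * w) * (zr k).2%:C).
  move=> hw; have [_ _ h3 _ _] := hzr k; have [h1 _ _] := hf k.
  by apply: cder_shift; apply: (hol_deriv1 h1); rewrite subr0; apply: lt_trans (h3 _ hw) sr.
have ndg k w : normc w < k.+1%:R * s ->
    normc (deriv1 (g k) w) = (zr k).2 * normc (deriv1 (f k) ((zr k).1 + (zr k).2%:C * w)).
  move=> hw; have [h0 _ _ _ _] := hzr k.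
  by rewrite (deriv1E (dg _ _ hw)) normcM normc_real gtr0_norm// mulrC.
have ks (k : nat) : 0 < k.+1%:R * s by rewrite mulr_gt0 ?ltr0n.
apply: (@rescaled_sequence_contradiction _ g a b c s M) => //.
- by move=> k w; rewrite subr0 => hw; eexists; exact: dg.
- move=> k w hw; have [_ _ _ h4 _] := hzr k; rewrite ndg; first exact: h4.
  by have := ks k; lra.
- move=> k; have [_ _ _ _ h5] := hzr k; rewrite ndg ?normc0//.
  by rewrite /g mulr0 addr0.
(* Rescaling multiplies derivatives by the scale, which is at most 1 / (k + 1); so the bound M over
   a, b, c becomes M / (k + 1). *)
- move=> k w hw abc; have [h0 h1 h3 _ _] := hzr k; have [_ h2 _] := hf k.
  have wr : normc ((zr k).1 + (zr k).2%:C * w) < r by apply: lt_trans (h3 _ hw) sr.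
  rewrite ndg// mulrAC; have := h2 _ wr abc.
  have p0 : 0 <= (zr k).2 * k.+1%:R by rewrite mulr_ge0// ltW.
  have := normc_ge0 (deriv1 (f k) ((zr k).1 + (zr k).2%:C * w)); nra.
Qed.

End LappanBound.

(** * Frechet differentiability from complex lines *)

Section FrechetDerivative.
Context {R : realType}.
Local Open Scope complex_scope.
Local Open Scope ring_scope.
Local Notation C := R[i].
Variable V : normedModType C.
Implicit Types (f g : V -> C) (z w v h : V) (r d e M : R) (t l : C).

Lemma mul_nvE e v : e%:C * `|v| = (e * nv v)%:C.
Proof. by rewrite nvE rmorphM. Qed.

Lemma differentiable_eps f z e : differentiable f z -> 0 < e -> exists2 d, 0 < d &
  forall h, nv h < d -> normc (f (z + h) - f z - 'd f z h) <= e * nv h.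
Proof.
move=> /diff_locally/eqaddoP H e0.
have e0' : 0 < e%:C by rewrite ltcR.
have /nbhs_nv[d d0 hd] := H _ e0'; exists d => // h hh.
have := hd h; rewrite subr0 => /(_ hh); rewrite /= mul_nvE lecR.
by rewrite !fctE /= [h + z]addrC opprD addrA.
Qed.

Definition linear_of (L : V -> C) of linear L := L.
HB.instance Definition _ (L : V -> C) (hL : linear L) :=
  GRing.isLinear.Build C V C *:%R (linear_of hL) hL.

Lemma eps_differentiable f z (L : V -> C) M : linear L ->
  (forall v, normc (L v) <= M * nv v) ->
  (forall e, 0 < e -> exists2 d, 0 < d &
    forall h, nv h < d -> normc (f (z + h) - f z - L h) <= e * nv h) ->
  differentiable f z.
Proof.
move=> hL bL H.
have cL : continuous (linear_of hL).
  move=> x U /nbhs_normc[e e0 eU]; apply/nbhs_nv.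
  exists (e / (`|M| + 1)) => [|w]; first by rewrite divr_gt0// ltr_pwDr.
  rewrite ltr_pdivlMr ?ltr_pwDr// => hw; apply: eU.
  rewrite -[linear_of hL w - _](linearB (linear_of hL)); apply: le_lt_trans (bL _) _.
  apply: le_lt_trans hw; rewrite mulrC ler_wpM2l ?nv_ge0//.
  by have := ler_norm M; lra.
have E : f \o shift z = cst (f z) + linear_of hL +o_ (0 : V) id.
  apply/eqaddoP => e e0; have eE : e = (complex.Re e)%:C by rewrite RRe_real// gtr0_real.
  have e1 : 0 < complex.Re e by rewrite -ltcR -eE.
  have [d d0 hd] := H _ e1.
  apply/nbhs_nv; exists d => // h; rewrite subr0 => /hd hh.
  rewrite /= eE mul_nvE lecR !fctE /= [h + z]addrC opprD addrA.
  exact: hh.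
by apply/diff_locallyP; rewrite (diff_unique cL E).
Qed.

Lemma differentiable_slice f z v : differentiable f z ->
  cder (fun t => f (z + t *: v)) 0 ('d f z v).
Proof.
move=> df; apply: eps_cder => e e0; have v0 := nv_ge0 v.
have v1 : 0 < nv v + 1 by lra.
have [d d0 hd] := differentiable_eps df (divr_gt0 e0 v1).
exists (d / (nv v + 1)) => [|t]; first by rewrite divr_gt0.
rewrite ltr_pdivlMr// => ht; have t0 := normc_ge0 t.
have := hd (t *: v); rewrite nvZ => /(_ ltac:(nra)) H.
rewrite add0r scale0r addr0.
have -> : 'd f z v * t = 'd f z (t *: v) by rewrite linearZ mulrC.
apply: le_trans H _; rewrite mulrAC ler_pdivrMr//; nra.
Qed.

(** The line in direction v stays in the ball for |t| < r / |v|, so Cauchy's estimate is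
    proportional to |v|. *)
Lemma le_slice_cder g z r M v l : 0 < r ->
  (forall w, nv (w - z) < r -> normc (g w) <= M) ->
  (forall w v, nv (w - z) < r -> exists l, cder (fun t => g (w + t *: v)) 0 l) ->
  cder (fun t => g (z + t *: v)) 0 l -> normc l <= 24 * M / r * nv v.
Proof.
move=> r0 bg hs dl; have := nv_ge0 v; rewrite le_eqVlt => /predU1P[/esym/eqP|v0].
  rewrite nv_eq0 => /eqP v0; suff -> : l = 0 by rewrite normc0 v0 (nv0 V) mulr0.
  apply: cder_uniq dl _; apply: cder_ext ltr01 _ (cder_cst (g z) 0) => t _.
  by rewrite v0 scaler0 addr0.
have slice t : normc (t - 0) < r / nv v -> nv (z + t *: v - z) < r.
  by rewrite subr0 ltr_pdivlMr// addrAC subrr add0r nvZ.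
have -> : 24 * M / r * nv v = 24 * M / (r / nv v) by field; rewrite !gt_eqF.
apply: (le_cder _ _ _ dl); first by rewrite divr_gt0.
- by move=> t /slice ht; have [m hm] := hs _ v ht; exists m; exact: slice_cder.
- by move=> t /slice; exact: bg.
Qed.

(* Gateaux-holomorphic and bounded: Cauchy's estimates on the slices are uniform in the direction. *)
Lemma bounded_slices_differentiable g z r M (L : V -> C) : 0 < r -> linear L ->
  (forall w, nv (w - z) < r -> normc (g w) <= M) ->
  (forall w v, nv (w - z) < r -> exists l, cder (fun t => g (w + t *: v)) 0 l) ->
  (forall v, cder (fun t => g (z + t *: v)) 0 (L v)) -> differentiable g z.
Proof.
move=> r0 hL bg hs dL.
have M0 : 0 <= M by apply: le_trans (bg z _); rewrite ?normc_ge0// subrr nv0.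
have slice v t : 0 < nv v -> normc (t - 0) < r / nv v -> nv (z + t *: v - z) < r.
  by move=> v0; rewrite subr0 ltr_pdivlMr// addrAC subrr add0r nvZ.
have hol_slice v : 0 < nv v -> hol (fun t => g (z + t *: v)) 0 (r / nv v).
  move=> v0 t /(slice _ _ v0) ht; have [l hl] := hs _ v ht.
  by exists l; exact: slice_cder.
have bslice v : 0 < nv v -> forall t, normc (t - 0) < r / nv v -> normc (g (z + t *: v)) <= M.
  by move=> v0 t /(slice _ _ v0) ht; exact: bg.
have bL v : normc (L v) <= 24 * M / r * nv v by apply: le_slice_cder (dL v).
apply: (eps_differentiable hL bL) => // e e0.
pose K := second_order_bound M r; have K0 : 0 <= K by exact: second_order_bound_ge0.
have K1 : 0 < K + 1 by lra.
exists (Num.min (r / 4) (e / (K + 1))) => [|v]; first by rewrite lt_min !divr_gt0.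
rewrite lt_min ltr_pdivlMr// => /andP[h1]; rewrite ltr_pdivlMr// => h2.
have := nv_ge0 v; rewrite le_eqVlt => /predU1P[/esym/eqP|v0].
  move=> /eqP v0; have := bL v; rewrite v0 mulr0.
  by move/eqP: v0; rewrite nv_eq0 => /eqP ->; rewrite addr0 subrr sub0r normcN mulr0.
have rv : 0 < r / nv v by rewrite divr_gt0.
(* The slice has radius r / |v|, and [second_order_bound] scales as the inverse square of the
   radius: the remainder at t = 1 is K |v|^2. *)
have := taylor1 rv (hol_slice v v0) (bslice v v0) (z := 0) (h := 1).
rewrite subrr normc0 normc1 add0r scale1r scale0r addr0 (deriv1E (dL v)) mulr1 expr1n mulr1.
have -> : second_order_bound M (r / nv v) = K * nv v * nv v.
  by rewrite /K /second_order_bound; field; rewrite !gt_eqF.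
move=> H; apply: le_trans (H _ _) _; first by rewrite divr_gt0.
  by rewrite ltr_pdivlMr// ltr_pdivlMr//; lra.
by rewrite ler_wpM2r// ltW//; lra.
Qed.

Lemma locally_bounded g z : differentiable g z ->
  exists2 r, 0 < r & forall w, nv (w - z) < r -> normc (g w) <= normc (g z) + 1.
Proof.
move=> /differentiable_continuous/(_ [set x | normc (x - g z) < 1]).
rewrite /= => /(_ _)/nbhs_nv[|r r0 hr]; first by apply/nbhs_normc; exists 1.
exists r => // w /hr /= hw; have := normc_dist_trans (g z) (g w) 0.
by rewrite !subr0; lra.
Qed.

(** Weierstrass's theorem on each line gives the directional derivatives of g as limits of those of
    u_k. Hence they are linear in the direction, and local boundedness turns them into a Frechet
    derivative. *)
Lemma limit_differentiable u g z r : 0 < r ->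
  (forall k w, nv (w - z) < r -> differentiable (u k) w) ->
  (forall e, 0 < e -> exists N, forall k : nat, (N <= k)%N -> forall w, nv (w - z) < r ->
     normc (u k w - g w) <= e) ->
  differentiable g z.
Proof.
move=> r0 du cu; have zz : nv (z - z) < r by rewrite subrr nv0.
have [N hN] := cu 1 ltr01.
have [d d0 hd] := locally_bounded (du N z zz).
have slice w v : nv (w - z) < r -> exists s, [/\ 0 < s,
    eventually_hol (fun k t => u k (w + t *: v)) 0 s &
    cvg_unif (fun k t => u k (w + t *: v)) (fun t => g (w + t *: v)) 0 s].
  move=> hw; have v0 := nv_ge0 v; have v1 : 0 < nv v + 1 by lra.
  have rw : 0 < r - nv (w - z) by lra.
  have hin t : normc (t - 0) < (r - nv (w - z)) / (nv v + 1) -> nv (w + t *: v - z) < r.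
    rewrite subr0 ltr_pdivlMr// => ht; apply: le_lt_trans (nv_trans w _ _) _.
    by rewrite addrAC subrr add0r nvZ; have := normc_ge0 t; nra.
  exists ((r - nv (w - z)) / (nv v + 1)); split; first by rewrite divr_gt0.
    exists 0%N => k _ t /hin /(du k) dk; exists ('d (u k) (w + t *: v) v).
    by apply: slice_cder; exact: differentiable_slice.
  by move=> e /cu[M hM]; exists M => k /hM hk t /hin; exact: hk.
have sl w v : nv (w - z) < r -> exists l, cder (fun t => g (w + t *: v)) 0 l.
  move=> hw; have [s [s0 h1 h2]] := slice w v hw; have [|l hl] := weierstrass s0 h1 h2 (_ : normc (0 - 0) < s).
    by rewrite subrr normc0.
  by exists l.
pose L v := deriv1 (fun t => g (z + t *: v)) 0.
have dL v : cder (fun t => g (z + t *: v)) 0 (L v).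
  by have [l hl] := sl z v zz; rewrite /L (deriv1E hl).
have cL v e : 0 < e -> exists M : nat, forall k, (M <= k)%N -> normc ('d (u k) z v - L v) <= e.
  move=> e0; have [s [s0 h1 h2]] := slice z v zz.
  have s2 : s / 2 < s by lra.
  have [M hM] := cvg_unif_deriv1 (divr_gt0 s0 (ltr0Sn _ 1)) s2 h1 h2 e0.
  exists M => k hk; have := hM _ hk 0.
  rewrite subrr normc0 (deriv1E (differentiable_slice v (du k z zz))).
  by apply; rewrite divr_gt0.
have hL : linear L.
  move=> a x y; apply: subr0_eq; apply: normc_lt_eq0 => e e0.
  have a0 := normc_ge0 a; have d1 : 0 < e / (4 * (normc a + 1)) by rewrite divr_gt0//; lra.
  have [M1 h1] := cL x _ d1; have e4 : 0 < e / 4 by lra.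
  have [M2 h2] := cL y _ e4; have [M3 h3] := cL (a *: x + y) _ e4.
  pose k := maxn M1 (maxn M2 M3).
  have {}h1 := h1 k (leq_maxl _ _).
  have {}h2 := h2 k (leq_trans (leq_maxl _ _) (leq_maxr _ _)).
  have {}h3 := h3 k (leq_trans (leq_maxr _ _) (leq_maxr _ _)).
  have -> : L (a *: x + y) - (a *: L x + L y) = a * ('d (u k) z x - L x)
     + ('d (u k) z y - L y) - ('d (u k) z (a *: x + y) - L (a *: x + y)).
    have -> : 'd (u k) z (a *: x + y) = a * 'd (u k) z x + 'd (u k) z y by rewrite linearD linearZ.
    by transitivity (L (a *: x + y) - (a * L x + L y)); [|ring].
  apply: le_trans (le_normcB _ _) _; apply: (@le_trans _ _ (e / 4 + e / 4 + e / 4)); last lra.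
  apply: lerD => //; apply: le_trans (le_normcD _ _) _; apply: lerD => //.
  rewrite normcM; apply: le_trans (ler_wpM2l a0 h1) _.
  by rewrite mulrA ler_pdivrMr; [clear -a0 e0; nra|clear -a0; lra].
apply: (@bounded_slices_differentiable g z (Num.min d r) (normc (u N z) + 1 + 1) L) => //.
- by rewrite lt_min d0.
- move=> w; rewrite lt_min => /andP[/hd h1 /(hN N (leqnn _)) h2].
  have := normc_dist_trans (u N w) (g w) 0; rewrite !subr0 -[normc (g w - _)]normcN opprB; lra.
- by move=> w v; rewrite lt_min => /andP[_]; exact: sl.
Qed.

End FrechetDerivative.

(** * The spherical derivative against the sup norm *)

Section SphericalDerivative.
Context {R : realType} {n : nat}.
Local Open Scope complex_scope.
Local Open Scope ring_scope.
Local Notation C := R[i].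
Local Notation Cn := 'rV[C]_n.
Implicit Types (f g : Cn -> C) (z w v : Cn) (r M : R).

Lemma complex_deriv_diff f z v : differentiable f z -> complex_deriv f z v = 'd f z v.
Proof.
move=> df; rewrite [in RHS](row_sum_delta v) linear_sum; apply: eq_bigr => k _.
by rewrite linearZ deriveE// mulrC.
Qed.

Lemma le_normc_nv v k : normc (v 0 k) <= nv v.
Proof.
rewrite leNgt; apply/negP => lt; have := lt; rewrite nv_rV_lt; last first.
  by apply: le_lt_trans lt; exact: nv_ge0.
by move/(_ k); rewrite ltxx.
Qed.

Lemma sqrtr_sqr_ge0 M : 0 <= M -> Num.sqrt (M ^+ 2) = M.
Proof. by move=> M0; rewrite sqrtr_sqr ger0_norm. Qed.

Lemma euclidean_norm_le v : euclidean_norm v <= n%:R * nv v.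
Proof.
have n0 : 0 <= n%:R * nv v by rewrite mulr_ge0 ?nv_ge0.
rewrite -[leRHS]sqrtr_sqr_ge0 // ler_sqrt ?sqr_ge0//.
apply: (@le_trans _ _ (\sum_(k < n) nv v ^+ 2)).
  by apply: ler_sum => k _; rewrite lerXn2r ?nnegrE ?nv_ge0 ?normc_ge0 ?le_normc_nv.
rewrite sumr_const card_ord -[leLHS]mulr_natl exprMn ler_wpM2r ?sqr_ge0//.
by rewrite -natrX ler_nat; case: (n) => // m; rewrite expnS leq_pmulr// expn_gt0.
Qed.

Lemma nv_le_euclidean_norm v : nv v <= euclidean_norm v.
Proof.
apply/ler_addgt0Pr => e e0; apply: ltW; rewrite nv_rV_lt; last first.
  by rewrite ltr_wpDl// sqrtr_ge0.
move=> k; apply: le_lt_trans (_ : euclidean_norm v < _); last by rewrite ltrDl.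
rewrite -[leLHS]sqrtr_sqr_ge0 ?normc_ge0// ler_wsqrtr//.
by rewrite (bigD1 k)//= lerDl sumr_ge0// => j _; rewrite sqr_ge0.
Qed.

Lemma euclidean_normZ (a : C) v : euclidean_norm (a *: v) = normc a * euclidean_norm v.
Proof.
rewrite /euclidean_norm -[normc a]sqrtr_sqr_ge0 ?normc_ge0// -sqrtrM ?sqr_ge0//.
by congr Num.sqrt; rewrite mulr_sumr; apply: eq_bigr => k _; rewrite mxE normcM exprMn.
Qed.

Lemma spherical_derivative_le f z M : (0 < n)%N -> differentiable f z ->
  (forall v, normc ('d f z v) <= M * nv v * (1 + normc (f z) ^+ 2)) ->
  0 <= M -> spherical_derivative f z <= M.
Proof.
move=> n0 df H M0; have p0 := sqr_ge0 (normc (f z)).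
apply: ge_sup => [|_ [v /= v1 <-]].
  (* A unit vector, showing that the supremum is taken over a nonempty set. *)
  pose i0 : 'I_n := Ordinal n0; eexists; exists (delta_mx 0 i0) => //=.
  rewrite /euclidean_norm (bigD1 i0)//= big1 => [|j ji].
    by rewrite mxE !eqxx normc1 expr1n addr0 sqrtr1.
  by rewrite mxE (negbTE ji) andbF normc0 expr0n.
rewrite complex_deriv_diff// ler_pdivrMr; last lra.
apply: le_trans (H v) _; rewrite ler_wpM2r//; first lra.
by rewrite ler_piMr// -v1 nv_le_euclidean_norm.
Qed.

(** The vector is normalised in the Euclidean norm; the factor n, a crude form of its square root,
    is the price of returning to the sup norm. *)
Lemma le_spherical_derivative f z v : differentiable f z ->
  normc ('d f z v) <= n%:R * spherical_derivative f z * nv v * (1 + normc (f z) ^+ 2).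
Proof.
move=> df; have p0 := sqr_ge0 (normc (f z)).
have [->|v0] := eqVneq v 0; first by rewrite linear0 normc0 nv0 mulr0 mul0r.
have e0 : 0 < euclidean_norm v.
  by apply: lt_le_trans (nv_le_euclidean_norm v); rewrite lt_neqAle nv_ge0 eq_sym nv_eq0 v0.
pose v1 := ((euclidean_norm v)^-1)%:C *: v.
have v11 : euclidean_norm v1 = 1.
  by rewrite euclidean_normZ normc_real ger0_norm ?invr_ge0 ?mulVf ?gt_eqF ?ltW.
have H : normc ('d f z v1) / (1 + normc (f z) ^+ 2) <= spherical_derivative f z.
  apply: ub_le_sup; last by exists v1 => //; rewrite complex_deriv_diff.
  (* The supremum of a set in [R] is an upper bound only if the set is bounded; the coordinates of a
     unit vector have modulus at most 1. *)
  exists (\sum_k normc ('D_(delta_mx 0 k) f z)) => _ [w /= w1 <-].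
  rewrite ler_pdivrMr; last lra.
  apply: (@le_trans _ _ (\sum_k normc ('D_(delta_mx 0 k) f z))); last first.
    by rewrite ler_peMr ?sumr_ge0// => [k _|]; [exact: normc_ge0|lra].
  rewrite /complex_deriv; elim/big_ind2: _ => [|x1 x2 y1 y2 h1 h2|k _]; first by rewrite normc0.
    by apply: le_trans (le_normcD _ _) _; exact: lerD.
  rewrite normcM ler_piMr ?normc_ge0//.
  by apply: le_trans (le_normc_nv _ _) _; rewrite -w1 nv_le_euclidean_norm.
have S0 : 0 <= spherical_derivative f z.
  by apply: le_trans H; rewrite divr_ge0 ?normc_ge0//; lra.
move: H; rewrite linearZ [normc (_ *: _)]normcM normc_real ger0_norm; last first.
  by rewrite invr_ge0 ltW.
rewrite ler_pdivrMr; last lra.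
rewrite ler_pdivrMl// => /le_trans; apply; rewrite mulrA ler_wpM2r//; first lra.
by rewrite mulrAC ler_wpM2r// euclidean_norm_le.
Qed.

End SphericalDerivative.

Section NormalFamilies.
Context {R : realType} {n : nat}.
Local Open Scope complex_scope.
Local Open Scope ring_scope.
Local Notation C := R[i].
Local Notation Cn := 'rV[C]_n.
Implicit Types (f g : Cn -> C) (u : nat -> Cn -> C) (D A K : set Cn) (F : set (Cn -> C))
  (E : set C) (z w v : Cn) (r e M : R).

Lemma uniform_cvgP A u g : {uniform A, u k @[k --> \oo] --> g} <->
  forall e, 0 < e -> exists N, forall k, (N <= k)%N -> forall w, A w -> normc (u k w - g w) <= e.
Proof.
split=> [H e e0|H P /uniform_nbhs[S [+ SP]]].
  pose S := [set xy : C * C | ball xy.1 e%:C xy.2].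
  have : nbhs (g : {uniform` A -> C}) [set h | forall y, A y -> S (g y, h y)].
    apply/uniform_nbhs; exists S; split => //; rewrite -entourage_ballE.
    by exists e%:C => //=; rewrite ltcR.
  move=> /H[N _ hN]; exists N => k /hN hk w /hk.
  by rewrite /S /= ball_nv nvB nv_normc => /ltW.
rewrite -entourage_ballE => -[e /= e0 eS].
have eE : e = (complex.Re e)%:C by rewrite RRe_real// gtr0_real.
have e1 : 0 < complex.Re e / 2 by rewrite divr_gt0// -ltcR -eE.
have [N hN] := H _ e1; exists N => // k /hN hk; apply: SP => y /hk hy; apply: eS => /=.
by rewrite eE ball_nv nvB nv_normc; lra.
Qed.

Lemma open_nv D z : open D -> D z -> exists2 r, 0 < r & forall w, nv (w - z) < r -> D w.
Proof. by move=> oD Dz; apply/nbhs_nv/open_nbhs_nbhs. Qed.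

Lemma nv_open D : (forall z, D z -> exists2 r, 0 < r & forall w, nv (w - z) < r -> D w) -> open D.
Proof. by move=> H; rewrite openE => z /H /nbhs_nv. Qed.

Lemma connected_locally_constant D (B : Cn -> Prop) : open D -> connected D ->
  (forall z, D z -> exists2 r, 0 < r & forall w, nv (w - z) < r -> (B w <-> B z)) ->
  forall z w, D z -> D w -> B z -> B w.
Proof.
move=> oD cD hB z w Dz Dw Bz.
have oP (Q : Cn -> Prop) : (forall z, D z -> exists2 r, 0 < r &
    forall w, nv (w - z) < r -> (Q w <-> Q z)) -> open [set x | D x /\ Q x].
  move=> hQ; apply: nv_open => x [Dx Qx]; have [r r0 hr] := open_nv oD Dx.
  have [s s0 hs] := hQ _ Dx; exists (Num.min r s) => [|y]; first by rewrite lt_min r0.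
  by rewrite lt_min => /andP[/hr Dy /hs Qy]; split => //; apply/Qy.
have DB : [set x | D x /\ B x] = D; last by move: Dw; rewrite -DB => -[].
apply: cD; first by exists z.
- exists [set x | D x /\ B x]; first exact: oP.
  by apply/seteqP; split => x [] //= Dx [].
- exists (~` [set x | D x /\ ~ B x]).
    apply: open_closedC; apply: oP => x /hB[r r0 hr]; exists r => // y /hr [h1 h2].
    by split=> h3 h4; apply: h3; auto.
  apply/seteqP; split => x [] //= Dx Bx; split => //; first by case.
  by apply: contrapT => nB; apply: Bx.
Qed.

Lemma totally_bounded_rV : totally_bounded_balls Cn.
Proof.
move=> r e e0; have [s hs] := compact_total_bounded (@compact_polydisc R n 0 r) e0.
exists s => w wr; apply: hs => i /=; rewrite mxE subr0.
by apply: le_trans (le_normc_nv _ _) (ltW wr).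
Qed.

Lemma three_points E : `I_3 #<= E ->
  exists a b c, [/\ a != b, a != c, b != c & [/\ E a, E b & E c]].
Proof.
move=> /pcard_leP[h]; have inj i j : (i < 3)%N -> (j < 3)%N -> i != j -> h i != h j.
  by move=> i3 j3; apply: contra_neq => /(@inj _ _ _ h); apply; rewrite inE.
exists (h 0%N), (h 1%N), (h 2%N); split; try exact: inj.
by split; exact: (@funS _ _ _ _ h).
Qed.

Lemma three_naturals : `I_3 #<= [set (k%:R : C) | k in `I_3].
Proof.
suff : [set (k%:R : C) | k in `I_3] #= `I_3 by move=> /card_eqPle[].
by apply: inj_card_eq => j k _ _ /eqP; rewrite eqr_nat => /eqP.
Qed.

End NormalFamilies.

(** * The two implications *)

Section NormalityCriterion.
Context {R : realType} {n : nat}.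
Local Open Scope complex_scope.
Local Open Scope ring_scope.
Local Notation C := R[i].
Local Notation Cn := 'rV[C]_n.
Implicit Types (f g : Cn -> C) (u : nat -> Cn -> C) (D K : set Cn) (F : set (Cn -> C))
  (E : set C) (z w v : Cn) (r M : R).

Definition bounded_spherical_derivative_on_values D F E :=
  forall K, compact K -> K `<=` D -> exists2 M, 0 < M &
    forall f z, F f -> K z -> E (f z) -> spherical_derivative f z <= M.

(** The one-variable bound is applied at each w to the line in a direction of sup norm 1. Lines of
    radius r / 2 starting within r / 2 of z stay in one compact polydisc, so a single M serves all
    of them. *)
Lemma locally_spherical_bound D F E z : open D -> (forall f, F f -> holomorphic_on D f) ->
  `I_3 #<= E -> bounded_spherical_derivative_on_values D F E -> D z ->
  exists r M, [/\ 0 < r, 0 <= M & forall f, F f -> spherical_bound f z r M].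
Proof.
move=> oD hF /three_points[a [b [c [ab ac bc [Ea Eb Ec]]]]] hE Dz.
have [r0 r00 r0D] := open_nv oD Dz; pose r := r0 / 2.
have rpos : 0 < r by rewrite divr_gt0.
have KD : [set v : Cn | forall i, normc (v 0 i - z 0 i) <= r] `<=` D.
  move=> v hv; apply: r0D; rewrite nv_rV_lt// => i; rewrite !mxE.
  by apply: le_lt_trans (hv i) _; rewrite /r; lra.
have [M M0 hM] := hE _ (@compact_polydisc R n z r) KD.
(* At points with value a, b or c one has |f| <= A, so the bound on f# becomes a bound on the
   derivative itself. *)
pose A := normc a + normc b + normc c; pose M' := n%:R * M * (1 + A ^+ 2).
have [a0 b0 c0] := And3 (normc_ge0 a) (normc_ge0 b) (normc_ge0 c).
have A0 : 0 <= A by rewrite /A; lra.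
have A2 := sqr_ge0 A.
have M'0 : 0 <= M' by rewrite !mulr_ge0 ?(ltW M0)//; lra.
have r2 : 0 < r / 2 by rewrite divr_gt0.
have [B B0 hB] := lappan_bound ab ac bc r2 M'0.
exists (r / 2), B; split => // f Ff w wz v; have df := hF _ Ff.
have wr : nv (w - z) < r0 by rewrite /r in wz; lra.
exists ('d f w v); first exact: differentiable_slice (df _ (r0D _ wr)).
have [->|v0] := eqVneq v 0; first by rewrite linear0 normc0 nv0 mulr0 mul0r.
have vp : 0 < nv v by rewrite lt_neqAle nv_ge0 eq_sym nv_eq0 v0.
pose v1 := ((nv v)^-1)%:C *: v.
have v11 : nv v1 = 1.
  by rewrite nvZ normc_real ger0_norm ?invr_ge0 ?mulVf ?gt_eqF// ltW.
have vv : v = (nv v)%:C *: v1 by rewrite scalerA -rmorphM mulfV ?gt_eqF// scale1r.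
have inr t : normc t < r / 2 -> nv (w + t *: v1 - z) < r.
  move=> ht; apply: le_lt_trans (nv_trans w _ _) _.
  by rewrite addrAC subrr add0r nvZ v11; clear -ht wz; lra.
have rr0 : r < r0 by rewrite /r; clear -r00; lra.
have inD t : normc t < r / 2 -> D (w + t *: v1) by move=> /inr h; apply: r0D; clear -h rr0; lra.
have dt t : normc t < r / 2 -> cder (fun t => f (w + t *: v1)) t ('d f (w + t *: v1) v1).
  by move=> /inD/df dw; apply: slice_cder; exact: differentiable_slice.
have := hB (fun t => f (w + t *: v1)).
rewrite (deriv1E (dt 0 _)) ?normc0// scale0r addr0 => H.
rewrite [v in 'd f w v]vv linearZ [normc _]normcM normc_real ger0_norm ?nv_ge0//.
rewrite [B * _]mulrC -mulrA ler_wpM2l ?nv_ge0//; apply: H => [t|t ht abc].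
  by rewrite subr0 => /dt; eexists; eassumption.
rewrite (deriv1E (dt _ ht)).
apply: le_trans (le_spherical_derivative _ (df _ (inD _ ht))) _.
rewrite v11 mulr1; have E1 : E (f (w + t *: v1)) by case: abc => [->|[->|->]].
have S1 : spherical_derivative f (w + t *: v1) <= M.
  apply: hM => // i; have := inr _ ht; rewrite nv_rV_lt// => /(_ i).
  by rewrite !mxE => /ltW.
have fA : normc (f (w + t *: v1)) <= A by rewrite /A; clear -a0 b0 c0 abc; case: abc => [->|[->|->]]; lra.
have fA2 : normc (f (w + t *: v1)) ^+ 2 <= A ^+ 2 by rewrite lerXn2r ?nnegrE ?normc_ge0.
have p0 := sqr_ge0 (normc (f (w + t *: v1))).
rewrite /M' -!mulrA ler_wpM2l//.
apply: le_trans (ler_wpM2r _ S1) _; first by rewrite addr_ge0.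
by rewrite ler_wpM2l ?lerD2l// ltW.
Qed.

Lemma normal_of_bounded_spherical_derivative D F E : is_domain D ->
  (forall f, F f -> holomorphic_on D f) -> `I_3 #<= E ->
  bounded_spherical_derivative_on_values D F E -> normal_family D F.
Proof.
move=> [_ oD cD] hF E3 hE u Fu.
have [|||phi hphi H] := @marty_normality _ _ D u (totally_bounded_rV (n := n)).
- by move=> z; exact: open_nv.
- by move=> B; apply: connected_locally_constant.
- move=> z /(locally_spherical_bound oD hF E3 hE)[r [M [r0 M0 h]]].
  by exists r, M, 0%N; split => // k _; exact: h.
exists phi => //; case: H => [[g hg]|H]; [left; exists g|right].
- move=> z Dz; have [r r0 hr] := hg z Dz; have [s s0 sD] := open_nv oD Dz.
  apply: (@limit_differentiable _ _ (u \o phi) g z (Num.min r s)).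
  + by rewrite lt_min r0.
  + by move=> k w; rewrite lt_min => /andP[_ /sD]; exact: (hF _ (Fu _)).
  + move=> e /hr[N hN]; exists N => k /hN hk w; rewrite lt_min => /andP[+ _]; exact: hk.
- move=> z /hg[r r0 hr]; exists [set w | nv (w - z) < r]; first by apply/nbhs_nv; exists r.
  by apply/uniform_cvgP => e /hr[N hN]; exists N => k /hN hk w [/hk].
- move=> z /H[r r0 hr]; exists [set w | nv (w - z) < r]; first by apply/nbhs_nv; exists r.
  by move=> A; have [N hN] := hr A; exists N => // k /hN hk w [/hk].
Qed.

Lemma bounded_spherical_derivative_of_normal D F : (0 < n)%N -> open D ->
  (forall f, F f -> holomorphic_on D f) -> normal_family D F ->
  bounded_spherical_derivative_on_values D F [set (k%:R : C) | k in `I_3].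
Proof.
move=> n0 oD hF nF K cK KD; apply: contrapT => H.
have bad (k : nat) : exists fz : (Cn -> C) * Cn, [/\ F fz.1, K fz.2,
    [set (k%:R : C) | k in `I_3] (fz.1 fz.2) & k.+1%:R < spherical_derivative fz.1 fz.2].
  apply: contrapT => nb; apply: H; exists k.+1%:R => [|f z Ff Kz Ez]; first by rewrite ltr0n.
  by rewrite leNgt; apply/negP => hlt; apply: nb; exists (f, z).
have /choice[fz hfz] := bad; pose u k := (fz k).1.
have Fu k : F (u k) by have [] := hfz k.
have [phi hphi cphi] := nF u Fu.
have phi_ge k : (k <= phi k)%N.
  by elim: k => // k IH; apply: leq_ltn_trans IH _; exact: hphi.
(* Since [P] involves k, the near-covering form of compactness reduces a threshold valid on all of
   [K] to one near each point. *)
pose P k z := [set (k%:R : C) | k in `I_3] (u (phi k) z) ->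
  spherical_derivative (u (phi k)) z <= k%:R.
suff : \forall k \near \oo, K `<=` P k.
  move=> [N _ /(_ N (leqnn N)) hN]; have [_ Kz Ez] := hfz (phi N).
  rewrite ltNge => /negP; apply; apply: le_trans (hN _ Kz Ez) _.
  by rewrite ler_nat; apply: leqW; exact: phi_ge.
have := cK => /compact_near_coveringP; apply => z Kz; have Dz := KD _ Kz.
have [s s0 sD] := open_nv oD Dz.
case: cphi => [[g _ cg]|cinf].
  have [U /nbhs_nv[r r0 rU] /uniform_cvgP hU] := cg z Dz.
  have [N hN] := hU 1 ltr01; pose m := Num.min r s.
  have m0 : 0 < m by rewrite /m lt_min r0.
  have zm : nv (z - z) < m by rewrite subrr nv0.
  have inm w : nv (w - z) < m -> U w /\ D w.
    by rewrite lt_min => /andP[/rU ? /sD].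
  have [d d0 hd] := locally_bounded (hF _ (Fu (phi N)) z Dz).
  (* One unit each for passing from u_k to g, from g to u_N, and from u_N(w) to u_N(z). *)
  pose q := Num.min m d; pose B := normc (u (phi N) z) + 3.
  have q0 : 0 < q by rewrite lt_min m0.
  have B0 : 0 <= B by rewrite /B; have := normc_ge0 (u (phi N) z); lra.
  have hB k w : (N <= k)%N -> nv (w - z) < q -> normc (u (phi k) w) <= B.
    move=> hk; rewrite lt_min => /andP[/inm wm /hd h1].
    have h2 := hN _ hk _ wm; have h3 := hN _ (leqnn N) _ wm.
    have h4 := normc_dist_trans (g w) (u (phi k) w) 0.
    have h5 := normc_dist_trans (u (phi N) w) (g w) 0.
    by move: h3 h4 h5; rewrite /= normcB !subr0 /B; move: h2 => /=; lra.
  pose L := 24 * B / (q / 2).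
  have L0 : 0 <= L by rewrite divr_ge0 ?mulr_ge0//; lra.
  have q2 : 0 < q / 2 by lra.
  exists ([set w | nv (w - z) < q / 2], [set k | (maxn N (Num.bound L) <= k)%N]).
    split; first by apply/nbhs_nv; exists (q / 2).
    by exists (maxn N (Num.bound L)).
  move=> [w k] /= [wq]; rewrite geq_max => /andP[Nk Lk] _.
  apply: (@le_trans _ _ L); last first.
    by apply: ltW; apply: lt_le_trans (archi_boundP L0) _; rewrite ler_nat.
  have wq2 x : nv (x - w) < q / 2 -> nv (x - z) < q.
    by move=> hx; apply: le_lt_trans (nv_trans w _ _) _; clear -hx wq; lra.
  have inq x : nv (x - z) < q -> D x.
    by rewrite lt_min => /andP[/inm[]].
  have dk x : nv (x - w) < q / 2 -> differentiable (u (phi k)) x.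
    by move=> /wq2/inq; exact: (hF _ (Fu _)).
  have ww : nv (w - w) < q / 2 by rewrite subrr nv0.
  apply: spherical_derivative_le => //; first exact: dk.
  move=> v; have v0 := nv_ge0 v; have p0 := sqr_ge0 (normc (u (phi k) w)).
  apply: (@le_trans _ _ (L * nv v)); last by rewrite ler_peMr ?lerDl ?(mulr_ge0 L0 v0).
  apply: (@le_slice_cder _ _ (u (phi k)) w _ _ v) => //.
  - by move=> x /wq2; exact: hB.
  - by move=> x y /dk dx; eexists; exact: differentiable_slice.
  - by apply: differentiable_slice; exact: dk.
(* Once |u_k| > 2 near z, none of the values 0, 1, 2 is taken and [P] holds vacuously. *)
have [U /nbhs_nv[r r0 rU] hU] := cinf z Dz; have [N _ hN] := hU 2.
exists ([set w | nv (w - z) < Num.min r s], [set k | (N <= k)%N]).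
  split; first by apply/nbhs_nv; exists (Num.min r s) => //; rewrite lt_min r0.
  by exists N.
move=> [w k] /= [+ Nk]; rewrite lt_min => /andP[/rU Uw /sD Dw] [j j3 jE].
have := hN _ Nk w (conj Uw Dw); rewrite /= -jE normc_nat ltr_nat => j2.
by move: j3; rewrite /= ltnS leqNgt j2.
Qed.

End NormalityCriterion.

Theorem theorem2p3 (R : realType) (n : nat) (D : set 'rV[R[i]]_n)
    (F : set ('rV[R[i]]_n -> R[i])) :
  (0 < n)%N -> is_domain D -> (forall f, F f -> holomorphic_on D f) ->
  normal_family D F <->
  exists2 E : set R[i], `I_3 #<= E &
    forall K : set 'rV[R[i]]_n, compact K -> K `<=` D ->
      exists2 M : R, 0 < M &
        forall f z, F f -> K z -> E (f z) -> spherical_derivative f z <= M.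
Proof.
move=> n0 dD hF; split=> [nF|[E E3 hE]].
  exists [set (k%:R : R[i]) | k in `I_3]; first exact: three_naturals.
  by have [_ oD _] := dD; exact: bounded_spherical_derivative_of_normal.
exact: normal_of_bounded_spherical_derivative dD hF E3 hE.
Qed.
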